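(* For every integer $k\ge 0$, the space $M_k$ of monogenic spinors of degree $k$ on $\mathcal U$ decomposes into irreducible $G_0$-modules as $$M_k\cong\bigoplus_{a,b,l\ge 0,\ 2a+b+2l=k} W_{(\frac52+l+a+b,\ \frac52+l+a)}\otimes V_{(2a+b+1,\ a+b,\ a,\ 0)},$$ where $a,b,l$ range over non-negative integers. Moreover, the decomposition of the space $\bigoplus_{k\ge0}M_k$ of all algebraic (polynomial) monogenic spinors on $\mathcal U$ into irreducible $G_0$-modules is multiplicity free.
   Context: **Groups.** Let $h$ be the non-degenerate symmetric complex bilinear form on $\mathbb C^{10}$ with ordered basis $\{e_1,e_2,e_3,e_4,e_5,\bar e_3,\bar e_4,\bar e_5,\bar e_1,\bar e_2\}$ such that $h(e_i,\bar e_j)=\delta_{ij}$, $h(e_i,e_j)=h(\bar e_i,\bar e_j)=0$ for $1\le i,j\le 5$. Let $G=SO(\mathbb C^{10},h)$, let $P$ be the stabilizer in $G$ of the null plane $x_0=\langle e_1,e_2\rangle$, and let $G_0\cong GL(2,\mathbb C)\times SO(6,\mathbb C)$ be the stabilizer in $P$ of $x_0^c=\langle e_3,e_4,e_5,\bar e_3,\bar e_4,\bar e_5\rangle$. The Lie algebra $\mathfrak g$ of $G$ consists of the matrices (in the ordered basis $\{e_1,e_2,e_3,e_4,e_5,\bar e_3,\bar e_4,\bar e_5,\bar e_1,\bar e_2\}$) $$\begin{pmatrix} A & Y_1 & Y_2 & Y_{12} \\ X_1 & B & D & -Y_2^T \\ X_2 & C & -B^T & -Y_1^T \\ X_{12}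 & -X_2^T & -X_1^T & -A^T \end{pmatrix}$$ with $A\in M(2,\mathbb C)$, $B\in M(3,\mathbb C)$, $C,D$ skew $3\times3$, $X_{12},Y_{12}$ skew $2\times2$, $Y_i,X_i^T\in M(2,3,\mathbb C)$. Here $\mathfrak g_0=\mathrm{Lie}(G_0)$ consists of the blocks $A,B,C,D$, and $\mathfrak g_-=\mathfrak g_{-2}\oplus\mathfrak g_{-1}$ with $\mathfrak g_{-2}$ the block $X_{12}$ and $\mathfrak g_{-1}$ the blocks $X_1,X_2$. Let $G_-=\exp(\mathfrak g_-)$ and $\mathcal U=\pi(G_-)\subset G/P$, where $\pi:G\to G/P$ is the projection. The maps $\exp:\mathfrak g_-\to G_-$ and $\pi:G_-\to\mathcal U$ are biholomorphisms. Coordinates on $\mathfrak g_-\cong\mathcal U$ are $X_1=(x^1_{ij})$, $X_2=(x^2_{ij})$ ($i=1,2,3$, $j=1,2$) and $x_{12}$, where $X_{12}=\begin{pmatrix} 0 & x_{12} \\ -x_{12} & 0 \end{pmatrix}$. **Spinors.** Let $f_0,f_1,f_2,f_3$ be the standard basis of $\mathbb C^4$. Identify $x_0^c\cong\Lambda^2\mathbb C^4$ by sending $e_3,e_4,e_5,\bar e_3,\bar e_4,\bar e_5$ to $f_0\wedge f_1,\ f_0\wedge f_2,\ f_0\wedge f_3,\ f_2\wedge f_3,\ -f_1\wedge f_3,\ f_1\wedge f_2$ respectively. This identifies $SL(4,\mathbb C)\cong Spin(6,\mathbb C)$ and $\mathfrak{sl}(4,\mathbb C)\cong\mathfrak{so}(6,\mathbb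 C)$. Put $\mathbb S_+=\mathbb C^4$ and $\mathbb S_-=(\mathbb C^4)^*\cong\Lambda^3\mathbb C^4$. Let $\mathbb C_\nu$ be the one-dimensional $\mathfrak{gl}(2,\mathbb C)$-module of highest weight $(\frac52,\frac52)$ and $\mathbb C^2_\mu$ the irreducible one of highest weight $(\frac72,\frac52)$. Let $\mathcal V_1=G\times_P(\mathbb C_\nu\otimes\mathbb S_+)$ and $\mathcal V_2=G\times_P(\mathbb C^2_\mu\otimes\mathbb S_-)$. (Since half-integral weights and spin modules occur, $G$ and its subgroups are replaced by the appropriate covers; ''$G_0$-module'' may be read as ''$\mathfrak g_0$-module'', with $\mathfrak g_0\cong\mathfrak{gl}(2,\mathbb C)\oplus\mathfrak{sl}(4,\mathbb C)$.) **The 2-Dirac operator.** Both bundles are trivialized over $\mathcal U$ by the section $\mathcal U\cong G_-\hookrightarrow G$, so sections of $\mathcal V_1$ over $\mathcal U$ are functions $\psi=(\psi_0,\psi_1,\psi_2,\psi_3)=\sum_i\psi_if_i$ on $\mathfrak g_-$ with values in $\mathbb S_+=\mathbb C^4$. The 2-Dirac operator $D_1:\Gamma(\mathcal V_1)\to\Gamma(\mathcal V_2)$ is the $G$-invariant first order operator; up to a non-zero scalar, in this trivialization it is $D_1\psi=(D^{(1)}\psi,D^{(2)}\psi)$ with $$D^{(j)}\psi=\sum_{i=1}^3\big(\bar e_{i+2}\wedge L^1_{ij}\psi+e_{i+2}\wedge L^2_{ij}\psi\big)\in\Lambda^3\mathbb C^4,\qquad j=1,2,$$ where $L^k_{ij}$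 is the left-invariant vector field on $G_-$ extending $\partial/\partial x^k_{ij}$ at the identity. Explicitly, $L^1_{i1}=\partial_{x^1_{i1}}+\frac12x^2_{i2}\partial_{x_{12}}$, $L^1_{i2}=\partial_{x^1_{i2}}-\frac12x^2_{i1}\partial_{x_{12}}$, $L^2_{i1}=\partial_{x^2_{i1}}+\frac12x^1_{i2}\partial_{x_{12}}$, $L^2_{i2}=\partial_{x^2_{i2}}-\frac12x^1_{i1}\partial_{x_{12}}$. A spinor $\psi$ is monogenic if $D_1\psi=0$. **Grading.** On $\mathbb C[x_{12},x^k_{ij}]$ put $\deg x_{12}=2$, $\deg x^k_{ij}=1$, extended additively to monomials. Let $N_k$ be the span of the monomials of degree $k$. $M_k$ is the space of monogenic spinors $\psi$ all of whose components lie in $N_k$. **Action.** $G_0$ acts on sections of $\mathcal V_1$ over $\mathcal U$ by left translation; in the trivialization, $(g\cdot\psi)(X)=g\,\psi(\mathrm{Ad}(g^{-1})X)$ for $X\in\mathfrak g_-$, where $g$ acts on values through $\mathbb C_\nu\otimes\mathbb S_+$. This preserves each $M_k$. **Irreducible modules.** $W_{(a,b)}$ denotes the irreducible $GL(2,\mathbb C)$- (or $\mathfrak{gl}(2,\mathbb C)$-) module of highest weight $(a,b)$, and $V_{(a,b,c,d)}$ the irreducible $SL(4,\mathbb C)$-module of highest weight $(a,b,c,d)$ (weights modulo $(1,1,1,1)$). The block $A$ acts on $x_0\cong\mathbb C^2$ with highest weight $(1,0)$. *)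

(* Defs.v *)
From HB Require Import structures.
From mathcomp Require Import all_boot all_order all_algebra.
From mathcomp Require Import ring mpoly.

Set Implicit Arguments.
Unset Strict Implicit.
Unset Printing Implicit Defensive.

Import GRing.Theory.
Local Open Scope ring_scope.

Record lieAlgebra (F : fieldType) := LieAlgebra {
  lie_sort :> lmodType F;
  lie_br : lie_sort -> lie_sort -> lie_sort;
  lie_br_linl : forall y, linear (fun x => lie_br x y);
  lie_br_linr : forall x, linear (lie_br x);
  lie_br_alt : forall x, lie_br x x = 0;
  lie_br_jacobi : forall x y z,
    lie_br x (lie_br y z) = lie_br (lie_br x y) z + lie_br y (lie_br x z) }.

Record lieModule (F : fieldType) (g : lieAlgebra F) := LieModule {
  lmod_sort :> lmodType F;
  lmod_act : g -> lmod_sort -> lmod_sort;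
  lmod_act_linl : forall v, linear (fun x => lmod_act x v);
  lmod_act_linr : forall x, linear (lmod_act x);
  lmod_act_br : forall x y v,
    lmod_act (lie_br x y) v
      = lmod_act x (lmod_act y v) - lmod_act y (lmod_act x v) }.

Record mxLieRep (F : fieldType) (g : lieAlgebra F) := MxLieRep {
  rep_dim : nat;
  rep_mx :> g -> 'M[F]_rep_dim;
  rep_mx_lin : linear rep_mx;
  rep_mx_br : forall x y,
    rep_mx (lie_br x y) = rep_mx x *m rep_mx y - rep_mx y *m rep_mx x }.

Section Modules.
Variables (F : fieldType) (g : lieAlgebra F).

Definition equivariant (V1 V2 : Type) (act1 : g -> V1 -> V1)
    (act2 : g -> V2 -> V2) (f : V1 -> V2) : Prop :=
  forall x v, f (act1 x v) = act2 x (f v).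

Definition is_submodule (T : lieModule g) (U : T -> Prop) : Prop :=
  [/\ U 0, (forall (a : F) u v, U u -> U v -> U (a *: u + v))
    & (forall x v, U v -> U (lmod_act x v))].

Definition irreducible_module (T : lieModule g) : Prop :=
  (exists v : T, v != 0) /\
  (forall U : T -> Prop, is_submodule U ->
     (forall v, U v -> v = 0) \/ (forall v, U v)).

Definition isomorphic_modules (T1 T2 : lieModule g) : Prop :=
  exists f : {linear T1 -> T2},
    bijective f /\ equivariant (@lmod_act _ _ T1) (@lmod_act _ _ T2) f.

(* [M], a subset of a vector space [S] on which [g] acts by [act], is
   isomorphic to the direct sum of the modules [T i]: an isomorphism
   is given by its restrictions [Phi i] to the summands, and an element of the
   direct sum by its components on a finite set [s] of indices. *)
Definition iso_direct_sum (S : lmodType F) (act : g -> S -> S) (M : S -> Prop)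
    (I : eqType) (T : I -> lieModule g) : Prop :=
  exists Phi : forall i, {linear T i -> S},
    [/\ forall i, equivariant (@lmod_act _ _ (T i)) act (Phi i),
        forall psi, M psi <->
          exists (s : seq I) (t : forall i, T i),
            uniq s /\ psi = \sum_(i <- s) Phi i (t i)
      & forall (s : seq I) (t : forall i, T i), uniq s ->
          \sum_(i <- s) Phi i (t i) = 0 -> forall i, i \in s -> t i = 0].

Definition multiplicity_free (S : lmodType F) (act : g -> S -> S)
    (M : S -> Prop) : Prop :=
  exists (I : eqType) (T : I -> lieModule g),
    [/\ forall i, irreducible_module (T i),
        forall i j, isomorphic_modules (T i) (T j) -> i = j
      & iso_direct_sum act M T].

Section RepModule.
Variable rho : mxLieRep g.

Definition rep_act (x : g) (v : 'cV[F]_(rep_dim rho)) := rho x *m v.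

Fact rep_act_linl v : linear (fun x => rep_act x v).
Proof. by move=> a x y; rewrite /rep_act rep_mx_lin mulmxDl scalemxAl. Qed.

Fact rep_act_linr x : linear (rep_act x).
Proof. by move=> a u v; rewrite /rep_act mulmxDr scalemxAr. Qed.

Fact rep_act_br x y v :
  rep_act (lie_br x y) v = rep_act x (rep_act y v) - rep_act y (rep_act x v).
Proof. by rewrite /rep_act rep_mx_br mulmxBl !mulmxA. Qed.

Definition rep_module : lieModule g :=
  LieModule rep_act_linl rep_act_linr rep_act_br.

End RepModule.

End Modules.

Section LieAlgebras.
Variable F : fieldType.

Definition mxbr (n : nat) (A B : 'M[F]_n) : 'M[F]_n := A *m B - B *m A.

Fact mxbr_linl n (B : 'M[F]_n) : linear (fun A => mxbr A B).
Proof.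
move=> a A A'; rewrite /mxbr mulmxDl mulmxDr -scalemxAl -scalemxAr.
by rewrite scalerBr opprD addrACA.
Qed.

Fact mxbr_linr n (A : 'M[F]_n) : linear (mxbr A).
Proof.
move=> a B B'; rewrite /mxbr mulmxDl mulmxDr -scalemxAl -scalemxAr.
by rewrite scalerBr opprD addrACA.
Qed.

Fact mxbr_alt n (A : 'M[F]_n) : mxbr A A = 0.
Proof. exact: subrr. Qed.

Fact mxbr_jacobi n (A B C : 'M[F]_n) :
  mxbr A (mxbr B C) = mxbr (mxbr A B) C + mxbr B (mxbr A C).
Proof.
rewrite /mxbr !mulmxBl !mulmxBr !mulmxA.
move: (A *m B *m C) (A *m C *m B) (B *m A *m C) (B *m C *m A)
  (C *m A *m B) (C *m B *m A) => abc acb bac bca cab cba.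
by apply/matrixP=> i j; rewrite !mxE; ring.
Qed.

Definition gl (n : nat) : lieAlgebra F :=
  LieAlgebra (@mxbr_linl n) (@mxbr_linr n) (@mxbr_alt n) (@mxbr_jacobi n).

Definition traceless (n : nat) : {pred 'M[F]_n} := [pred Z | \tr Z == 0].
Arguments traceless : clear implicits.

Fact traceless_submod_closed n : submod_closed (traceless n).
Proof.
split=> [|a A B]; rewrite !inE ?mxtrace0 // => /eqP trA /eqP trB.
by rewrite mxtraceD mxtraceZ trA trB mulr0 addr0.
Qed.

HB.instance Definition _ n := GRing.isSubmodClosed.Build F 'M[F]_n (traceless n)
  (traceless_submod_closed n).

Record sl_type (n : nat) := SlMx { sl_mx :> 'M[F]_n; _ : sl_mx \in traceless n }.

HB.instance Definition _ n := [isSub for @sl_mx n].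
HB.instance Definition _ n := [Choice of sl_type n by <:].
HB.instance Definition _ n := [SubChoice_isSubLmodule of sl_type n by <:].

Fact mxbr_traceless n (A B : 'M[F]_n) : mxbr A B \in traceless n.
Proof. by rewrite inE /mxbr raddfB /= mxtrace_mulC subrr. Qed.

Definition slbr n (A B : sl_type n) : sl_type n := SlMx (mxbr_traceless A B).

Fact slbr_linl n (B : sl_type n) : linear (fun A => slbr A B).
Proof. by move=> a A A'; apply: val_inj; rewrite /= mxbr_linl. Qed.

Fact slbr_linr n (A : sl_type n) : linear (slbr A).
Proof. by move=> a B B'; apply: val_inj; rewrite /= mxbr_linr. Qed.

Fact slbr_alt n (A : sl_type n) : slbr A A = 0.
Proof. by apply: val_inj; rewrite /= mxbr_alt. Qed.

Fact slbr_jacobi n (A B C : sl_type n) :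
  slbr A (slbr B C) = slbr (slbr A B) C + slbr B (slbr A C).
Proof. by apply: val_inj; rewrite /= mxbr_jacobi. Qed.

Definition sl (n : nat) : lieAlgebra F :=
  LieAlgebra (@slbr_linl n) (@slbr_linr n) (@slbr_alt n) (@slbr_jacobi n).

Section Product.
Variables g1 g2 : lieAlgebra F.

Definition prod_br (x y : (g1 * g2)%type) : (g1 * g2)%type :=
  (lie_br x.1 y.1, lie_br x.2 y.2).

Fact prod_br_linl y : linear (fun x => prod_br x y).
Proof. by move=> a u v; congr (_, _); rewrite /= lie_br_linl. Qed.

Fact prod_br_linr x : linear (prod_br x).
Proof. by move=> a u v; congr (_, _); rewrite /= lie_br_linr. Qed.

Fact prod_br_alt x : prod_br x x = 0.
Proof. by congr (_, _); rewrite /= lie_br_alt. Qed.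

Fact prod_br_jacobi x y z :
  prod_br x (prod_br y z) = prod_br (prod_br x y) z + prod_br y (prod_br x z).
Proof. by congr (_, _); rewrite /= lie_br_jacobi. Qed.

Definition prod_lie : lieAlgebra F :=
  LieAlgebra prod_br_linl prod_br_linr prod_br_alt prod_br_jacobi.

(* The external tensor product of [F^n] and [F^m] is the space of n x m
   matrices, [u *m v^T] being the tensor of [u] and [v]. *)
Section Tensor.
Variables (W : mxLieRep g1) (V : mxLieRep g2).
Local Notation WV := 'M[F]_(rep_dim W, rep_dim V).

Definition tensor_act (x : prod_lie) (w : WV) : WV :=
  W x.1 *m w + w *m (V x.2)^T.

Fact tensor_act_linl w : linear (fun x => tensor_act x w).
Proof.
move=> a x y; rewrite /tensor_act /= !rep_mx_lin linearP mulmxDl mulmxDr.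
by rewrite -scalemxAl -scalemxAr scalerDr addrACA.
Qed.

Fact tensor_act_linr x : linear (tensor_act x).
Proof.
move=> a u v; rewrite /tensor_act mulmxDl mulmxDr.
by rewrite -scalemxAl -scalemxAr scalerDr addrACA.
Qed.

Fact tensor_act_br x y w :
  tensor_act (lie_br x y) w
    = tensor_act x (tensor_act y w) - tensor_act y (tensor_act x w).
Proof.
rewrite /tensor_act /= !rep_mx_br linearB /= !trmx_mul mulmxBl mulmxBr.
rewrite !mulmxDl !mulmxDr !mulmxA.
move: (W x.1 *m W y.1 *m w) (W y.1 *m W x.1 *m w) (w *m _ *m _) (w *m _ *m _)
  (W x.1 *m w *m _) (W y.1 *m w *m _) => a b c d e f.
by apply/matrixP=> i j; rewrite !mxE; ring.
Qed.

Definition tensor_module : lieModule prod_lie :=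
  LieModule tensor_act_linl tensor_act_linr tensor_act_br.

End Tensor.
End Product.
End LieAlgebras.

Section HighestWeight.
Variables (F : fieldType) (n : nat).

(* [mx] realizes [g] as a Lie algebra of n x n matrices containing the strictly
   upper triangular ones (the nilradical) and whose diagonal elements form the
   Cartan subalgebra. A weight [lambda] is the linear form
   diag(t_1, ..., t_n) |-> sum_i lambda_i t_i. For sl(n) this only depends on
   [lambda] modulo (1, ..., 1). *)
Definition is_highest_weight (g : lieAlgebra F) (mx : g -> 'M[F]_n)
    (rho : mxLieRep g) (lambda : n.-tuple F) : Prop :=
  exists v : rep_module rho,
    [/\ v != 0,
        forall x : g, (forall i j : 'I_n, (j <= i)%N -> mx x i j = 0) ->
          lmod_act x v = 0
      & forall x : g, is_diag_mx (mx x) ->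
          lmod_act x v = (\sum_i tnth lambda i * mx x i i) *: v].

Definition is_irrep_gl (rho : mxLieRep (gl F n)) (lambda : n.-tuple F) : Prop :=
  irreducible_module (rep_module rho) /\
  is_highest_weight (fun x : gl F n => x) rho lambda.

Definition is_irrep_sl (rho : mxLieRep (sl F n)) (lambda : n.-tuple F) : Prop :=
  irreducible_module (rep_module rho) /\
  is_highest_weight (fun x : sl F n => sl_mx x) rho lambda.

End HighestWeight.

(* [None] is x_12 and [Some (k, i, j)] is x^(k+1)_(i+1, j+1); here and below
   indices start from 0. *)
Definition coord : finType := option ('I_2 * 'I_3 * 'I_2).
Definition x12 : coord := None.
Definition x1 (i : 'I_3) (j : 'I_2) : coord := Some (ord0, i, j).
Definition x2 (i : 'I_3) (j : 'I_2) : coord := Some (ord_max, i, j).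

Definition coord_deg (c : coord) : nat := if c is None then 2 else 1.

Definition mnm_deg (m : 'X_{1..#|{: coord}|}) : nat :=
  (\sum_(c : coord) coord_deg c * m (enum_rank c))%N.

Fact mnm_deg0 : mnm_deg 0%MM = 0%N.
Proof. by rewrite /mnm_deg big1 // => c _; rewrite mnm0E muln0. Qed.

Fact mnm_degD : {morph mnm_deg : m1 m2 / (m1 + m2)%MM >-> (m1 + m2)%N}.
Proof.
move=> m1 m2; rewrite /mnm_deg -big_split /=.
by apply: eq_bigr => c _; rewrite mnmDE mulnDr.
Qed.

HB.instance Definition _ :=
  isMeasure.Build #|{: coord}| mnm_deg mnm_deg0 mnm_degD.

Definition spinor (F : fieldType) : Type :=
  {ffun 'I_4 -> {mpoly F[#|{: coord}|]}}.
HB.instance Definition _ F := GRing.Lmodule.on (spinor F).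

Section Spinors.
Variable F : fieldType.
Local Notation poly := {mpoly F[#|{: coord}|]}.

Definition var (c : coord) : poly := 'X_(enum_rank c).
Definition pder (c : coord) (p : poly) : poly := p^`M(enum_rank c).

(* The left-invariant vector fields extending the partial derivatives with
   respect to x^1_ij and x^2_ij; [rev_ord] exchanges the two values of [j]. *)
Definition L1 (i : 'I_3) (j : 'I_2) (p : poly) : poly :=
  pder (x1 i j) p
    + ((-1) ^+ j / 2%:R) *: (var (x2 i (rev_ord j)) * pder x12 p).
Definition L2 (i : 'I_3) (j : 'I_2) (p : poly) : poly :=
  pder (x2 i j) p
    + ((-1) ^+ j / 2%:R) *: (var (x1 i (rev_ord j)) * pder x12 p).

(* Exterior powers of F^4 are represented by antisymmetric tensors: [ext2 p q]
   is f_p ^ f_q, and [wedge21 w u p q r] is, for p < q < r, the coefficient of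
   f_p ^ f_q ^ f_r in w ^ u. *)
Definition ext2 (p q : 'I_4) : 'M[F]_4 := delta_mx p q - delta_mx q p.

Definition wedge21 (w : 'M[F]_4) (u : 'I_4 -> poly) (p q r : 'I_4) : poly :=
  w p q *: u r + w q r *: u p + w r p *: u q.

Local Notation f0 := (inord 0 : 'I_4).
Local Notation f1 := (inord 1 : 'I_4).
Local Notation f2 := (inord 2 : 'I_4).
Local Notation f3 := (inord 3 : 'I_4).

(* The images in Lambda^2 F^4 of e_3, e_4, e_5 and of their h-duals. *)
Definition vec_e (i : 'I_3) : 'M[F]_4 :=
  tnth [tuple ext2 f0 f1; ext2 f0 f2; ext2 f0 f3] i.
Definition vec_ebar (i : 'I_3) : 'M[F]_4 :=
  tnth [tuple ext2 f2 f3; - ext2 f1 f3; ext2 f1 f2] i.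

Definition dirac2 (psi : spinor F) (j : 'I_2) (p q r : 'I_4) : poly :=
  \sum_(i < 3) (wedge21 (vec_ebar i) (fun s => L1 i j (psi s)) p q r
                + wedge21 (vec_e i) (fun s => L2 i j (psi s)) p q r).

Definition monogenic (psi : spinor F) : Prop :=
  forall (j : 'I_2) (p q r : 'I_4), dirac2 psi j p q r = 0.

Definition monogenic_of_degree (k : nat) (psi : spinor F) : Prop :=
  monogenic psi /\ (forall s, psi s \is k.-homog for mnm_deg).

Definition monogenic_sum (psi : spinor F) : Prop :=
  exists (n : nat) (phi : nat -> spinor F),
    (forall k, monogenic_of_degree k (phi k)) /\ psi = \sum_(k < n) phi k.

Definition g0 : lieAlgebra F := prod_lie (gl F 2) (sl F 4).

(* Coordinates of an element of Lambda^2 F^4 in the basis e_3, e_4, e_5 and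
   their h-duals. *)
Definition ext2_coord (w : 'M[F]_4) : 'cV[F]_(3 + 3) :=
  col_mx (\col_i tnth [tuple w f0 f1; w f0 f2; w f0 f3] i)
         (\col_i tnth [tuple w f2 f3; - w f1 f3; w f1 f2] i).

Definition ext2_basis (i : 'I_(3 + 3)) : 'M[F]_4 :=
  match split i with inl i1 => vec_e i1 | inr i2 => vec_ebar i2 end.

(* sl(4) -> so(6): the derivation w |-> Z w + w Z^T that [Z] induces on
   Lambda^2 F^4. *)
Definition so6_of_sl4 (Z : 'M[F]_4) : 'M[F]_(3 + 3) :=
  \matrix_(i, j)
     ext2_coord (Z *m ext2_basis j + ext2_basis j *m Z^T) i 0.

Definition g0_mx (x : g0) : 'M[F]_(2 + (3 + 3 + 2)) :=
  block_mx x.1 0 0 (block_mx (so6_of_sl4 x.2) 0 0 (- x.1^T)).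

(* The generic element of g_-, the coordinates being indeterminates. *)
Definition gminus_mx : 'M[poly]_(2 + (3 + 3 + 2)) :=
  let X1 := \matrix_(i < 3, j < 2) var (x1 i j) in
  let X2 := \matrix_(i < 3, j < 2) var (x2 i j) in
  let X12 := block_mx 0 (var x12)%:M (- var x12)%:M 0 : 'M_(1 + 1) in
  block_mx 0 0 (col_mx (col_mx X1 X2) X12)
    (block_mx 0 0 (row_mx (- X2^T) (- X1^T)) 0).

Definition gminus_coord (N : 'M[poly]_(2 + (3 + 3 + 2))) (c : coord) : poly :=
  let X := usubmx (dlsubmx N) : 'M_(3 + 3, 2) in
  let X12 := dsubmx (dlsubmx N) : 'M_2 in
  match c with
  | None => X12 ord0 ord_max
  | Some (k, i, j) => if k == ord0 then usubmx X i j else dsubmx X i j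
  end.

(* The coordinates of [x, X], as linear polynomials in those of X. *)
Definition ad_coord (x : g0) (c : coord) : poly :=
  let Z := map_mx (@mpolyC _ F) (g0_mx x) in
  gminus_coord (Z *m gminus_mx - gminus_mx *m Z) c.

(* The derivative at the identity of (g . psi)(X) = g psi(Ad(g^-1) X), where
   gl(2) acts on C_nu by 5/2 of the trace:
   (x . psi)(X) = x psi(X) - (d psi)_X([x, X]). *)
Definition spinor_act (x : g0) (psi : spinor F) : spinor F :=
  [ffun s => (5%:R / 2%:R * \tr x.1) *: psi s
             + \sum_(t < 4) sl_mx x.2 s t *: psi t
             - \sum_(c : coord) ad_coord x c * pder c (psi s)].

End Spinors.

Definition decomp_index (k : nat) : eqType :=
  {t : nat * nat * nat | (2 * t.1.1 + t.1.2 + 2 * t.2)%N == k}.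

Section Weights.
Variable F : fieldType.

Definition W_weight (t : nat * nat * nat) : 2.-tuple F :=
  let: (a, b, l) := t in
  [tuple 5%:R / 2%:R + (l + a + b)%:R; 5%:R / 2%:R + (l + a)%:R].

Definition V_weight (t : nat * nat * nat) : 4.-tuple F :=
  let: (a, b, l) := t in
  [tuple (2 * a + b + 1)%:R; (a + b)%:R; a%:R; 0].

End Weights.

(* Main.v *)
(* The Fischer form <f, g> = (f(d) g^bar)(0) on polynomial spinors is positive
   definite, and the adjoint of the action of x in g_0 is the action of its
   conjugate transpose. Hence orthogonal complements of submodules are submodules,
   a highest weight vector generates an irreducible module, highest weight
   vectors of different weights generate orthogonal modules, and M_k, being finite
   dimensional, is the sum of the modules generated by its singular vectors (those
   killed by the strictly upper triangular elements). Such a module is the tensor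
   product of the modules generated by the two factors of g_0.

   Arrange x^1_ij and x^2_ij into antisymmetric 4 x 4 matrices X_1, X_2. With
   y = X_1^{23} and Delta = X_1^{23} X_2^{13} - X_1^{13} X_2^{23}, the spinors
   y^b Delta^a f_0 are singular and monogenic. An element of g_2 acts
   by a g_0-equivariant operator N (up to a character) which preserves
   monogenicity and raises degrees by 2; the commutator relation
   d/dx_12 N^l psi = c_l N^{l-1} psi with c_l <> 0, for psi independent of x_12,
   shows that N^l y^b Delta^a f_0 is a nonzero singular spinor of the weight stated.

   Conversely let psi be singular and monogenic. If d psi/dx_12 = 0, contracting
   the Dirac equations with X and using the raising operators of sl(4) leaves only
   psi = f f_0 with f a polynomial in four of the variables which is singular for
   the remaining raising operators, and f is a combination of the y^b Delta^a. In
   general d psi/dx_12 is again singular and monogenic, so that by induction on the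
   degree it agrees with d/dx_12 of a combination of the N^l y^b Delta^a f_0. *)

From HB Require Import structures.
Require Import Defs.
From mathcomp Require Import all_boot all_order all_algebra.
From mathcomp Require Import reals complex.
From mathcomp Require Import ring zify mpoly.
From Stdlib Require Import ClassicalEpsilon.

Set Implicit Arguments.
Unset Strict Implicit.
Unset Printing Implicit Defensive.

Import Order.TTheory GRing.Theory Num.Theory.
Import Defs.
Local Open Scope ring_scope.

(** Complete reducibility and the uniqueness of highest weight vectors come from a single mechanism:
    lowering elements are adjoint to raising ones for a definite form, so a singular vector
    orthogonal to the generator of a cyclic module is orthogonal to the whole module. That every
    nonzero stable subspace contains a singular vector comes from a height which raising elements
    increase and which is bounded on spinors of fixed degree. The concrete operators are derivations
    plus multiplication by polynomials. A commutator of derivations is a derivation, so each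
    relation between vector fields is checked on [t] and on the entries of [X j] only, where it
    becomes a polynomial identity. Antisymmetric matrices are used because sl(4) then acts by matrix
    multiplication, without so(6), and the Dirac operator becomes the contraction sum_r L^{sr}
    psi_r, close in shape to the raising operators of sl(4). On the kernel of d/dx_12 the fields L
    are plain partial derivatives; this makes that case tractable, and division by the nonzero
    constants c_l lifts its solutions to the general case. *)

Definition pbool (P : Prop) : bool :=
  if excluded_middle_informative P then true else false.

Lemma pboolP P : reflect P (pbool P).
Proof. by rewrite /pbool; case: excluded_middle_informative => ?; constructor. Qed.

(** * Subspaces and Hermitian forms *)

Section Subspaces.
Variables (K : fieldType) (S : lmodType K).

Definition subspace (U : S -> Prop) : Prop :=
  U 0 /\ forall (a : K) u v, U u -> U v -> U (a *: u + v).

Lemma subspaceD U u v : subspace U -> U u -> U v -> U (u + v).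
Proof. by case=> _ U_lin Uu Uv; rewrite -[u]scale1r; apply: U_lin. Qed.

Lemma subspaceZ U a u : subspace U -> U u -> U (a *: u).
Proof. by case=> U0 U_lin Uu; rewrite -[_ *: _]addr0; apply: U_lin. Qed.

Lemma subspaceB U u v : subspace U -> U u -> U v -> U (u - v).
Proof.
by move=> sU Uu Uv; apply: subspaceD => //; rewrite -scaleN1r; apply: subspaceZ.
Qed.

Lemma subspace_sum U (I : Type) (r : seq I) (P : pred I) (f : I -> S) :
  subspace U -> (forall i, P i -> U (f i)) -> U (\sum_(i <- r | P i) f i).
Proof.
move=> sU Uf; elim/big_rec: _ => [|i u Pi Uu]; first by case: sU.
by apply: subspaceD => //; apply: Uf.
Qed.

Definition lincomb n (b : 'I_n -> S) (c : 'cV[K]_n) : S := \sum_i c i 0 *: b i.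

Lemma lincomb_is_linear n (b : 'I_n -> S) : linear (lincomb b).
Proof.
move=> a c d; rewrite /lincomb scaler_sumr -big_split; apply: eq_bigr => i _.
by rewrite !mxE scalerDl scalerA.
Qed.
HB.instance Definition _ n (b : 'I_n -> S) :=
  GRing.isLinear.Build K 'cV[K]_n S _ (lincomb b) (lincomb_is_linear b).

Lemma lincomb_delta n (b : 'I_n -> S) i : lincomb b (delta_mx i 0) = b i.
Proof.
rewrite /lincomb (bigD1 i) //= big1 => [|j /negPf ne_ji]; rewrite mxE ?eqxx.
  by rewrite scale1r addr0.
by rewrite ne_ji scale0r.
Qed.

Definition is_basis n (b : 'I_n -> S) (U : S -> Prop) : Prop :=
  (forall c, lincomb b c = 0 -> c = 0) /\
  (forall u, U u <-> exists c, u = lincomb b c).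

Lemma is_basis_mem n (b : 'I_n -> S) U i : is_basis b U -> U (b i).
Proof. by case=> _ ->; exists (delta_mx i 0); rewrite lincomb_delta. Qed.

(** A matrix of maximal rank whose row space consists of coordinate vectors of elements of [U]
    exhausts [U]: a missing vector could be adjoined and would raise the rank. Membership in [U] is
    a mere proposition, so the maximum is taken classically through [pbool]. *)
Lemma subspace_basis n (a : 'I_n -> S) M U : is_basis a M -> subspace U ->
  (forall u, U u -> M u) -> exists d (b : 'I_d -> S), is_basis b U.
Proof.
move=> [a_free a_span] [U0 U_lin] UM.
pose good r := exists B : 'M[K]_n, \rank B = r /\ forall c : 'rV_n, (c <= B)%MS -> U (lincomb a c^T).
have good0 : exists r, pbool (good r).
  exists 0%N; apply/pboolP; exists 0; split; first exact: mxrank0.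
  by move=> c; rewrite submx0 => /eqP->; rewrite trmx0 linear0.
have good_le r : pbool (good r) -> (r <= n)%N.
  by move=> /pboolP[B [<- _]]; apply: rank_leq_row.
have [r /pboolP[B [rB UB]] r_max] := ex_maxnP good0 good_le.
exists (\rank B), (fun i => lincomb a (row i (row_base B))^T).
have lc c : lincomb (fun i => lincomb a (row i (row_base B))^T) c = lincomb a (c^T *m row_base B)^T.
  rewrite mulmx_sum_row (raddf_sum (@trmx _ _ _)) (raddf_sum (lincomb a)) /=.
  by apply: eq_bigr => i _; rewrite mxE linearZ /= linearZ.
split=> [c|u].
  rewrite lc => /a_free/(congr1 trmx); rewrite trmxK trmx0 => cB0.
  apply: trmx_inj; apply: (row_free_inj (row_base_free B)).
  by rewrite cB0 trmx0 mul0mx.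
split=> [Uu|[c ->]]; last first.
  by rewrite lc; apply: UB; rewrite -(eq_row_base B) submxMl.
have [c Dc] := (a_span u).1 (UM u Uu).
have [|ncB] := boolP (c^T <= row_base B)%MS.
  by case/submxP=> d Dd; exists d^T; rewrite lc trmxK -Dd trmxK.
have gB : good (\rank (B + c^T)%MS).
  exists (B + c^T)%MS; split=> // d /sub_addsmxP[[d1 d2] /= ->].
  have -> : (d1 *m B + d2 *m c^T)^T = d2 0 0 *: c + (d1 *m B)^T.
    by rewrite [d2 in LHS]mx11_scalar mul_scalar_mx addrC linearD linearZ /= trmxK.
  by rewrite (linearP (lincomb a)) /= -Dc; apply: U_lin => //; apply: UB; rewrite submxMl.
have /pboolP/r_max := gB; rewrite leqNgt -rB => /negP[]; apply: rank_ltmx.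
rewrite ltmxE addsmxSl; apply: contra ncB => le_B.
by rewrite eq_row_base; apply: submx_trans le_B; apply: addsmxSr.
Qed.
End Subspaces.

Section HermitianForms.
Variables (K : numClosedFieldType) (S : lmodType K).

Record hermitian_form := HermitianForm {
  hform :> S -> S -> K;
  hform_linear : forall w, scalar (hform^~ w);
  hform_sym : forall u v, hform u v = (hform v u)^*;
  hform_definite : forall u, hform u u = 0 -> u = 0 }.

Variable form : hermitian_form.

Definition hform_left w u := form u w.
HB.instance Definition _ w :=
  GRing.isLinear.Build K S K _ (hform_left w) (hform_linear form w).

Lemma hformDl u v w : form (u + v) w = form u w + form v w.
Proof. exact: (linearD (hform_left w)). Qed.
Lemma hformBl u v w : form (u - v) w = form u w - form v w.
Proof. exact: (linearB (hform_left w)). Qed.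
Lemma hformZl a u w : form (a *: u) w = a * form u w.
Proof. exact: (linearZ_LR (hform_left w)). Qed.
Lemma hform0l w : form 0 w = 0.
Proof. exact: (linear0 (hform_left w)). Qed.
Lemma hform_suml I (r : seq I) (P : pred I) f w :
  form (\sum_(i <- r | P i) f i) w = \sum_(i <- r | P i) form (f i) w.
Proof. exact: (linear_sum (hform_left w)). Qed.
Lemma hform0r w : form w 0 = 0.
Proof. by rewrite hform_sym hform0l conjC0. Qed.
Lemma hformZr a u w : form w (a *: u) = a^* * form w u.
Proof. by rewrite hform_sym hformZl rmorphM /= -(hform_sym form). Qed.
Lemma hformDr u v w : form w (u + v) = form w u + form w v.
Proof. by rewrite hform_sym hformDl rmorphD /= -!(hform_sym form). Qed.
Lemma hform_eq0 u v : form u v = 0 -> form v u = 0.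
Proof. by move=> uv0; rewrite hform_sym uv0 conjC0. Qed.

Lemma subspace_orthl w : subspace (fun u => form u w = 0).
Proof.
split=> [|a u v uw vw]; first exact: hform0l.
by rewrite hformDl hformZl uw vw mulr0 addr0.
Qed.

Lemma subspace_orthr w : subspace (fun u => form w u = 0).
Proof.
split=> [|a u v uw vw]; first exact: hform0r.
by rewrite hformDr hformZr uw vw mulr0 addr0.
Qed.

Section Coordinates.
Variables (n : nat) (b : 'I_n -> S).

Definition gram : 'M[K]_n := \matrix_(j, i) form (b i) (b j).
(** Solution of the normal equations. It is linear on all of [S]; outside the span of a basis [b] it
    gives the coordinates of the orthogonal projection. *)
Definition coord_in (u : S) : 'cV[K]_n :=
  invmx gram *m \col_j form u (b j).

Lemma gram_mul c : gram *m c = \col_j form (lincomb b c) (b j).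
Proof.
apply/colP=> j; rewrite !mxE hform_suml; apply: eq_bigr => i _.
by rewrite mxE hformZl mulrC.
Qed.

Lemma gram_unit U : is_basis b U -> gram \in unitmx.
Proof.
case=> b_free _; rewrite -unitmx_tr -row_free_unit; apply: inj_row_free => c cG.
have Gc : gram *m c^T = 0 by rewrite -[gram]trmxK -trmx_mul cG trmx0.
apply: trmx_inj; rewrite trmx0; apply: b_free; apply: (hform_definite (h := form)).
rewrite {2}/lincomb hform_sym hform_suml big1 ?conjC0 // => i _.
have /colP/(_ i) := Gc; rewrite gram_mul !mxE => lci.
by rewrite hformZl [form (b i) _]hform_sym lci conjC0 mulr0.
Qed.

Lemma coord_in_is_linear : linear coord_in.
Proof.
move=> a u v; rewrite /coord_in scalemxAr -mulmxDr; congr (_ *m _).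
by apply/colP=> j; rewrite !mxE hformDl hformZl.
Qed.
HB.instance Definition _ :=
  GRing.isLinear.Build K S 'cV[K]_n _ coord_in coord_in_is_linear.

Variable U : S -> Prop.
Hypothesis bU : is_basis b U.

Lemma lincombK c : coord_in (lincomb b c) = c.
Proof. by rewrite /coord_in -gram_mul mulKmx // (gram_unit bU). Qed.

Lemma coord_inK u : U u -> lincomb b (coord_in u) = u.
Proof. by case/bU.2=> c ->; rewrite lincombK. Qed.

Lemma coord_in_orth u w : U w -> form (u - lincomb b (coord_in u)) w = 0.
Proof.
case/bU.2=> c ->; set v := _ - _.
rewrite /lincomb; apply: (@subspace_sum _ _ (fun w => form v w = 0)) => [|j _].
  exact: subspace_orthr.
apply: (@subspaceZ _ _ (fun w => form v w = 0)); first exact: subspace_orthr.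
rewrite /v hformBl; apply/eqP; rewrite subr_eq0.
have : (gram *m coord_in u) j 0 = form u (b j).
  by rewrite /coord_in mulKVmx ?(gram_unit bU) // mxE.
by rewrite gram_mul mxE => ->.
Qed.

End Coordinates.
End HermitianForms.

(** * Cyclic modules of a unitary action *)

Section Cyclic.
Variables (K : fieldType) (S : lmodType K) (g : lieAlgebra K).
Variable act : g -> S -> S.

Definition stable (U : S -> Prop) : Prop :=
  subspace U /\ forall x u, U u -> U (act x u).

(** The submodule generated by [v], as the intersection of the stable subspaces containing it: a
    property of its elements is proved by exhibiting a stable subspace. *)
Definition cyclic (v w : S) : Prop := forall U, stable U -> U v -> U w.

Lemma cyclic_stable v : stable (cyclic v).
Proof.
split=> [|x u vu U sU Uv]; last by apply: sU.2; apply: vu.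
split=> [U [[U0 _] _] //|a u w vu vw U sU Uv].
by apply: sU.1.2; [apply: vu | apply: vw].
Qed.

Lemma cyclic_subspace v : subspace (cyclic v).
Proof. exact: (cyclic_stable v).1. Qed.

Lemma cyclic_refl v : cyclic v v. Proof. by move=> U. Qed.

(** A finite filtration in which each element of [np] moves one step up; it supplies what Engel's
    theorem would and restricts to subsets of [M]. *)
Definition nilpotent_on (np : g -> Prop) (M : S -> Prop) : Prop :=
  exists (H : nat) (F : nat -> S -> Prop),
    [/\ forall u, M u -> F 0%N u, forall u, F H u -> u = 0
      & forall x h u, np x -> F h u -> F h.+1 (act x u)].

Lemma nilpotent_sub np (M M' : S -> Prop) :
  (forall u, M' u -> M u) -> nilpotent_on np M -> nilpotent_on np M'.
Proof. by move=> sub [H [F [F0 FH Fn]]]; exists H, F; split=> // u /sub/F0. Qed.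

(** While some raising element does not kill [u], it gives another nonzero vector of [U] one step
    higher in the filtration. This stops after at most [H] steps. *)
Lemma singular_vector np M U : nilpotent_on np M -> stable U ->
  (forall u, U u -> M u) -> (exists2 u, U u & u != 0) ->
  exists v, [/\ U v, v != 0 & forall x, np x -> act x v = 0].
Proof.
case=> H [F [F0 FH Fn]] sU UM [u Uu nz_u].
have key n : (n <= H)%N -> forall u, U u -> u != 0 -> F (H - n)%N u ->
    exists v, [/\ U v, v != 0 & forall x, np x -> act x v = 0]; last first.
  by apply: (key H (leqnn H) u) => //; rewrite subnn; apply/F0/UM.
elim: n => [|n IHn] lt_nH {}u {}Uu {}nz_u Fu.
  by rewrite subn0 in Fu; rewrite (FH _ Fu) eqxx in nz_u.
case: (classic (exists2 x, np x & act x u != 0)) => [[x npx nz_xu]|all0].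
  apply: (IHn (ltnW lt_nH) (act x u)); [exact: sU.2 | exact: nz_xu |].
  by rewrite (_ : H - n = (H - n.+1).+1)%N; [apply: Fn | rewrite -subSn].
exists u; split=> // x npx; apply/eqP/negPn/negP => nz_xu.
by case: all0; exists x.
Qed.

End Cyclic.

Section UnitaryActions.
Variables (K : numClosedFieldType) (S : lmodType K) (form : hermitian_form S).

(** [np], [nm] and [bo] stand for the raising, the lowering and the Borel elements, [star] for the
    conjugate transpose. *)
Record unitary_action (g : lieAlgebra K) (star : g -> g) (np nm bo : g -> Prop)
    (act : g -> S -> S) : Prop := UnitaryAction {
  ua_linl : forall v, linear (act^~ v);
  ua_linr : forall x, linear (act x);
  ua_br : forall x y v, act (lie_br x y) v = act x (act y v) - act y (act x v);
  ua_adj : forall x u w, form (act x u) w = form u (act (star x) w);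
  ua_star : forall x, nm x -> np (star x);
  ua_triangular : forall x, exists y z, [/\ x = y + z, nm y & bo z] }.

Section OneAlgebra.
Variables (g : lieAlgebra K) (star : g -> g) (np nm bo : g -> Prop).
Variable act : g -> S -> S.
Hypothesis uact : unitary_action star np nm bo act.

Local Notation cyc := (cyclic act).

Lemma actD x u v : act x (u + v) = act x u + act x v.
Proof. by rewrite -[u]scale1r (ua_linr uact) !scale1r. Qed.

Lemma act0 x : act x 0 = 0.
Proof. by apply: (addrI (act x 0)); rewrite -actD !addr0. Qed.

Lemma actZ x a u : act x (a *: u) = a *: act x u.
Proof. by rewrite -[a *: u]addr0 (ua_linr uact) act0 addr0. Qed.

Lemma act_sum x I (r : seq I) (P : pred I) (f : I -> S) :
  act x (\sum_(i <- r | P i) f i) = \sum_(i <- r | P i) act x (f i).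
Proof. by apply: (big_morph _ (actD x)); apply: act0. Qed.

Lemma actDl x y u : act (x + y) u = act x u + act y u.
Proof. by rewrite -[x]scale1r (ua_linl uact u) !scale1r. Qed.

Lemma act0l u : act 0 u = 0.
Proof. by apply: (addrI (act 0 u)); rewrite -actDl !addr0. Qed.

Definition singular (v : S) : Prop := forall x, np x -> act x v = 0.

Definition hw_vector (v : S) : Prop :=
  [/\ v != 0, singular v & forall x, bo x -> exists c, act x v = c *: v].

Lemma orth_stable U : stable act U -> stable act (fun w => forall u, U u -> form w u = 0).
Proof.
move=> sU; split=> [|x u uU w Uw]; last by rewrite (ua_adj uact) uU //; apply: sU.2.
split=> [u _|a u v uU vU w Uw]; first exact: hform0l.
by rewrite hformDl hformZl uU // vU // mulr0 addr0.
Qed.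

Section HighestWeightVector.
Variable v : S.
Hypothesis hv : hw_vector v.

(** Takes the place of the Poincare-Birkhoff-Witt theorem: starting from a highest weight vector,
    lowering elements alone reach the whole cyclic module. *)
Lemma cyclic_lower U : subspace U -> U v ->
  (forall x u, nm x -> U u -> U (act x u)) -> forall w, cyc v w -> U w.
Proof.
move=> sU Uv Unm.
pose C w := forall U, subspace U -> U v -> (forall x u, nm x -> U u -> U (act x u)) -> U w.
have sC : subspace C.
  split=> [U' [] //|a u w Cu Cw U' sU' U'v U'nm].
  by apply: sU'.2; [apply: Cu | apply: Cw].
have Cv : C v by [].
have Cnm x u : nm x -> C u -> C (act x u).
  by move=> nmx Cu U' sU' U'v U'nm; apply: (U'nm _ _ nmx); apply: Cu.
(* [C] is closed under lowering elements by construction. To get all of [g], show that [C'] contains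
   [v], by the triangular decomposition, and is closed under lowering elements x, by y (x w) =
   [y, x] w + x (y w). *)
pose C' w := C w /\ forall x, C (act x w).
have C'v : C' v.
  split=> // x; have [y [z [-> nmy boz]]] := ua_triangular uact x.
  rewrite actDl; have [_ _ /(_ z boz)[c ->]] := hv.
  by apply: (subspaceD sC (Cnm _ _ nmy Cv)); apply: (subspaceZ c sC Cv).
have sC' : subspace C'.
  split=> [|a u w [Cu C'u] [Cw C'w]].
    by split=> [|x]; rewrite ?act0; case: sC.
  by split=> [|x]; rewrite ?(ua_linr uact); apply: sC.2.
have C'nm x u : nm x -> C' u -> C' (act x u).
  move=> nmx [Cu C'u]; split=> [|y]; first exact: C'u.
  rewrite -[act y _](subrK (act x (act y u))) -(ua_br uact).
  exact: (subspaceD sC (C'u (lie_br y x)) (Cnm _ _ nmx (C'u y))).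
have CC' w : C w -> C' w by move=> Cw; apply: Cw.
have stC : stable act C by split=> // x u /CC'[].
by move=> w cw; apply: (cw C stC Cv).
Qed.

(** The adjoint of a lowering element is a raising one and kills [w], so everything obtained by
    lowering is orthogonal to [w]. *)
Lemma cyclic_orth w u : singular w -> form v w = 0 -> cyc v u -> form u w = 0.
Proof.
move=> sw vw; apply: (@cyclic_lower (fun u => form u w = 0)) => //.
  exact: subspace_orthl.
by move=> x u' nmx _; rewrite (ua_adj uact) sw ?hform0r //; apply: (ua_star uact nmx).
Qed.

Lemma hform_hw_neq0 : form v v != 0.
Proof. by apply/eqP=> /(hform_definite (h := form)) v0; case: hv; rewrite v0 eqxx. Qed.

(** Subtracting the projection onto [v] leaves a singular vector of the cyclic module that is
    orthogonal to [v], hence to the whole cyclic module and to itself. *)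
Lemma cyclic_singular w : cyc v w -> singular w -> exists c, w = c *: v.
Proof.
move=> cw sw; exists (form w v / form v v); apply/eqP; rewrite -subr_eq0; apply/eqP.
set c := _ / _; have swc : singular (w - c *: v).
  move=> x npx; rewrite -scaleN1r addrC (ua_linr uact) sw // actZ.
  by have [_ -> // _] := hv; rewrite !scaler0 addr0.
have orth : form (w - c *: v) v = 0.
  by rewrite hformBl hformZl /c divfK ?subrr // hform_hw_neq0.
apply: (hform_definite (h := form)); apply: cyclic_orth => //; first exact: hform_eq0.
have scyc := cyclic_subspace act v.
exact: (subspaceB scyc cw (subspaceZ c scyc (@cyclic_refl _ _ _ _ v))).
Qed.

Lemma cyclic_irreducible U : nilpotent_on act np (cyc v) -> stable act U ->
  (forall u, U u -> cyc v u) -> (exists2 u, U u & u != 0) ->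
  forall u, cyc v u -> U u.
Proof.
move=> nilp sU UM nzU u cu.
have [w [Uw nz_w sw]] := singular_vector nilp sU UM nzU.
have [c Dw] := cyclic_singular (UM w Uw) sw.
apply: cu => //; have nz_c : c != 0.
  by apply: contraNneq nz_w => c0; rewrite Dw c0 scale0r.
by rewrite -[v](scalerK nz_c) -Dw; apply: (subspaceZ _ sU.1 Uw).
Qed.

Lemma cyclic_irreducible_module (T : lieModule g) (f : {linear T -> S}) :
  nilpotent_on act np (cyc v) -> injective f ->
  equivariant (@lmod_act _ _ T) act f ->
  (forall u, cyc v u <-> exists t, u = f t) ->
  irreducible_module T.
Proof.
move=> nilp f_inj f_eq imf; split.
  have [t Dt] := (imf v).1 (@cyclic_refl _ _ _ _ v); exists t.
  by apply/eqP=> t0; case: hv; rewrite Dt t0 linear0 eqxx.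
move=> U [U0 U_lin U_act]; case: (classic (exists2 t, U t & t != 0)) => [[t Ut nz_t]|none].
  right=> t'; pose fU u := exists2 t, U t & u = f t.
  have sfU : stable act fU.
    split=> [|x _ [s Us ->]]; last by exists (lmod_act x s); [apply: U_act | rewrite f_eq].
    split=> [|a _ _ [s Us ->] [s' Us' ->]]; first by exists 0; rewrite ?linear0.
    by exists (a *: s + s'); [apply: U_lin | rewrite linearP].
  have fUc u : fU u -> cyc v u by case=> s _ ->; apply/imf; exists s.
  have nz_fU : exists2 u, fU u & u != 0.
    by exists (f t); [exists t | rewrite -(linear0 f) (inj_eq f_inj)].
  have ct' : cyc v (f t') by apply/imf; exists t'.
  by have [s Us /f_inj->] := cyclic_irreducible nilp sfU fUc nz_fU ct'.
left=> t Ut; apply/eqP/negPn/negP => nz_t; by case: none; exists t.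
Qed.

End HighestWeightVector.
End OneAlgebra.
End UnitaryActions.

Lemma eq_mulmx_col (K : fieldType) m n (A B : 'M[K]_(m, n)) :
  (forall c : 'cV_n, A *m c = B *m c) -> A = B.
Proof.
move=> eqAB; apply/matrixP=> i j.
by have /colP/(_ i) := eqAB (delta_mx j 0); rewrite -!colE !mxE.
Qed.

Section BasisRepresentation.
Variables (K : numClosedFieldType) (S : lmodType K) (form : hermitian_form S).
Variables (g : lieAlgebra K) (star : g -> g) (np nm bo : g -> Prop).
Variable act : g -> S -> S.
Hypothesis uact : unitary_action form star np nm bo act.
Variables (n : nat) (b : 'I_n -> S) (U : S -> Prop).
Hypotheses (bU : is_basis b U) (stU : stable act U).

Definition basis_mx (x : g) : 'M[K]_n :=
  \matrix_(i, j) coord_in form b (act x (b j)) i 0.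

Lemma basis_mx_mul x c : basis_mx x *m c = coord_in form b (act x (lincomb b c)).
Proof.
rewrite /lincomb (act_sum uact) linear_sum /=.
under eq_bigr do rewrite (actZ uact) linearZ /=.
by apply/colP=> i; rewrite mxE summxE; apply: eq_bigr => j _; rewrite [basis_mx x i j]mxE [RHS]mxE mulrC.
Qed.

Lemma lincomb_basis_mx x c :
  lincomb b (basis_mx x *m c) = act x (lincomb b c).
Proof. by rewrite basis_mx_mul (coord_inK form bU) //; apply/stU.2/bU.2; exists c. Qed.

Lemma basis_mx_linear : linear basis_mx.
Proof.
move=> a x y; apply: eq_mulmx_col => c.
by rewrite mulmxDl -scalemxAl !basis_mx_mul (ua_linl uact) linearP.
Qed.

Lemma basis_mx_br x y :
  basis_mx (lie_br x y) = basis_mx x *m basis_mx y - basis_mx y *m basis_mx x.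
Proof.
apply: eq_mulmx_col => c; rewrite mulmxBl -!mulmxA.
by rewrite !basis_mx_mul !(coord_inK form bU) ?(ua_br uact) ?linearB //;
  apply/stU.2/bU.2; exists c.
Qed.

Definition basis_rep : mxLieRep g := MxLieRep basis_mx_linear basis_mx_br.

Lemma lincomb_equivariant :
  equivariant (@lmod_act _ _ (rep_module basis_rep)) act (lincomb b).
Proof. by move=> x c; rewrite lincomb_basis_mx. Qed.

Lemma lincomb_inj : injective (lincomb b).
Proof. exact: can_inj (lincombK form bU). Qed.

Lemma basis_rep_eigen v x c : U v -> act x v = c *: v ->
  lmod_act (l := rep_module basis_rep) x (coord_in form b v) = c *: coord_in form b v.
Proof.
by move=> Uv Dv; rewrite /= /rep_act /= basis_mx_mul (coord_inK form bU) // Dv linearZ.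
Qed.

End BasisRepresentation.

(** * Operators generated by the action, and cyclic modules of a product of Lie algebras *)

Section OperatorAlgebra.
Variables (K : numClosedFieldType) (S : lmodType K) (form : hermitian_form S).
Variables (g : lieAlgebra K) (star : g -> g) (np nm bo : g -> Prop).
Variable act : g -> S -> S.
Hypothesis uact : unitary_action form star np nm bo act.

(** Up to pointwise equality, the image of the universal enveloping algebra. Working with operators
    instead of vectors allows those of one factor to be moved past those of the other. *)
Inductive op_alg : (S -> S) -> Prop :=
| op_id : op_alg id
| op_lin a A B : op_alg A -> op_alg B -> op_alg (fun u => a *: A u + B u)
| op_act x A : op_alg A -> op_alg (fun u => act x (A u)).

Lemma op_alg_cyclic v w : cyclic act v w -> exists2 A, op_alg A & w = A v.
Proof.
move=> vw; apply: (vw (fun w => exists2 A, op_alg A & w = A v)); last by exists id => //; apply: op_id.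
split=> [|x _ [A opA ->]]; last by exists (fun u => act x (A u)) => //; apply: op_act.
split=> [|a _ _ [A opA ->] [B opB ->]].
  exists (fun u => -1 *: id u + id u); first by apply: op_lin; apply: op_id.
  by rewrite scaleN1r addNr.
by exists (fun u => a *: A u + B u) => //; apply: op_lin.
Qed.

Lemma op_alg_stable A U u : op_alg A -> stable act U -> U u -> U (A u).
Proof.
move=> opA sU; elim: opA u => [//|a {}A B _ IHA _ IHB|x {}A _ IHA] u Uu.
  by apply: sU.1.2; [apply: IHA | apply: IHB].
by apply: sU.2; apply: IHA.
Qed.

Lemma op_alg_linear A : op_alg A -> linear A.
Proof.
elim=> [//|a {}A B _ IHA _ IHB|x {}A _ IHA] k u v.
  rewrite IHA IHB !scalerDr !scalerA [a * k]mulrC addrACA.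
  by rewrite -!scalerA -scalerDr.
by rewrite IHA (ua_linr uact).
Qed.

Lemma op_alg_commute (B : S -> S) A : linear B ->
  (forall x u, B (act x u) = act x (B u)) -> op_alg A -> forall u, A (B u) = B (A u).
Proof.
move=> linB comB; elim=> [//|a {}A A' _ IHA _ IHA'|x {}A _ IHA] u.
  by rewrite IHA IHA' linB.
by rewrite IHA comB.
Qed.

(** Closure under right multiplication, which the constructors do not give directly; it is needed
    because adjoints reverse products. *)
Lemma op_alg_comp_act x A : op_alg A -> op_alg (fun u => A (act x u)).
Proof.
elim=> [|a {}A B _ opA _ opB|y {}A _ opA].
- exact: (op_act x op_id).
- exact: (op_lin a opA opB).
- exact: (op_act y opA).
Qed.

Lemma op_alg_adjoint A : op_alg A ->
  exists2 A', op_alg A' & forall u w, form (A u) w = form u (A' w).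
Proof.
elim=> [|a {}A B _ [A' opA' adjA] _ [B' opB' adjB]|x {}A _ [A' opA' adjA]].
- by exists id => //; apply: op_id.
- exists (fun u => a^* *: A' u + B' u); first exact: op_lin.
  by move=> u w; rewrite hformDl hformZl adjA adjB hformDr hformZr conjCK.
- exists (fun u => A' (act (star x) u)); first exact: op_alg_comp_act.
  by move=> u w; rewrite (ua_adj uact) adjA.
Qed.

End OperatorAlgebra.

Lemma linear_lincomb (K : fieldType) (S S' : lmodType K) (f : S -> S') n
    (b : 'I_n -> S) (c : 'cV[K]_n) :
  linear f -> f (lincomb b c) = \sum_i c i 0 *: f (b i).
Proof.
move=> lf; pose fl : {linear S -> S'} := HB.pack f (GRing.isLinear.Build K S S' _ f lf).
by apply: etrans (linear_sum fl _ _ _) _; apply: eq_bigr => i _; apply: (linearZ_LR fl).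
Qed.

Lemma linear_scale (K : fieldType) (S S' : lmodType K) (f : S -> S') c u :
  linear f -> f (c *: u) = c *: f u.
Proof.
move=> lf; pose fl : {linear S -> S'} := HB.pack f (GRing.isLinear.Build K S S' _ f lf).
exact: (linearZ_LR fl).
Qed.

Section TensorMap.
Variables (K : fieldType) (S : lmodType K) (n1 n2 : nat).
Variable e : 'I_n1 -> 'I_n2 -> S.

Definition tensor_map (m : 'M[K]_(n1, n2)) : S := \sum_i \sum_j m i j *: e i j.

Lemma tensor_map_linear : linear tensor_map.
Proof.
move=> c u w; rewrite /tensor_map scaler_sumr -big_split; apply: eq_bigr => i _.
rewrite scaler_sumr -big_split; apply: eq_bigr => j _.
by rewrite !mxE scalerDl scalerA.
Qed.
HB.instance Definition _ :=
  GRing.isLinear.Build K 'M[K]_(n1, n2) S _ tensor_map tensor_map_linear.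
End TensorMap.

Section ProductAlgebra.
Variables (K : numClosedFieldType) (S : lmodType K) (form : hermitian_form S).
Variables g1 g2 : lieAlgebra K.
Variables (star1 : g1 -> g1) (np1 nm1 bo1 : g1 -> Prop).
Variables (star2 : g2 -> g2) (np2 nm2 bo2 : g2 -> Prop).
Local Notation g := (prod_lie g1 g2).
Variable act : g -> S -> S.

Definition prod_star (x : g) : g := (star1 x.1, star2 x.2).
Definition prod_pred (p1 : g1 -> Prop) (p2 : g2 -> Prop) (x : g) : Prop :=
  p1 x.1 /\ p2 x.2.
Local Notation np := (prod_pred np1 np2).
Local Notation nm := (prod_pred nm1 nm2).
Local Notation bo := (prod_pred bo1 bo2).

Hypothesis uact : unitary_action form prod_star np nm bo act.
Hypothesis at0_1 : [/\ star1 0 = 0, np1 0, nm1 0 & bo1 0].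
Hypothesis at0_2 : [/\ star2 0 = 0, np2 0, nm2 0 & bo2 0].

Definition act_fst (x : g1) : S -> S := act ((x, 0) : g).
Definition act_snd (y : g2) : S -> S := act ((0, y) : g).

Lemma lie_br0r (h : lieAlgebra K) (x : h) : lie_br x 0 = 0.
Proof. by apply: (addIr (lie_br x 0)); rewrite -{1}[lie_br x 0]scale1r -lie_br_linr scale1r !add0r. Qed.

Lemma lie_br0l (h : lieAlgebra K) (x : h) : lie_br 0 x = 0.
Proof.
by apply: (addIr (lie_br 0 x)); rewrite -{1}[lie_br 0 x]scale1r -(lie_br_linl x) scale1r !add0r.
Qed.

Lemma act_split x y u : act ((x, y) : g) u = act_fst x u + act_snd y u.
Proof.
rewrite -(actDl uact); congr (act _ u).
by rewrite [RHS]/GRing.add /= /GRing.add /= /add_pair /= addr0 add0r.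
Qed.

Lemma act_fst_snd x y u : act_fst x (act_snd y u) = act_snd y (act_fst x u).
Proof.
apply/eqP; rewrite -subr_eq0 -(ua_br uact); apply/eqP.
have -> : lie_br ((x, 0) : g) ((0, y) : g) = 0 :> g.
  by rewrite /= /prod_br /= lie_br0r lie_br0l.
exact: (act0l uact).
Qed.

Lemma fst_unitary : unitary_action form star1 np1 nm1 bo1 act_fst.
Proof.
have [s1 p1 m1 o1] := at0_1; have [s2 p2 m2 o2] := at0_2; split.
- move=> v a x y; rewrite /act_fst -(ua_linl uact); congr (act _ v).
  by congr (_, _); rewrite /= scaler0 addr0.
- by move=> x; apply: (ua_linr uact).
- move=> x y v; rewrite /act_fst -(ua_br uact); congr (act _ v).
  by congr (_, _); rewrite /= lie_br0r.
- by move=> x u w; rewrite /act_fst (ua_adj uact) /prod_star /= s2.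
- by move=> x nmx; case: (ua_star uact (x := (x, 0))).
- move=> x; have [y [z [/(congr1 fst)/= -> [my _] [oz _]]]] := ua_triangular uact (x, 0).
  by exists y.1, z.1.
Qed.

Lemma snd_unitary : unitary_action form star2 np2 nm2 bo2 act_snd.
Proof.
have [s1 p1 m1 o1] := at0_1; have [s2 p2 m2 o2] := at0_2; split.
- move=> v a x y; rewrite /act_snd -(ua_linl uact); congr (act _ v).
  by congr (_, _); rewrite /= scaler0 addr0.
- by move=> x; apply: (ua_linr uact).
- move=> x y v; rewrite /act_snd -(ua_br uact); congr (act _ v).
  by congr (_, _); rewrite /= lie_br0r.
- by move=> x u w; rewrite /act_snd (ua_adj uact) /prod_star /= s1.
- by move=> x nmx; case: (ua_star uact (x := (0, x))).
- move=> x; have [y [z [/(congr1 snd)/= -> [_ my] [_ oz]]]] := ua_triangular uact (0, x).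
  by exists y.2, z.2.
Qed.

Variables (v : S) (n : nat) (a : 'I_n -> S) (M : S -> Prop).
Hypotheses (hv : hw_vector np bo act v).
Hypotheses (stM : stable act M) (Mv : M v) (aM : is_basis a M).
Hypothesis nilM : nilpotent_on act np M.

Lemma fst_hw_vector : hw_vector np1 bo1 act_fst v.
Proof.
have [s2 p2 m2 o2] := at0_2; have [nz_v sv ev] := hv.
by split=> // x ?; [apply: sv | apply: ev].
Qed.

Lemma snd_hw_vector : hw_vector np2 bo2 act_snd v.
Proof.
have [s1 p1 m1 o1] := at0_1; have [nz_v sv ev] := hv.
by split=> // x ?; [apply: sv | apply: ev].
Qed.

Lemma stable_fst U : stable act U -> stable act_fst U.
Proof. by case=> sU aU; split=> // x u; apply: aU. Qed.

Lemma stable_snd U : stable act U -> stable act_snd U.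
Proof. by case=> sU aU; split=> // x u; apply: aU. Qed.

Lemma cyclic_sub U : stable act U -> U v -> forall w, cyclic act v w -> U w.
Proof. by move=> stU Uv w vw; apply: vw. Qed.

Lemma cyclic_fst_sub w : cyclic act_fst v w -> cyclic act v w.
Proof. by apply; [apply/stable_fst/cyclic_stable | apply: cyclic_refl]. Qed.

Lemma cyclic_snd_sub w : cyclic act_snd v w -> cyclic act v w.
Proof. by apply; [apply/stable_snd/cyclic_stable | apply: cyclic_refl]. Qed.

(* The two factors commute, so the lowering operators of one factor are adjoint
   to raising operators which kill the cyclic module of the other factor. *)
Lemma hform_cyclic_mul w u : cyclic act_fst v w -> cyclic act_snd v u ->
  form v v * form w u = form w v * form v u.
Proof.
move=> vw vu; have hv1 := fst_hw_vector.
have singu : singular np1 act_fst u.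
  move=> x npx; apply: (vu (fun u => act_fst x u = 0)); last by case: hv1 => _ ->.
  split=> [|y u' xu']; last by rewrite act_fst_snd xu' (act0 snd_unitary).
  split=> [|c u1 u2 xu1 xu2]; first exact: (act0 fst_unitary).
  by rewrite (ua_linr fst_unitary) xu1 xu2 scaler0 addr0.
have [_ singv _] := hv1.
apply: (cyclic_lower fst_unitary hv1 (U := fun w => form v v * form w u = form w v * form v u)) vw => //.
  split=> [|c w1 w2 e1 e2]; first by rewrite !hform0l mulr0 mul0r.
  by rewrite !hformDl !hformZl mulrDr mulrCA e1 e2 mulrDl mulrA.
move=> x w' nmx _; have npx := ua_star fst_unitary nmx.
by rewrite !(ua_adj fst_unitary) singu // singv // !hform0r mulr0 mul0r.
Qed.

(** The basis vectors of the two cyclic modules are written A_i v and B_j v, and [Phi] sends the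
    matrix unit (i, j) to A_i B_j v. Equivariance holds because operators of different factors
    commute; injectivity is read off the Gram matrices. *)
Lemma tensor_isomorphism : exists (W : mxLieRep g1) (V : mxLieRep g2)
    (Phi : {linear tensor_module W V -> S}),
  [/\ [/\ irreducible_module (rep_module W), irreducible_module (rep_module V)
        & irreducible_module (tensor_module W V)],
      exists2 w : rep_module W, w != 0 &
        forall x c, act_fst x v = c *: v -> lmod_act x w = c *: w,
      exists2 w : rep_module V, w != 0 &
        forall x c, act_snd x v = c *: v -> lmod_act x w = c *: w,
      equivariant (@lmod_act _ _ (tensor_module W V)) act Phi
    & injective Phi /\ forall u, cyclic act v u <-> exists t, u = Phi t].
Proof.
have hv1 := fst_hw_vector; have hv2 := snd_hw_vector.
have u1 := fst_unitary; have u2 := snd_unitary.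
have [nz_v _ _] := hv; have nz_vv := hform_hw_neq0 form hv.
have cM := cyclic_sub stM Mv.
have c1M w (cw : cyclic act_fst v w) := cM w (cyclic_fst_sub cw).
have c2M w (cw : cyclic act_snd v w) := cM w (cyclic_snd_sub cw).
have [d1 [b1 bW]] := subspace_basis aM (cyclic_subspace act_fst v) c1M.
have [d2 [b2 bV]] := subspace_basis aM (cyclic_subspace act_snd v) c2M.
have stW := cyclic_stable act_fst v; have stV := cyclic_stable act_snd v.
pose W := basis_rep u1 bW stW; pose V := basis_rep u2 bV stV.
have [A DA] : exists A : 'I_d1 -> S -> S, forall i, op_alg act_fst (A i) /\ b1 i = A i v.
  have exA i : exists A, op_alg act_fst A /\ b1 i = A v.
    by have [A opA ->] := op_alg_cyclic (is_basis_mem i bW); exists A.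
  by have [A DA] := fin_all_exists exA; exists A.
have [B DB] : exists B : 'I_d2 -> S -> S, forall i, op_alg act_snd (B i) /\ b2 i = B i v.
  have exB i : exists B, op_alg act_snd B /\ b2 i = B v.
    by have [B opB ->] := op_alg_cyclic (is_basis_mem i bV); exists B.
  by have [B DB] := fin_all_exists exB; exists B.
have linA i := op_alg_linear u1 (DA i).1; have linB j := op_alg_linear u2 (DB j).1.
have comAB i j u : A i (B j u) = B j (A i u).
  apply: (op_alg_commute (linB j)) (DA i).1 u => x u'.
  by rewrite (op_alg_commute (ua_linr u1 x) _ (DB j).1) // => y u''; rewrite act_fst_snd.
have comA i y u : A i (act_snd y u) = act_snd y (A i u).
  by apply: (op_alg_commute (ua_linr u2 y)) (DA i).1 u => x u'; rewrite act_fst_snd.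
pose Phi := tensor_map (fun i j => A i (B j v)) : {linear tensor_module W V -> S}.
(* Two ways of summing: by columns the inner combination lies in the module of the first factor, by
   rows in that of the second. *)
have Phi1 m : Phi m = \sum_j B j (lincomb b1 (col j m)).
  rewrite /Phi /= /tensor_map exchange_big; apply: eq_bigr => j _.
  rewrite (linear_lincomb _ _ (linB j)); apply: eq_bigr => i _.
  by rewrite mxE (DA i).2 comAB.
have Phi2 m : Phi m = \sum_i A i (lincomb b2 (row i m)^T).
  rewrite /Phi /= /tensor_map; apply: eq_bigr => i _.
  rewrite (linear_lincomb _ _ (linA i)); apply: eq_bigr => j _.
  by rewrite !mxE (DB j).2.
have Phi_eq : equivariant (@lmod_act _ _ (tensor_module W V)) act Phi.
  move=> [x y] m; rewrite /= /tensor_act (linearD Phi) /= act_split; congr (_ + _).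
    rewrite !Phi1 (act_sum u1); apply: eq_bigr => j _.
    rewrite (_ : col j (W x *m m) = basis_mx form act_fst b1 x *m col j m); last by rewrite !colE mulmxA.
    rewrite (lincomb_basis_mx u1 bW stW) (op_alg_commute (ua_linr u1 x) _ (DB j).1) // => z u.
    by rewrite act_fst_snd.
  rewrite !Phi2 (act_sum u2); apply: eq_bigr => i _.
  by rewrite row_mul trmx_mul trmxK (lincomb_basis_mx u2 bV stV) comA.
(* Up to [form v v], the Gram matrix of the vectors A_i B_j v is the Kronecker product of those of
   [b1] and [b2]: move A_i' to the left and B_j to the right, then apply [hform_cyclic_mul]. *)
have key i j i' j' : form v v * form (A i (B j v)) (A i' (B j' v))
    = form (b1 i) (b1 i') * form (b2 j) (b2 j').
  have [A' opA' adjA] := op_alg_adjoint u1 (DA i').1.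
  have [B' opB' adjB] := op_alg_adjoint u2 (DB j).1.
  rewrite [form (A i _) _]hform_sym adjA -hform_sym.
  rewrite comAB (op_alg_commute (linB j) _ opA') => [|x u]; last first.
    by rewrite (op_alg_commute (ua_linr u1 x) _ (DB j).1) // => z u'; rewrite act_fst_snd.
  rewrite adjB hform_cyclic_mul; first last.
  - by apply: (op_alg_stable opB' stV); rewrite -(DB j').2; apply: is_basis_mem bV.
  - by apply: (op_alg_stable opA' stW); rewrite -(DA i).2; apply: is_basis_mem bW.
  rewrite -adjB (DB j).2 (DB j').2; congr (_ * _).
  by rewrite [LHS]hform_sym -adjA -hform_sym (DA i).2 (DA i').2.
have Phi_inj : injective Phi.
  apply: raddf_inj => m Phi_m.
  have G1 := gram_unit form bW; have G2 := gram_unit form bV.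
  (* Pairing [Phi m] with every A_i' B_j' v sandwiches [m] between two invertible Gram matrices. *)
  suff G0 : gram form b1 *m m *m (gram form b2)^T = 0.
    rewrite -unitmx_tr in G2; rewrite -[m](mulKmx G1) -[gram form b1 *m m](mulmxK G2).
    by rewrite G0 mul0mx mulmx0.
  apply/matrixP=> i' j'; rewrite [RHS]mxE -(mulr0 (form v v)).
  rewrite -(hform0l form (A i' (B j' v))) -Phi_m mxE.
  rewrite /Phi /= /tensor_map hform_suml mulr_sumr.
  under eq_bigr do rewrite mxE mulr_suml.
  rewrite exchange_big; apply: eq_bigr => i _; rewrite hform_suml mulr_sumr.
  apply: eq_bigr => j _; rewrite hformZl mulrCA key !mxE; ring.
have imPhi u : cyclic act v u <-> exists t, u = Phi t.
  split=> [vu|[m ->]]; last first.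
    have scyc := cyclic_subspace act v; rewrite /Phi /= /tensor_map.
    apply: (@subspace_sum _ _ (cyclic act v) _ _ _ _ scyc) => i _.
    apply: (@subspace_sum _ _ (cyclic act v) _ _ _ _ scyc) => j _; apply: (@subspaceZ _ _ (cyclic act v) _ _ scyc).
    apply: (op_alg_stable (DA i).1 (stable_fst (cyclic_stable act v))).
    apply: (op_alg_stable (DB j).1 (stable_snd (cyclic_stable act v))).
    exact: cyclic_refl.
  apply: (vu (fun u => exists t, u = Phi t)).
    split=> [|x _ [t ->]]; last by exists (lmod_act x t); rewrite Phi_eq.
    split=> [|c _ _ [t ->] [t' ->]]; first by exists 0; rewrite linear0.
    by exists (c *: t + t'); rewrite linearP.
  (* [v] is the image of the rank one matrix made of its coordinates in the two bases. *)
  exists (coord_in form b1 v *m (coord_in form b2 v)^T); rewrite Phi2.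
  have v1 := coord_inK form bW (@cyclic_refl _ _ _ act_fst v).
  have v2 := coord_inK form bV (@cyclic_refl _ _ _ act_snd v).
  rewrite -{1}v1 [LHS]/lincomb; apply: eq_bigr => i _.
  have -> : (row i (coord_in form b1 v *m (coord_in form b2 v)^T))^T
      = coord_in form b1 v i 0 *: coord_in form b2 v.
    by apply/colP=> j; rewrite !mxE big_ord1 !mxE.
  by rewrite (linearZ_LR (lincomb b2)) /= v2 (linear_scale _ _ (linA i)) (DA i).2.
have nil1 : nilpotent_on act_fst np1 (cyclic act_fst v).
  apply: nilpotent_sub c1M _; have [H [F [F0 FH Fn]]] := nilM.
  exists H, F; split=> // x h u npx; apply: Fn; split=> //=; by case: at0_2.
have nil2 : nilpotent_on act_snd np2 (cyclic act_snd v).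
  apply: nilpotent_sub c2M _; have [H [F [F0 FH Fn]]] := nilM.
  exists H, F; split=> // x h u npx; apply: Fn; split=> //=; by case: at0_1.
exists W, V, Phi; split=> //.
- split.
  + apply: (cyclic_irreducible_module u1 hv1 (f := lincomb b1 : {linear rep_module W -> S}) nil1).
    * exact: (lincomb_inj form bW).
    * exact: lincomb_equivariant.
    * exact: bW.2.
  + apply: (cyclic_irreducible_module u2 hv2 (f := lincomb b2 : {linear rep_module V -> S}) nil2).
    * exact: (lincomb_inj form bV).
    * exact: lincomb_equivariant.
    * exact: bV.2.
  + apply: (cyclic_irreducible_module uact hv (f := Phi)) => //.
    exact: nilpotent_sub cM nilM.
- exists (coord_in form b1 v); last by move=> x c; apply: basis_rep_eigen; apply: cyclic_refl.
  apply: contraNneq nz_v => v0; rewrite -(coord_inK form bW (@cyclic_refl _ _ _ act_fst v)).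
  by rewrite v0 linear0.
- exists (coord_in form b2 v); last by move=> x c; apply: basis_rep_eigen; apply: cyclic_refl.
  apply: contraNneq nz_v => v0; rewrite -(coord_inK form bV (@cyclic_refl _ _ _ act_snd v)).
  by rewrite v0 linear0.
Qed.
End ProductAlgebra.

(** * Orthogonal decomposition into cyclic modules *)

Section OrthogonalDecomposition.
Variables (K : numClosedFieldType) (S : lmodType K) (form : hermitian_form S).
Variables (g : lieAlgebra K) (star : g -> g) (np nm bo : g -> Prop).
Variable act : g -> S -> S.
Hypothesis uact : unitary_action form star np nm bo act.
Variables (I : eqType) (v : I -> S).
Hypothesis hv : forall i, hw_vector np bo act (v i).
Hypothesis orth_v : forall i j, i != j -> form (v i) (v j) = 0.

Lemma cyclic_orth_cyclic i j u w : i != j ->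
  cyclic act (v i) u -> cyclic act (v j) w -> form u w = 0.
Proof.
move=> ne_ij iu jw; have [_ sj _] := hv j; apply: hform_eq0.
apply: (jw (fun w => forall u, cyclic act (v i) u -> form w u = 0)) u iu.
  exact: (orth_stable uact (cyclic_stable act (v i))).
by move=> u iu; apply: hform_eq0; apply: (cyclic_orth uact (hv i) sj) iu; apply: orth_v.
Qed.

Lemma cyclic_independent (s : seq I) (u : I -> S) : uniq s ->
  (forall i, cyclic act (v i) (u i)) -> \sum_(i <- s) u i = 0 ->
  forall i, i \in s -> u i = 0.
Proof.
move=> uniq_s cu sum0 i si; apply: (hform_definite (h := form)).
rewrite -(hform0l form (u i)) -sum0 hform_suml (bigD1_seq i) //= big1 ?addr0 // => j ne_ji.
exact: cyclic_orth_cyclic ne_ji (cu j) (cu i).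
Qed.

Variables (M : S -> Prop) (n : nat) (a : 'I_n -> S) (ts : seq I).
Hypotheses (stM : stable act M) (aM : is_basis a M).
Hypothesis nilM : nilpotent_on act np M.
Hypotheses (uniq_ts : uniq ts) (Mv : forall i, i \in ts -> M (v i)).
Hypothesis singM : forall w, M w -> singular np act w ->
  exists c : I -> K, w = \sum_(i <- ts) c i *: v i.

(** Subtract from [w] its projections onto the mutually orthogonal cyclic modules. A nonzero
    remainder makes their common orthogonal complement in [M] nonzero. That complement is stable, so
    it contains a singular vector, which by [singM] is a combination of the [v i] and therefore
    orthogonal to itself. *)
Lemma cyclic_decomposition w : M w ->
  exists2 u : I -> S, (forall i, cyclic act (v i) (u i)) & w = \sum_(i <- ts) u i.
Proof.
move=> Mw.
have proj i : exists u, cyclic act (v i) u /\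
    (i \in ts -> forall w', cyclic act (v i) w' -> form (w - u) w' = 0).
  (* Outside [ts] the vector [v i] is a default value that makes the family total. *)
  case: (boolP (i \in ts)) => [ts_i|_]; last by exists (v i); split => //; apply: cyclic_refl.
  have subM w' : cyclic act (v i) w' -> M w' by apply; [|apply: Mv].
  have [d [b bi]] := subspace_basis aM (cyclic_subspace act (v i)) subM.
  exists (lincomb b (coord_in form b w)); split; first by apply/bi.2; exists (coord_in form b w).
  by move=> _ w' iw'; apply: (coord_in_orth form bi).
pose u i := proj1_sig (constructive_indefinite_description _ (proj i)).
have uP i : cyclic act (v i) (u i) /\
    (i \in ts -> forall w', cyclic act (v i) w' -> form (w - u i) w' = 0).
  exact: proj2_sig (constructive_indefinite_description _ (proj i)).
exists u => [i|]; first by case: (uP i).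
pose U w' := M w' /\ forall i, i \in ts -> forall x, cyclic act (v i) x -> form w' x = 0.
have stU : stable act U.
  have orth i := orth_stable uact (cyclic_stable act (v i)).
  split; first split.
  - by split=> [|i _ x _]; [case: stM => [[]] | rewrite hform0l].
  - move=> c x y [Mx Ux] [My Uy]; split; first exact: stM.1.2.
    by move=> i tsi; apply: (orth i).1.2; [apply: Ux | apply: Uy].
  - move=> x y [My Uy]; split; first exact: stM.2.
    by move=> i tsi; apply: (orth i).2; apply: Uy.
have Uw : U (w - \sum_(i <- ts) u i).
  split=> [|j tsj x jx].
    apply: (subspaceB stM.1 Mw); rewrite big_seq; apply: (@subspace_sum _ _ M _ _ _ _ stM.1) => i tsi.
    by apply: (uP i).1 => //; apply: Mv.
  rewrite (bigD1_seq j) //= opprD addrA hformBl (uP j).2 // sub0r.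
  rewrite hform_suml big1 ?oppr0 // => i ne_ij.
  exact: (cyclic_orth_cyclic ne_ij (uP i).1 jx).
apply/eqP; rewrite -subr_eq0; apply/negPn/negP => nz.
have nzU : exists2 x, U x & x != 0 by exists (w - \sum_(i <- ts) u i).
have UM x : U x -> M x by case.
have [x [[Mx Ux] nz_x sx]] := singular_vector nilM stU UM nzU.
have [c Dx] := singM Mx sx; move/eqP: nz_x; apply; apply: (hform_definite (h := form)).
rewrite {1}Dx hform_suml big_seq big1 // => i tsi.
by rewrite hformZl (hform_eq0 (Ux i tsi _ _)) ?mulr0 //; apply: cyclic_refl.
Qed.

End OrthogonalDecomposition.

(** * Derivations of the coordinate ring *)

Section Derivations.
Variable F : fieldType.
Local Notation poly := {mpoly F[#|{: coord}|]}.
Implicit Types (p q : poly) (d : poly -> poly).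

Definition derivation d : Prop :=
  linear d /\ forall p q, d (p * q) = d p * q + p * d q.

Section Rules.
Variable d : poly -> poly.
Hypothesis dd : derivation d.

Lemma derivationD p q : d (p + q) = d p + d q.
Proof. by have [ld _] := dd; rewrite -[p]scale1r ld !scale1r. Qed.

Lemma derivation0 : d 0 = 0.
Proof. by apply: (addrI (d 0)); rewrite -derivationD !addr0. Qed.

Lemma derivationZ a p : d (a *: p) = a *: d p.
Proof. by rewrite -[a *: p]addr0 dd.1 derivation0 addr0. Qed.

Lemma derivationN p : d (- p) = - d p.
Proof. by rewrite -scaleN1r derivationZ scaleN1r. Qed.

Lemma derivationB p q : d (p - q) = d p - d q.
Proof. by rewrite derivationD derivationN. Qed.

Lemma derivationM p q : d (p * q) = d p * q + p * d q.
Proof. by case: dd. Qed.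

Lemma derivation_sum I (r : seq I) (P : pred I) (f : I -> poly) :
  d (\sum_(i <- r | P i) f i) = \sum_(i <- r | P i) d (f i).
Proof. by apply: (big_morph d) => [p q|]; [apply: derivationD | apply: derivation0]. Qed.

Lemma derivation1 : d 1 = 0.
Proof.
by apply: (addrI (d 1)); rewrite addr0 -{3}[1]mul1r derivationM mul1r mulr1.
Qed.

Lemma derivationC a : d a%:MP = 0.
Proof. by rewrite -[_%:MP]mulr1 mul_mpolyC derivationZ derivation1 scaler0. Qed.

Lemma derivation_exp p n : d (p ^+ n.+1) = (n.+1)%:R * (p ^+ n * d p).
Proof.
elim: n => [|n IHn]; first by rewrite expr1 expr0 !mul1r.
by rewrite exprS derivationM IHn [n.+2%:R]mulrS [p ^+ n.+1]exprS; ring.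
Qed.

End Rules.

Lemma derivation_zero : derivation (fun=> 0).
Proof.
by split=> [a p q|p q]; rewrite ?scaler0 ?mul0r ?mulr0 addr0.
Qed.

Lemma derivation_add d d' : derivation d -> derivation d' -> derivation (fun p => d p + d' p).
Proof.
move=> dd dd'; split=> [a p q|p q].
  by rewrite (derivationD dd) (derivationD dd') (derivationZ dd) (derivationZ dd') scalerDr addrACA.
by rewrite (derivationM dd) (derivationM dd') mulrDl mulrDr addrACA.
Qed.

Lemma derivation_mul d r : derivation d -> derivation (fun p => r * d p).
Proof.
move=> dd; split=> [a p q|p q].
  by rewrite (derivationD dd) (derivationZ dd) mulrDr scalerAr.
by rewrite (derivationM dd) mulrDr mulrA [p * (r * _)]mulrCA.
Qed.

Lemma derivation_opp d : derivation d -> derivation (fun p => - d p).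
Proof.
move=> dd; have [ld md] := derivation_mul (-1) dd.
split=> [b p q|p q]; rewrite -![- d _]mulN1r; first exact: ld.
exact: md.
Qed.

Lemma derivation_bigsum I (r : seq I) (P : pred I) (d : I -> poly -> poly) :
  (forall i, derivation (d i)) -> derivation (fun p => \sum_(i <- r | P i) d i p).
Proof.
move=> dd; split=> [a p q|p q].
  rewrite scaler_sumr -big_split; apply: eq_bigr => i _.
  by rewrite derivationD // derivationZ.
rewrite mulr_suml mulr_sumr -big_split; apply: eq_bigr => i _.
by rewrite derivationM.
Qed.

Lemma derivation_comm d d' : derivation d -> derivation d' ->
  derivation (fun p => d (d' p) - d' (d p)).
Proof.
move=> dd dd'; split=> [a p q|p q].
  rewrite !(derivationD dd, derivationD dd', derivationZ dd, derivationZ dd').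
  by rewrite scalerBr opprD addrACA.
rewrite !(derivationM dd, derivationM dd', derivationD dd, derivationD dd'); ring.
Qed.

Lemma derivation_pder c : derivation (pder c : poly -> poly).
Proof. by split=> [a p q|p q]; rewrite /pder ?mderivD ?mderivZ // mderivM. Qed.

Lemma derivation_eq d d' : derivation d -> derivation d' ->
  (forall c, d (var F c) = d' (var F c)) -> d =1 d'.
Proof.
move=> dd dd' eqv.
have eqX i : d 'X_i = d' 'X_i by have := eqv (enum_val i); rewrite /var enum_valK.
have eqM p q : d p = d' p -> d q = d' q -> d (p * q) = d' (p * q).
  by move=> ep eq_q; rewrite (derivationM dd) (derivationM dd') ep eq_q.
have eq1 : d 1 = d' 1 by rewrite (derivation1 dd) (derivation1 dd').
move=> p; rewrite (mpolyE p) (derivation_sum dd) (derivation_sum dd'); apply: eq_bigr => m _.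
rewrite (derivationZ dd) (derivationZ dd'); congr (_ *: _); rewrite mpolyXE_id.
apply: (big_ind (fun q => d q = d' q)) => // i _.
by elim: (m i) => [|k IHk]; rewrite ?expr0 // exprS; apply: eqM.
Qed.

(** The pattern of most commutation relations below: both sides are derivations, so the variables
    decide. [derivation_comm_eqX] is the version with matrix entries. *)
Lemma derivation_comm_eq d d' d'' : derivation d -> derivation d' -> derivation d'' ->
  (forall c, d (d' (var F c)) - d' (d (var F c)) = d'' (var F c)) ->
  forall p, d (d' p) = d' (d p) + d'' p.
Proof.
move=> dd dd' dd'' eqv p.
by rewrite -(derivation_eq (derivation_comm dd dd') dd'' eqv) addrC subrK.
Qed.

Lemma pder_var c c' : pder c (var F c') = (c == c')%:R.
Proof.
rewrite /pder /var mderivX mnm1E (inj_eq enum_rank_inj) eq_sym.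
case: eqVneq => [->|_]; last by rewrite scale0r.
by rewrite scale1r -mpolyX0; congr 'X_[_]; apply/mnmP=> k; rewrite mnmBE subnn mnm0E.
Qed.

Definition vfield (a : coord -> poly) (p : poly) : poly := \sum_c a c * pder c p.

Lemma derivation_vfield a : derivation (vfield a).
Proof. by apply: derivation_bigsum => c; apply/derivation_mul/derivation_pder. Qed.

Lemma vfield_var a c : vfield a (var F c) = a c.
Proof.
rewrite /vfield (bigD1 c) //= big1 => [|c' /negPf ne]; rewrite pder_var ?eqxx ?mulr1 ?addr0 //.
by rewrite ne mulr0.
Qed.

End Derivations.

(** * The coordinates as antisymmetric 4 x 4 matrices *)

Notation i0 := (@Ordinal 4 0 isT).
Notation i1 := (@Ordinal 4 1 isT).
Notation i2 := (@Ordinal 4 2 isT).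
Notation i3 := (@Ordinal 4 3 isT).
Notation k0 := (@Ordinal 3 0 isT).
Notation k1 := (@Ordinal 3 1 isT).
Notation k2 := (@Ordinal 3 2 isT).
Notation j0 := (@Ordinal 2 0 isT).
Notation j1 := (@Ordinal 2 1 isT).

Lemma ord2_ind (P : 'I_2 -> Prop) : P j0 -> P j1 -> forall j, P j.
Proof. by move=> P0 P1 [[|[|//]] lt]; rewrite (bool_irrelevance lt isT). Qed.

Lemma ord3_ind (P : 'I_3 -> Prop) : P k0 -> P k1 -> P k2 -> forall j, P j.
Proof. by move=> P0 P1 P2 [[|[|[|//]]] lt]; rewrite (bool_irrelevance lt isT). Qed.

Lemma ord4_ind (P : 'I_4 -> Prop) : P i0 -> P i1 -> P i2 -> P i3 -> forall j, P j.
Proof. by move=> P0 P1 P2 P3 [[|[|[|[|//]]]] lt]; rewrite (bool_irrelevance lt isT). Qed.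

Lemma sum_ord2 (V : nmodType) (f : 'I_2 -> V) : \sum_i f i = f j0 + f j1.
Proof. by rewrite 2!big_ord_recl big_ord0 addr0; congr (f _ + f _); apply: val_inj. Qed.

Lemma sum_ord3 (V : nmodType) (f : 'I_3 -> V) : \sum_i f i = f k0 + f k1 + f k2.
Proof.
by rewrite 3!big_ord_recl big_ord0 addr0 addrA; congr (f _ + f _ + f _); apply: val_inj.
Qed.

Lemma sum_ord4 (V : nmodType) (f : 'I_4 -> V) :
  \sum_i f i = f i0 + f i1 + f i2 + f i3.
Proof.
by rewrite 4!big_ord_recl big_ord0 addr0 !addrA; congr (f _ + f _ + f _ + f _); apply: val_inj.
Qed.

Definition skew4 (V : zmodType) (a01 a02 a03 a12 a13 a23 : V) (p q : 'I_4) : V :=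
  match nat_of_ord p, nat_of_ord q with
  | 0%N, 1%N => a01 | 0%N, 2%N => a02 | 0%N, 3%N => a03 | 1%N, 2%N => a12 | 1%N, 3%N => a13 | 2%N, 3%N => a23
  | 1%N, 0%N => - a01 | 2%N, 0%N => - a02 | 3%N, 0%N => - a03 | 2%N, 1%N => - a12 | 3%N, 1%N => - a13
  | 3%N, 2%N => - a23 | _, _ => 0
  end.

(* [X], [Xs] and [qf] are locked to prevent rewriting from matching inside them. *)
Fact X_key : unit. Proof. by []. Qed.
Fact Xs_key : unit. Proof. by []. Qed.
Fact qf_key : unit. Proof. by []. Qed.

Section Coordinates.
Variable F : fieldType.
Local Notation poly := {mpoly F[#|{: coord}|]}.
Local Notation var := (var F).
Implicit Types (f : poly) (p q r s : 'I_4) (i j k : 'I_2).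

Definition X j : 'I_4 -> 'I_4 -> poly := locked_with X_key
  (skew4 (var (x1 k0 j)) (var (x1 k1 j)) (var (x1 k2 j))
         (var (x2 k2 j)) (- var (x2 k1 j)) (var (x2 k0 j))).

Lemma XE j : X j = skew4 (var (x1 k0 j)) (var (x1 k1 j)) (var (x1 k2 j))
                         (var (x2 k2 j)) (- var (x2 k1 j)) (var (x2 k0 j)).
Proof. by rewrite /X; case: X_key. Qed.

(* The Hodge dual of [X j]. *)
Definition Xs j : 'I_4 -> 'I_4 -> poly := locked_with Xs_key
  (skew4 (var (x2 k0 j)) (var (x2 k1 j)) (var (x2 k2 j))
         (var (x1 k2 j)) (- var (x1 k1 j)) (var (x1 k0 j))).

Lemma XsE' j : Xs j = skew4 (var (x2 k0 j)) (var (x2 k1 j)) (var (x2 k2 j))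
                            (var (x1 k2 j)) (- var (x1 k1 j)) (var (x1 k0 j)).
Proof. by rewrite /Xs; case: Xs_key. Qed.

Definition t : poly := var x12.

(** Partial derivative with respect to the entry (p, q) of [X j], extended antisymmetrically in p
    and q. *)
Definition dX j p q f : poly :=
  skew4 (pder (x1 k0 j) f) (pder (x1 k1 j) f) (pder (x1 k2 j) f)
       (pder (x2 k2 j) f) (- pder (x2 k1 j) f) (pder (x2 k0 j) f) p q.

Definition dT f : poly := pder x12 f.

Definition inv2 : F := 2%:R^-1.
Definition h : poly := inv2%:MP.
Definition sg j : poly := (-1) ^+ j.

(** Common form of [L1] and [L2], justified in [L12E]: each multiplies d/dx_12 by a variable of the
    opposite family, and the Hodge dual exchanges the two families. *)
Definition L j p q f : poly := dX j p q f + sg j * h * Xs (rev_ord j) p q * dT f.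

Lemma coord_var_ind (P : poly -> Prop) :
  (forall f, P f -> P (- f)) -> P t -> (forall j p q, P (X j p q)) -> forall c, P (var c).
Proof.
move=> PN Pt PX [[[k i] j]|] //; move: k i.
have PNX p q : P (- X j p q) by apply/PN/PX.
move: PX => /(_ j) PX; rewrite XE in PX PNX.
have E0 : j0 = ord0 by apply: val_inj.
have E1 : j1 = ord_max by apply: val_inj.
apply: ord2_ind; rewrite ?E0 ?E1; apply: ord3_ind.
- exact: (PX i0 i1).
- exact: (PX i0 i2).
- exact: (PX i0 i3).
- exact: (PX i2 i3).
- by have := PNX i1 i3; rewrite /skew4 /= opprK.
- exact: (PX i1 i2).
Qed.

Lemma derivation_eqX (d d' : poly -> poly) : derivation d -> derivation d' ->
  d t = d' t -> (forall j p q, d (X j p q) = d' (X j p q)) -> d =1 d'.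
Proof.
move=> dd dd' et eX; apply: derivation_eq => //.
apply: (coord_var_ind (P := fun f => d f = d' f)) => // f ef.
by rewrite (derivationN dd) (derivationN dd') ef.
Qed.

Lemma derivation_comm_eqX (d d' d'' : poly -> poly) :
  derivation d -> derivation d' -> derivation d'' ->
  d (d' t) - d' (d t) = d'' t ->
  (forall j p q, d (d' (X j p q)) - d' (d (X j p q)) = d'' (X j p q)) ->
  forall f, d (d' f) = d' (d f) + d'' f.
Proof.
move=> dd dd' dd'' et eX f.
by rewrite -(derivation_eqX (derivation_comm dd dd') dd'' et eX) addrC subrK.
Qed.

Lemma derivation_skew4 (d : 'I_4 -> 'I_4 -> poly -> poly) (d01 d02 d03 d12 d13 d23 : poly -> poly) :
  derivation d01 -> derivation d02 -> derivation d03 ->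
  derivation d12 -> derivation d13 -> derivation d23 -> forall p q,
  derivation (fun f => skew4 (d01 f) (d02 f) (d03 f) (d12 f) (d13 f) (d23 f) p q).
Proof.
have dz := derivation_zero F.
move=> ? ? ? ? ? ?; apply: ord4_ind; apply: ord4_ind => //; by apply: derivation_opp.
Qed.

Lemma derivation_dX j p q : derivation (dX j p q).
Proof. by apply: derivation_skew4 => //; try apply: derivation_opp; apply: derivation_pder. Qed.

Lemma derivation_dT : derivation dT. Proof. exact: derivation_pder. Qed.

Lemma derivation_L j p q : derivation (L j p q).
Proof.
apply: derivation_add; first exact: derivation_dX.
exact/derivation_mul/derivation_dT.
Qed.

Lemma dX_t j p q : dX j p q t = 0.
Proof.
by move: p q; apply: ord4_ind; apply: ord4_ind; rewrite /dX /skew4 /= ?pder_var ?oppr0.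
Qed.

Lemma dT_t : dT t = 1. Proof. by rewrite /dT pder_var. Qed.

Lemma dT_X j p q : dT (X j p q) = 0.
Proof.
have dd := derivation_dT.
move: p q; apply: ord4_ind; apply: ord4_ind; rewrite XE /skew4 /= ?(derivationN dd) ?(derivation0 dd) //;
by rewrite /dT ?pder_var ?oppr0.
Qed.

Lemma dT_Xs j p q : dT (Xs j p q) = 0.
Proof.
have dd := derivation_dT.
move: p q; apply: ord4_ind; apply: ord4_ind; rewrite XsE' /skew4 /= ?(derivationN dd) ?(derivation0 dd) //;
by rewrite /dT ?pder_var ?oppr0.
Qed.

(** The derivative of the entry (r, s) of an antisymmetric matrix by its entry (p, q). *)
Definition dl p q r s : poly := (p == r)%:R * (q == s)%:R - (p == s)%:R * (q == r)%:R.

Lemma x1_eq (a b : 'I_3) i j : (x1 a i == x1 b j) = (a == b) && (i == j). Proof. by []. Qed.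
Lemma x2_eq (a b : 'I_3) i j : (x2 a i == x2 b j) = (a == b) && (i == j). Proof. by []. Qed.
Lemma x12_eq (a b : 'I_3) i j : (x1 a i == x2 b j) = false. Proof. by []. Qed.
Lemma x21_eq (a b : 'I_3) i j : (x2 a i == x1 b j) = false. Proof. by []. Qed.

Lemma dX_X i j p q r s : dX i p q (X j r s) = (i == j)%:R * dl p q r s.
Proof.
have dd c := @derivation_pder F c; rewrite /dl.
case: eqVneq => [->|/negPf ne]; rewrite ?mul1r ?mul0r; move: p q r s;
  do 4![apply: ord4_ind]; rewrite /dX XE /skew4 /= ?(derivationN (dd _)) ?(derivation0 (dd _)) //.
all: rewrite ?pder_var ?x1_eq ?x2_eq ?x12_eq ?x21_eq /= ?eqxx ?ne /=; ring.
Qed.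
End Coordinates.

Arguments X : simpl never.
Arguments Xs : simpl never.
Arguments L : simpl never.
Arguments dX : simpl never.

(** * The action of g_0 in matrix coordinates *)

Section Action.
Variable F : fieldType.
Local Notation poly := {mpoly F[#|{: coord}|]}.
Local Notation var := (var F).
Local Notation X := (@X F).
Local Notation t := (@t F).
Implicit Types (x : g0 F) (f : poly) (p q r s : 'I_4) (i j k : 'I_2).

Lemma inord4 : ((inord 0 = i0 :> 'I_4) * (inord 1 = i1 :> 'I_4)
  * (inord 2 = i2 :> 'I_4) * (inord 3 = i3 :> 'I_4))%type.
Proof. by do !split; apply: val_inj; rewrite /= inordK. Qed.

(** The first order part of the action, a vector field with linear coefficients; the sign comes from
    Ad(g^-1). *)
Definition fa x f : poly := vfield (fun c => - ad_coord x c) f.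

Lemma derivation_fa x : derivation (fa x).
Proof. exact: derivation_vfield. Qed.

Lemma spinor_actE x (psi : spinor F) s :
  spinor_act x psi s = (5%:R / 2%:R * \tr x.1) *: psi s
    + \sum_(r < 4) sl_mx x.2 s r *: psi r + fa x (psi s).
Proof.
rewrite ffunE; congr (_ + _); rewrite /fa /vfield -sumrN.
by apply: eq_bigr => c _; rewrite mulNr.
Qed.

Definition X12_mx : 'M[poly]_2 := block_mx 0 t%:M (- t)%:M 0 : 'M_(1 + 1).
Definition XX_mx : 'M[poly]_(3 + 3, 2) :=
  col_mx (\matrix_(i < 3, j < 2) var (x1 i j)) (\matrix_(i < 3, j < 2) var (x2 i j)).

Lemma ad_block x (A := map_mx (@mpolyC #|{: coord}| F) x.1)
    (B := map_mx (@mpolyC #|{: coord}| F) (so6_of_sl4 x.2))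
    (Z := map_mx (@mpolyC #|{: coord}| F) (g0_mx x)) :
  dlsubmx (Z *m gminus_mx F - gminus_mx F *m Z)
    = col_mx (B *m XX_mx - XX_mx *m A) (- A^T *m X12_mx - X12_mx *m A).
Proof.
rewrite /Z /g0_mx /gminus_mx !map_block_mx !map_mx0 -/XX_mx -/X12_mx !mulmx_block.
rewrite opp_block_mx add_block_mx block_mxKdl !mulmx0 ?mul0mx !addr0 !add0r.
by rewrite mul_block_col mul_col_mx !mul0mx addr0 add0r map_mxN map_trmx opp_col_mx add_col_mx.
Qed.

Lemma ad_coord_t x : ad_coord x x12 = - (\tr x.1 *: t).
Proof.
have e0 : j0 = lshift 1 ord0 :> 'I_(1 + 1) by apply: val_inj.
have e1 : j1 = rshift 1 ord0 :> 'I_(1 + 1) by apply: val_inj.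
have X00 : X12_mx j0 j0 = 0.
  by rewrite e0; apply: etrans (block_mxEul _ _ _ _ _ _) _; rewrite mxE.
have X01 : X12_mx j0 j1 = t.
  by rewrite e0 e1; apply: etrans (block_mxEur _ _ _ _ _ _) _; rewrite mxE.
have X11 : X12_mx j1 j1 = 0.
  by rewrite e1; apply: etrans (block_mxEdr _ _ _ _ _ _) _; rewrite mxE.
rewrite /ad_coord /gminus_coord /x12 ad_block col_mxKd.
have o0 : ord0 = j0 :> 'I_2 by apply: val_inj.
have o1 : ord_max = j1 :> 'I_2 by apply: val_inj.
rewrite o0 o1.
rewrite 4!mxE.
rewrite !sum_ord2.
rewrite X00 X01 X11 !mxE.
rewrite /mxtrace sum_ord2 -!mul_mpolyC mpolyCD; ring.
Qed.

Lemma ad_coord_X x k (i : 'I_3) j (a := if k == ord0 then lshift 3 i else rshift 3 i) :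
  ad_coord x (Some (k, i, j)) =
    \sum_b (so6_of_sl4 x.2 a b *: XX_mx b j)
    - \sum_k' (x.1 k' j *: var (Some (k, i, k'))).
Proof.
rewrite /ad_coord /gminus_coord ad_block col_mxKu {}/a.
have E (C : 'M[poly]_(3 + 3, 2)) : (if k == ord0 then usubmx C i j else dsubmx C i j)
    = C (if k == ord0 then lshift 3 i else rshift 3 i) j by case: ifP => _; rewrite mxE.
rewrite E mxE [X in _ + X]mxE !mxE; congr (_ - _); apply: eq_bigr => b _.
  by rewrite mxE -mul_mpolyC.
rewrite [map_mx _ _ _ _]mxE -mul_mpolyC mulrC; congr (_ * _).
move: k {E} i b; apply: ord2_ind => i b /=; rewrite /XX_mx.
  by rewrite col_mxEu mxE; congr (var (Some (_, _, _))); apply: val_inj.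
by rewrite col_mxEd mxE; congr (var (Some (_, _, _))); apply: val_inj.
Qed.

Lemma fa_t x : fa x t = \tr x.1 *: t.
Proof. by rewrite /fa vfield_var ad_coord_t opprK. Qed.

Lemma ext2_der (Z : 'M[F]_4) (u v r s : 'I_4) :
  (Z *m ext2 F u v + ext2 F u v *m Z^T) r s =
  Z r u * (v == s)%:R - Z r v * (u == s)%:R + (Z s v * (u == r)%:R - Z s u * (v == r)%:R).
Proof.
have E1 (a b : 'I_4) : (Z *m delta_mx a b) r s = Z r a * (b == s)%:R.
  rewrite mxE (bigD1 a) //= big1 => [|c /negPf ne]; rewrite mxE ?ne ?mulr0 //.
  by rewrite eqxx addr0 eq_sym.
have E2 (a b : 'I_4) : (delta_mx a b *m Z^T) r s = Z s b * (a == r)%:R.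
  rewrite mxE (bigD1 b) //= big1 => [|c /negPf ne]; rewrite !mxE ?ne ?andbF ?mul0r //.
  by rewrite eqxx andbT addr0 mulrC eq_sym.
have ED (A B : 'M[F]_4) : (A + B) r s = A r s + B r s by rewrite mxE.
have EN (A : 'M[F]_4) : (- A) r s = - A r s by rewrite mxE.
by rewrite /ext2 mulmxBr mulmxBl !ED !EN !E1 !E2.
Qed.

Definition ext2_der_entry (Z : 'M[F]_4) (u v r s : 'I_4) : F :=
  Z r u * (v == s)%:R - Z r v * (u == s)%:R + (Z s v * (u == r)%:R - Z s u * (v == r)%:R).

(* The index pairs (u, v) such that e_(i + 3) and its h-dual are f_u ^ f_v. *)
Definition e_fst (i : 'I_3) : 'I_4 := i0.
Definition e_snd (i : 'I_3) : 'I_4 :=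
  match nat_of_ord i with 0%N => i1 | 1%N => i2 | _ => i3 end.
Definition eb_fst (i : 'I_3) : 'I_4 :=
  match nat_of_ord i with 0%N => i2 | 1%N => i3 | _ => i1 end.
Definition eb_snd (i : 'I_3) : 'I_4 :=
  match nat_of_ord i with 0%N => i3 | 1%N => i1 | _ => i2 end.

Lemma so6_of_sl4E (Z : 'M[F]_4) (a b : 'I_3) :
  [/\ so6_of_sl4 Z (lshift 3 a) (lshift 3 b) = ext2_der_entry Z (e_fst b) (e_snd b) (e_fst a) (e_snd a),
      so6_of_sl4 Z (lshift 3 a) (rshift 3 b) = ext2_der_entry Z (eb_fst b) (eb_snd b) (e_fst a) (e_snd a),
      so6_of_sl4 Z (rshift 3 a) (lshift 3 b) = ext2_der_entry Z (e_fst b) (e_snd b) (eb_fst a) (eb_snd a)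
    & so6_of_sl4 Z (rshift 3 a) (rshift 3 b) = ext2_der_entry Z (eb_fst b) (eb_snd b) (eb_fst a) (eb_snd a)].
Proof.
have so6E (c d : 'I_6) : so6_of_sl4 Z c d
    = ext2_coord (Z *m ext2_basis F d + ext2_basis F d *m Z^T) c 0 by rewrite mxE.
have basl : ext2_basis F (lshift 3 b) = ext2 F (e_fst b) (e_snd b).
  rewrite /ext2_basis (unsplitK (inl b)); move: b; apply: ord3_ind;
  by rewrite /vec_e (tnth_nth 0) /= !inord4.
have basr : ext2_basis F (rshift 3 b) = ext2 F (eb_fst b) (eb_snd b).
  rewrite /ext2_basis (unsplitK (inr b)); move: b {basl}; apply: ord3_ind;
  by rewrite /vec_ebar (tnth_nth 0) /= !inord4 // /ext2 opprB.
have col (w : 'M[F]_4) : ext2_coord w (lshift 3 a) 0 = w (e_fst a) (e_snd a).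
  rewrite /ext2_coord (col_mxEu (m1 := 3) (m2 := 3)) mxE; move: a; apply: ord3_ind;
  by rewrite (tnth_nth 0) /= !inord4.
have cor u v : ext2_coord (Z *m ext2 F u v + ext2 F u v *m Z^T) (rshift 3 a) 0
    = ext2_der_entry Z u v (eb_fst a) (eb_snd a).
  rewrite /ext2_coord (col_mxEd (m1 := 3) (m2 := 3)) mxE; move: a {col}; apply: ord3_ind;
  rewrite (tnth_nth 0) /= !inord4 ext2_der //= /ext2_der_entry /=; ring.
by split; rewrite so6E ?basl ?basr ?col ?cor // ext2_der.
Qed.

(** Here so(6) is eliminated: sl(4) acts on the coordinates by - (Z X + X Z^T), and gl(2) mixes the
    two columns. The later computations start from this form. *)
Lemma fa_X x j p q : fa x (X j p q) =
  \sum_k (x.1 k j *: X k p q)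
  - \sum_r (sl_mx x.2 p r *: X j r q + sl_mx x.2 q r *: X j p r).
Proof.
have main k (i : 'I_3) : fa x (var (Some (k, i, j))) = 
    \sum_k' (x.1 k' j *: var (Some (k, i, k')))
    - \sum_b (so6_of_sl4 x.2 (if k == ord0 then lshift 3 i else rshift 3 i) b *: XX_mx b j).
  by rewrite /fa vfield_var ad_coord_X opprB.
have XXE (a b : 'I_3) : (XX_mx (lshift 3 a) j = var (x1 a j)) * (XX_mx (rshift 3 b) j = var (x2 b j)).
  by split; rewrite /XX_mx ?col_mxEu ?col_mxEd mxE.
have l2 (i : 'I_3) : fa x (var (x2 i j)) = \sum_k' (x.1 k' j *: var (x2 i k'))
    - (\sum_b (so6_of_sl4 x.2 (rshift 3 i) (lshift 3 b) *: var (x1 b j)) +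
      \sum_b (so6_of_sl4 x.2 (rshift 3 i) (rshift 3 b) *: var (x2 b j))).
  rewrite main big_split_ord /=; congr (_ - (_ + _)); apply: eq_bigr => b _; by rewrite XXE.
have l1 (i : 'I_3) : fa x (var (x1 i j)) = \sum_k' (x.1 k' j *: var (x1 i k'))
    - (\sum_b (so6_of_sl4 x.2 (lshift 3 i) (lshift 3 b) *: var (x1 b j)) +
      \sum_b (so6_of_sl4 x.2 (lshift 3 i) (rshift 3 b) *: var (x2 b j))).
  rewrite main big_split_ord /=; congr (_ - (_ + _)); apply: eq_bigr => b _; by rewrite XXE.
have dd := derivation_fa x.
rewrite !sum_ord2 !sum_ord4; set Z := sl_mx x.2 in l1 l2 *; move: p q.
have so1 a b := let: And4 e1 _ _ _ := so6_of_sl4E Z a b in e1.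
have so2 a b := let: And4 _ e1 _ _ := so6_of_sl4E Z a b in e1.
have so3 a b := let: And4 _ _ e1 _ := so6_of_sl4E Z a b in e1.
have so4 a b := let: And4 _ _ _ e1 := so6_of_sl4E Z a b in e1.
have eqs := (@sum_ord3, @sum_ord2, so1, so2, so3, so4).
do 2!apply: ord4_ind; rewrite !XE /skew4 /= ?(derivationN dd) ?(derivation0 dd) ?l1 ?l2.
all: rewrite ?eqs /ext2_der_entry /= ?mulr0 ?mulr1 ?(subr0, sub0r, addr0, add0r).
all: rewrite -!mul_mpolyC ?(mpolyCD, mpolyCN, mpolyCB, mpolyCM, mpolyC0); ring.
Qed.

End Action.

Section Equivariance.
Variable F : fieldType.
Local Notation poly := {mpoly F[#|{: coord}|]}.
Local Notation X := (@X F).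
Local Notation Xs := (@Xs F).
Local Notation t := (@t F).
Local Notation h := (@h F).
Local Notation sg := (@sg F).
Local Notation dl := (@dl F).
Implicit Types (x : g0 F) (f : poly) (p q r s : 'I_4) (i j k : 'I_2).

Definition AA x i j : poly := (x.1 i j)%:MP.
Definition ZZ x p q : poly := (sl_mx x.2 p q)%:MP.
Definition trA x : poly := AA x j0 j0 + AA x j1 j1.

Lemma trAE x : (\tr x.1)%:MP = trA x.
Proof. by rewrite /mxtrace sum_ord2 mpolyCD. Qed.

Lemma ZZ_trace x : ZZ x i3 i3 = - (ZZ x i0 i0 + ZZ x i1 i1 + ZZ x i2 i2).
Proof.
have := valP x.2; rewrite inE => /eqP/(congr1 (@mpolyC #|{: coord}| F)).
rewrite /mxtrace sum_ord4 !mpolyCD mpolyC0 => tr0; apply/eqP.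
by rewrite -addr_eq0 -[X in _ == X]tr0; apply/eqP; rewrite /ZZ; ring.
Qed.

Lemma faT x : fa x t = trA x * t.
Proof. by rewrite fa_t -mul_mpolyC trAE. Qed.

Lemma faX x j p q : fa x (X j p q) =
  \sum_k AA x k j * X k p q - \sum_r (ZZ x p r * X j r q + ZZ x q r * X j p r).
Proof.
rewrite fa_X; congr (_ - _); apply: eq_bigr => k _; first by rewrite mul_mpolyC.
by rewrite !mul_mpolyC.
Qed.

Lemma spinor_actP x (psi : spinor F) s :
  spinor_act x psi s = (5%:R / 2%:R)%:MP * trA x * psi s
    + \sum_(r < 4) ZZ x s r * psi r + fa x (psi s).
Proof.
rewrite spinor_actE -trAE -mpolyCM mul_mpolyC; congr (_ + _ + _).
by apply: eq_bigr => r _; rewrite mul_mpolyC.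
Qed.

Lemma skew4_anti (V : zmodType) (a b c d e f : V) p q :
  skew4 a b c d e f q p = - skew4 a b c d e f p q.
Proof. by move: p q; do 2!apply: ord4_ind; rewrite /skew4 /= ?opprK ?oppr0. Qed.

Lemma X_anti j p q : X j q p = - X j p q. Proof. by rewrite XE skew4_anti. Qed.
Lemma XsE j p q : Xs j p q =
  skew4 (X j i2 i3) (- X j i1 i3) (X j i1 i2) (X j i0 i3) (- X j i0 i2) (X j i0 i1) p q.
Proof. by rewrite XsE' XE; move: p q; do 2!apply: ord4_ind; rewrite /skew4 /= ?opprK. Qed.

(** The Hodge dual identifies Lambda^2 with its dual up to the determinant, so the vanishing of the
    trace of Z enters here. *)
Lemma faXs x j p q : fa x (Xs j p q) =
  \sum_k AA x k j * Xs k p q + \sum_r (ZZ x r p * Xs j r q + ZZ x r q * Xs j p r).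
Proof.
have dd := derivation_fa x; rewrite !sum_ord2 !sum_ord4.
move: p q; do 2!apply: ord4_ind; rewrite !XsE /skew4 /=.
all: rewrite ?(derivationN dd) ?(derivationN dd) ?(derivation0 dd) ?faX ?sum_ord2 ?sum_ord4 ?(ZZ_trace x) !XE /skew4 /=; ring.
Qed.

Lemma dl_pick (a : 'I_4 -> poly) p : \sum_u a u * (p == u)%:R = a p.
Proof.
rewrite (bigD1 p) //= big1 => [|u /negPf ne]; first by rewrite eqxx mulr1 addr0.
by rewrite eq_sym ne mulr0.
Qed.

Lemma dl_pick' (a : 'I_4 -> poly) p : \sum_u a u * (u == p)%:R = a p.
Proof. by under eq_bigr do rewrite eq_sym; apply: dl_pick. Qed.

Lemma dl_sum1 (a : 'I_4 -> poly) q r s :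
  \sum_u a u * dl u q r s = a r * (q == s)%:R - a s * (q == r)%:R.
Proof.
rewrite /dl -(dl_pick' a r) -(dl_pick' a s) !mulr_suml -sumrB.
by apply: eq_bigr => u _; ring.
Qed.

Lemma dl_sum2 (a : 'I_4 -> poly) p r s :
  \sum_u a u * dl p u r s = a s * (p == r)%:R - a r * (p == s)%:R.
Proof.
rewrite /dl -(dl_pick' a r) -(dl_pick' a s) !mulr_suml -sumrB.
by apply: eq_bigr => u _; ring.
Qed.

Lemma dl_sum3 (a : 'I_4 -> poly) p q s :
  \sum_u a u * dl p q u s = a p * (q == s)%:R - a q * (p == s)%:R.
Proof.
rewrite /dl -(dl_pick a p) -(dl_pick a q) !mulr_suml -sumrB.
by apply: eq_bigr => u _; ring.
Qed.

Lemma dl_sum4 (a : 'I_4 -> poly) p q r :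
  \sum_u a u * dl p q r u = a q * (p == r)%:R - a p * (q == r)%:R.
Proof.
rewrite /dl -(dl_pick a p) -(dl_pick a q) !mulr_suml -sumrB.
by apply: eq_bigr => u _; ring.
Qed.

Lemma L_t j p q : L j p q t = sg j * h * Xs (rev_ord j) p q.
Proof. by rewrite /L dX_t dT_t add0r mulr1. Qed.

Lemma L_X i j p q r s : L i p q (X j r s) = (i == j)%:R * dl p q r s.
Proof. by rewrite /L dX_X dT_X mulr0 addr0. Qed.

Lemma der_nat (d : poly -> poly) (n : nat) : derivation d -> d n%:R = 0.
Proof. by move=> dd; rewrite -mpolyC_nat (derivationC dd). Qed.

Lemma der_dl (d : poly -> poly) p q r s : derivation d -> d (dl p q r s) = 0.
Proof.
move=> dd; rewrite /dl (derivationB dd) !(derivationM dd) !(der_nat _ dd); ring.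
Qed.

Lemma der_sg (d : poly -> poly) j : derivation d -> d (sg j) = 0.
Proof.
move=> dd; move: j; apply: ord2_ind; rewrite /sg /= ?expr0 ?expr1 ?(derivationN dd);
by rewrite (derivation1 dd) ?oppr0.
Qed.

Lemma fa_dT x f : fa x (dT f) = dT (fa x f) + - trA x * dT f.
Proof.
have dd := derivation_fa x; have dT' := derivation_dT F.
have dC c : dT c%:MP = 0 := derivationC dT' c.
have dtr : dT (trA x) = 0 by rewrite /trA (derivationD dT') !dC addr0.
apply: (derivation_comm_eqX dd dT' (d'' := fun f => - trA x * dT f)).
- exact: derivation_mul.
- by rewrite dT_t (derivation1 dd) faT (derivationM dT') dtr dT_t; ring.
move=> j p q; rewrite dT_X (derivation0 dd) mulr0 sub0r faX.
rewrite (derivationB dT') !(derivation_sum dT') !big1 ?subr0 ?oppr0 // => r _.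
  by rewrite (derivationD dT') !(derivationM dT') !dC !dT_X; ring.
by rewrite (derivationM dT') dC dT_X; ring.
Qed.

(** The fields L span a g_0-module dual to that of the coordinates [X]. The equivariance of the
    Dirac operator rests on this relation. *)
Lemma fa_L x j p q f : fa x (L j p q f) = L j p q (fa x f) +
  (\sum_r (ZZ x r p * L j r q f + ZZ x r q * L j p r f) - \sum_k AA x j k * L k p q f).
Proof.
have dd := derivation_fa x; have dL i u v := derivation_L F i u v.
apply: (derivation_comm_eqX dd (dL _ _ _) (d'' := fun f =>
  \sum_r (ZZ x r p * L j r q f + ZZ x r q * L j p r f) - \sum_k AA x j k * L k p q f)).
- apply: derivation_add; first apply: derivation_bigsum => r.
    by apply: derivation_add; apply: derivation_mul.
  by apply/derivation_opp/derivation_bigsum => k; apply: derivation_mul.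
- rewrite L_t faT !(derivationM dd) (der_sg _ dd) (derivationC dd) faXs.
  rewrite (derivationM (dL _ _ _)) {1}/trA (derivationD (dL _ _ _)) !(derivationC (dL _ _ _)).
  rewrite !sum_ord2 !sum_ord4 !L_t /trA.
  have r0 : rev_ord j0 = j1 by apply: val_inj.
  have r1 : rev_ord j1 = j0 by apply: val_inj.
  by move: j; apply: ord2_ind; rewrite ?r0 ?r1 /sg /= ?expr0 ?expr1; ring.
- move=> i r s; rewrite L_X (derivationM dd) (der_nat _ dd) (der_dl _ _ _ _ dd).
  rewrite faX (derivationB (dL _ _ _)) !(derivation_sum (dL _ _ _)).
  under eq_bigr do rewrite (derivationM (dL _ _ _)) (derivationC (dL _ _ _)) L_X mul0r add0r.
  under [X in _ - (_ - X)]eq_bigr do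
    rewrite (derivationD (dL _ _ _)) !(derivationM (dL _ _ _)) !(derivationC (dL _ _ _)) !L_X !mul0r !add0r.
  under [X in _ = X - _]eq_bigr do rewrite !L_X.
  under [X in _ = _ - X]eq_bigr do rewrite !L_X.
  rewrite !big_split /=.
  have mv (a : 'I_4 -> poly) (b : 'I_4 -> poly) c : \sum_u a u * (c * b u) = c * \sum_u a u * b u.
    by rewrite mulr_sumr; apply: eq_bigr => u _; rewrite mulrCA.
  rewrite !mv dl_sum1 dl_sum2 dl_sum3 dl_sum4 !sum_ord2.
  by move: i j; do 2!apply: ord2_ind; rewrite /=; ring.
Qed.

End Equivariance.

(** * The Dirac operator in components *)

Section Dirac.
Variable F : fieldType.
Local Notation poly := {mpoly F[#|{: coord}|]}.
Local Notation h := (@h F).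
Implicit Types (x y : g0 F) (f : poly) (psi : spinor F) (p q r s : 'I_4) (i j k : 'I_2).

(** Component s of the Dirac operator when Lambda^3 is read as the dual of C^4. Since e is paired
    with L^2 and ebar with L^1, the bivector wedged with psi is the Hodge dual of [L j]; dualizing
    the resulting 3-vector undoes this. *)
Definition DD j psi s : poly := \sum_r L j s r (psi r).

(** The Levi-Civita symbol. *)
Definition eps4 (s p q r : 'I_4) : poly :=
  skew4 (skew4 0 0 0 0 0 1 q r) (skew4 0 0 0 0 (-1) 0 q r) (skew4 0 0 0 1 0 0 q r)
        (skew4 0 0 1 0 0 0 q r) (skew4 0 (-1) 0 0 0 0 q r) (skew4 1 0 0 0 0 0 q r) s p.

Lemma L12E j p q f : L j p q f =
  skew4 (L1 k0 j f) (L1 k1 j f) (L1 k2 j f) (L2 k2 j f) (- L2 k1 j f) (L2 k0 j f) p q.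
Proof.
have e : (-1) ^+ j / 2%:R = (-1) ^+ j * inv2 F by [].
have esg : ((-1) ^+ j)%:MP = @sg F j.
  by move: j {e}; apply: ord2_ind; rewrite /sg /= ?expr0 ?expr1 ?mpolyCN mpolyC1.
move: p q; do 2!apply: ord4_ind; rewrite /L /dX XsE' /skew4 /= /L1 /L2 -?mul_mpolyC ?e ?mpolyCM.
all: rewrite ?esg.
all: rewrite /h /dT /pder; ring.
Qed.

Lemma vec_table (a b : 'I_3 -> poly) p q :
  \sum_(i < 3) (vec_ebar F i p q *: a i + vec_e F i p q *: b i)
    = skew4 (b k0) (b k1) (b k2) (a k2) (- a k1) (a k0) p q.
Proof.
rewrite sum_ord3 /vec_e /vec_ebar !(tnth_nth 0) /= !inord4 /ext2 !mxE.
by move: p q; do 2!apply: ord4_ind; rewrite /= /skew4 /= -!mul_mpolyC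
  ?(mpolyCN, mpolyCB, mpolyC0, mpolyC1); ring.
Qed.

Lemma dirac2E psi j p q r : dirac2 psi j p q r = \sum_s eps4 s p q r * DD j psi s.
Proof.
have W u v w : \sum_(i < 3) (vec_ebar F i u v *: L1 i j (psi w) + vec_e F i u v *: L2 i j (psi w))
    = skew4 (L2 k0 j (psi w)) (L2 k1 j (psi w)) (L2 k2 j (psi w)) (L1 k2 j (psi w))
      (- L1 k1 j (psi w)) (L1 k0 j (psi w)) u v := vec_table _ _ u v.
transitivity (skew4 (L2 k0 j (psi r)) (L2 k1 j (psi r)) (L2 k2 j (psi r)) (L1 k2 j (psi r))
      (- L1 k1 j (psi r)) (L1 k0 j (psi r)) p q
  + skew4 (L2 k0 j (psi p)) (L2 k1 j (psi p)) (L2 k2 j (psi p)) (L1 k2 j (psi p))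
      (- L1 k1 j (psi p)) (L1 k0 j (psi p)) q r
  + skew4 (L2 k0 j (psi q)) (L2 k1 j (psi q)) (L2 k2 j (psi q)) (L1 k2 j (psi q))
      (- L1 k1 j (psi q)) (L1 k0 j (psi q)) r p).
  rewrite -!W -!big_split; apply: eq_bigr => i _; rewrite /wedge21 /=.
  rewrite -!mul_mpolyC; ring.
rewrite sum_ord4 /DD !sum_ord4 !L12E /eps4.
move: (L1 k0 j) (L1 k1 j) (L1 k2 j) (L2 k0 j) (L2 k1 j) (L2 k2 j) => a0 a1 a2 b0 b1 b2.
by move: p q r; do 3!apply: ord4_ind; rewrite /= /skew4 /=;
  move: (psi i0) (psi i1) (psi i2) (psi i3) => u0 u1 u2 u3; ring.
Qed.

Lemma monogenicE psi : monogenic psi <-> forall j s, DD j psi s = 0.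
Proof.
split=> [mono|D0 j p q r]; last by rewrite dirac2E big1 // => s _; rewrite D0 mulr0.
(* In each case s followed by the chosen triple is an even permutation, so [eps4] picks out
   [DD j psi s] with coefficient 1. *)
move=> j; apply: ord4_ind.
- by rewrite -(mono j i1 i2 i3) dirac2E sum_ord4 /eps4 /skew4 /=; ring.
- by rewrite -(mono j i0 i3 i2) dirac2E sum_ord4 /eps4 /skew4 /=; ring.
- by rewrite -(mono j i0 i1 i3) dirac2E sum_ord4 /eps4 /skew4 /=; ring.
- by rewrite -(mono j i0 i2 i1) dirac2E sum_ord4 /eps4 /skew4 /=; ring.
Qed.

End Dirac.

Section SpinorAction.
Variable F : fieldType.
Local Notation poly := {mpoly F[#|{: coord}|]}.
Local Notation X := (@X F).
Implicit Types (x y : g0 F) (f : poly) (psi : spinor F) (p q r s : 'I_4) (i j k : 'I_2).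

(** The right-hand side is the action on the target bundle: s carries the dual spin module, j the
    two-dimensional factor of gl(2). *)
Lemma DD_act x psi j s : DD j (spinor_act x psi) s =
  (5%:R / 2%:R)%:MP * trA x * DD j psi s + fa x (DD j psi s)
  - \sum_p ZZ x p s * DD j psi p + \sum_k AA x j k * DD k psi s.
Proof.
have dd := derivation_fa x; have dL i u v := derivation_L F i u v.
have DDx r : L j s r (spinor_act x psi r) =
    (5%:R / 2%:R)%:MP * trA x * L j s r (psi r) + \sum_u ZZ x r u * L j s r (psi u)
    + (fa x (L j s r (psi r)) - (\sum_u (ZZ x u s * L j u r (psi r) + ZZ x u r * L j s u (psi r))
       - \sum_k AA x j k * L k s r (psi r))).
  rewrite spinor_actP fa_L addrK !(derivationD (dL _ _ _)) (derivationM (dL _ _ _)) /trA.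
  rewrite [L j s r (_ * (_ + _))](derivationM (dL _ _ _)) (derivationD (dL _ _ _)).
  rewrite !(derivationC (dL _ _ _)) (derivation_sum (dL _ _ _)); congr (_ + _ + _); first by ring.
  by apply: eq_bigr => u _; rewrite (derivationM (dL _ _ _)) (derivationC (dL _ _ _)) mul0r add0r.
rewrite /DD; under eq_bigr do rewrite DDx.
rewrite (derivation_sum dd) !sum_ord4 !sum_ord2 !sum_ord4.
move: (L j) (L j0) (L j1) (psi i0) (psi i1) (psi i2) (psi i3) (fa x) {DDx dd dL} => Lj La Lb u0 u1 u2 u3 d.
move: (ZZ x) (AA x j j0) (AA x j j1) (_ * trA x) => z a0 a1 c.
ring.
Qed.

Lemma monogenic_act x psi : monogenic psi -> monogenic (spinor_act x psi).
Proof.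
move=> /monogenicE D0; apply/monogenicE => j s; rewrite DD_act D0 mulr0.
rewrite (derivation0 (derivation_fa x)) !big1 => [|p _|k _]; rewrite ?D0 ?mulr0 //.
by rewrite subr0 !addr0.
Qed.

Lemma spinor_comb a (u v : spinor F) s : (a *: u + v) s = a%:MP * u s + v s.
Proof. by rewrite 2!ffunE mul_mpolyC. Qed.

Lemma spinor_act_linr x : linear (spinor_act x : spinor F -> spinor F).
Proof.
have dd := derivation_fa x; move=> a u v; apply/ffunP=> s.
rewrite spinor_comb !spinor_actP !sum_ord4 !spinor_comb.
by rewrite (derivationD dd) (derivationM dd) (derivationC dd); ring.
Qed.

Lemma AA_lin a x y i j : AA (a *: x + y) i j = a%:MP * AA x i j + AA y i j.
Proof. by rewrite /AA /= !mxE mpolyCD mpolyCM. Qed.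

Lemma ZZ_lin a x y p q : ZZ (a *: x + y) p q = a%:MP * ZZ x p q + ZZ y p q.
Proof. by rewrite /ZZ /= !mxE mpolyCD mpolyCM. Qed.

Lemma fa_linl a x y f : fa (a *: x + y) f = a%:MP * fa x f + fa y f.
Proof.
apply: (derivation_eqX (d := fa (a *: x + y)) (d' := fun f => a%:MP * fa x f + fa y f)).
- exact: derivation_fa.
- by apply: derivation_add; [apply/derivation_mul/derivation_fa | apply: derivation_fa].
- by rewrite !faT /trA !AA_lin; ring.
- move=> j p q; rewrite !faX !sum_ord2 !sum_ord4 !AA_lin !ZZ_lin.
  move: (ZZ x) (ZZ y) (AA x) (AA y) (X j) (X j0) (X j1) => *; ring.
Qed.

(* Abstracting [spinor_act] keeps unification from unfolding it. *)
Lemma spinor_act_linl psi : linear (fun x => spinor_act x psi).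
Proof.
move=> a x y; have actP := @spinor_actP F; move: (@spinor_act F) actP => act actP.
apply/ffunP=> s; rewrite [RHS]spinor_comb /=.
have := fa_linl a x y (psi s); have := AA_lin a x y; have := ZZ_lin a x y.
move: (a *: x + y) => z zzE aaE fzE.
rewrite !actP !sum_ord4 fzE /trA !zzE !aaE.
move: (ZZ x) (ZZ y) (AA x) (AA y) (fa x (psi s)) (fa y (psi s)) => *.
ring.
Qed.

Lemma AA_br x y i j : AA (lie_br x y) i j =
  \sum_k (AA x i k * AA y k j - AA y i k * AA x k j).
Proof.
rewrite /AA /= /mxbr !mxE -sumrB rmorph_sum; apply: eq_bigr => k _.
by rewrite /= mpolyCB !mpolyCM.
Qed.

Lemma ZZ_br x y p q : ZZ (lie_br x y) p q =
  \sum_r (ZZ x p r * ZZ y r q - ZZ y p r * ZZ x r q).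
Proof.
rewrite /ZZ /= /mxbr !mxE -sumrB rmorph_sum; apply: eq_bigr => k _.
by rewrite /= mpolyCB !mpolyCM.
Qed.

Lemma fa_br x y f : fa x (fa y f) = fa y (fa x f) + fa (lie_br x y) f.
Proof.
have dx := derivation_fa x; have dy := derivation_fa y.
apply: (derivation_comm_eqX dx dy (d'' := fa (lie_br x y))).
- exact: derivation_fa.
- rewrite !faT !(derivationM dx) !(derivationM dy) !faT /trA !(derivationD dx) !(derivationD dy).
  rewrite !(derivationC dx) !(derivationC dy) !AA_br !sum_ord2; ring.
move=> j p q; rewrite !faX !sum_ord2 !sum_ord4.
rewrite !(derivationB dx, derivationB dy, derivationD dx, derivationD dy,
  derivationM dx, derivationM dy, derivationC dx, derivationC dy).
rewrite !faX !sum_ord2 !sum_ord4 !AA_br !ZZ_br !sum_ord2 !sum_ord4.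
move: (ZZ x) (ZZ y) (AA x) (AA y) (X j) (X j0) (X j1) => *; ring.
Qed.

Lemma spinor_act_br x y psi : spinor_act (lie_br x y) psi =
  spinor_act x (spinor_act y psi) - spinor_act y (spinor_act x psi).
Proof.
have dx := derivation_fa x; have dy := derivation_fa y.
have actP := @spinor_actP F; move: (@spinor_act F) actP => act actP.
apply/ffunP=> s; rewrite [in RHS]ffunE [X in _ = _ + X]ffunE !actP !sum_ord4 !actP !sum_ord4.
rewrite !(derivationD dx, derivationD dy, derivationM dx, derivationM dy).
rewrite /trA !(derivationD dx, derivationD dy, derivationC dx, derivationC dy).
rewrite fa_br !AA_br !ZZ_br !sum_ord2 !sum_ord4.
move: (ZZ x) (ZZ y) (AA x) (AA y) (fa (lie_br x y) (psi s)) => zx zy ax ay w.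
move: (fa x) (fa y) (psi i0) (psi i1) (psi i2) (psi i3) (psi s) (_%:MP) => *; ring.
Qed.

End SpinorAction.

(** * Degrees and the weighted Euler field *)

Section Degree.
Variable F : numFieldType.
Local Notation poly := {mpoly F[#|{: coord}|]}.
Local Notation var := (var F).
Local Notation X := (@X F).
Local Notation Xs := (@Xs F).
Local Notation t := (@t F).
Implicit Types (x y : g0 F) (f : poly) (psi : spinor F) (p q r s : 'I_4) (i j k : 'I_2).
Implicit Type (m : 'X_{1..#|{: coord}|}).

Lemma mcoeff_var_pder c f m :
  (var c * pder c f)@_m = (m (enum_rank c))%:R * f@_m.
Proof.
have varX m' : var c * pder c 'X_[m'] = (m' (enum_rank c))%:R *: 'X_[m'] :> poly.
  rewrite /var /pder mderivX -scalerAr -mpolyXD.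
  have [->|m'_gt0] := posnP (m' (enum_rank c)); first by rewrite !scale0r.
  congr (_ *: 'X_[_]); apply/mnmP=> i; rewrite mnmDE mnmBE mnm1E.
  by case: eqP => [<-|_]; rewrite ?subn0 // add1n subn1 prednK.
have dd := derivation_mul (var c) (derivation_pder F c).
rewrite {1}[f]mpolyE (derivation_sum dd) raddf_sum /=.
under eq_bigr do rewrite (derivationZ dd) varX !mcoeffZ mcoeffX.
have [fm|/memN_msupp_eq0 fm0] := boolP (m \in msupp f).
  rewrite (bigD1_seq m) ?msupp_uniq //= eqxx mulr1 mulrC big1 ?addr0 // => m' /negPf ne.
  by rewrite ne !mulr0.
rewrite fm0 mulr0 big1 // => m' _; case: eqP => [->|_]; rewrite ?fm0 ?mul0r // !mulr0 //.
Qed.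

(** Each monomial is an eigenvector whose eigenvalue is its weighted degree. Homogeneity thus
    becomes an equation for a derivation, which can be commuted with other fields. *)
Definition euler f : poly := vfield (fun c => (coord_deg c)%:R * var c) f.

Lemma derivation_euler : derivation euler. Proof. exact: derivation_vfield. Qed.

Lemma mcoeff_euler f m : (euler f)@_m = (mnm_deg m)%:R * f@_m.
Proof.
rewrite /euler /vfield raddf_sum /mnm_deg natr_sum mulr_suml; apply: eq_bigr => c _ /=.
by rewrite -mulrA -mpolyC_nat mcoeffCM mcoeff_var_pder natrM mulrA.
Qed.

Lemma mcoeff_natM n f m : (n%:R * f)@_m = n%:R * f@_m.
Proof. by rewrite -mpolyC_nat mcoeffCM. Qed.

Lemma dhomog_euler n f : (f \is n.-homog for mnm_deg) <-> euler f = n%:R * f.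
Proof.
split=> [hf|Ef].
  apply/mpolyP=> m; rewrite mcoeff_euler mcoeff_natM.
  case: (eqVneq (mnm_deg m) n) => [->//|ne].
  by rewrite (dhomog_nemf_coeff hf ne) !mulr0.
apply/dhomogP=> m; rewrite mcoeff_msupp => nz; apply/eqP.
have := congr1 (mcoeff m) Ef; rewrite mcoeff_euler mcoeff_natM => /(mulIf nz)/eqP.
by rewrite eqr_nat.
Qed.

(** The hypothesis makes [f] an eigenvector of [euler] for the negative number n - d. *)
Lemma euler_neg n d f : (n < d)%N -> euler f + d%:R * f = n%:R * f -> f = 0.
Proof.
move=> lt_nd Ef; apply/mpolyP=> m; rewrite mcoeff0; apply/eqP.
have /eqP := congr1 (mcoeff m) Ef.
rewrite mcoeffD mcoeff_euler !mcoeff_natM -mulrDl -natrD -subr_eq0 -mulrBl mulf_eq0 subr_eq0.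
by rewrite eqr_nat gtn_eqF // (leq_trans lt_nd) // leq_addl.
Qed.

Lemma euler_var c : euler (var c) = (coord_deg c)%:R * var c.
Proof. exact: vfield_var. Qed.

Lemma euler_t : euler t = 2%:R * t. Proof. exact: euler_var. Qed.

Lemma euler_X j p q : euler (X j p q) = X j p q.
Proof.
have dd := derivation_euler; move: p q; do 2!apply: ord4_ind; rewrite !XE /skew4 /=
  ?(derivationN dd) ?(derivation0 dd) ?(derivationN dd) ?euler_var /= ?mul1r //.
Qed.

Lemma euler_Xs j p q : euler (Xs j p q) = Xs j p q.
Proof.
have dd := derivation_euler; move: p q; do 2!apply: ord4_ind; rewrite !XsE' /skew4 /=
  ?(derivationN dd) ?(derivation0 dd) ?(derivationN dd) ?euler_var /= ?mul1r //.
Qed.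

Lemma euler_fa x f : euler (fa x f) = fa x (euler f).
Proof.
have dx := derivation_fa x; have dE := derivation_euler.
rewrite (derivation_comm_eqX dE dx (d'' := fun=> 0)) ?addr0 //; first exact: derivation_zero.
  rewrite faT euler_t (derivationM dx) (derivationM dE) /trA (derivationD dE) (der_nat _ dx).
  by rewrite !(derivationC dE) euler_t faT /trA; ring.
move=> j p q; rewrite euler_X faX !sum_ord2 !sum_ord4.
rewrite !(derivationB dE, derivationD dE, derivationM dE, derivationC dE) !euler_X; ring.
Qed.

Lemma euler_dT f : euler (dT f) + 2%:R * dT f = dT (euler f).
Proof.
have dT' := derivation_dT F; have dE := derivation_euler.
rewrite (derivation_comm_eqX dT' dE (d'' := fun f => 2%:R * dT f)) //.
- exact: derivation_mul.
- rewrite dT_t (derivation1 dE) euler_t (derivationM dT') (der_nat _ dT') dT_t; ring.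
by move=> j p q; rewrite euler_X dT_X (derivation0 dE); ring.
Qed.

Lemma euler_L j p q f : euler (L j p q f) + L j p q f = L j p q (euler f).
Proof.
have dL := derivation_L F j p q; have dE := derivation_euler.
rewrite (derivation_comm_eqX dL dE (d'' := L j p q)) //.
- rewrite L_t euler_t (derivationM dL) (der_nat _ dL) L_t !(derivationM dE) (der_sg _ dE).
  rewrite (derivationC dE) euler_Xs; ring.
by move=> i r s; rewrite euler_X L_X (derivationM dE) (der_nat _ dE) (der_dl _ _ _ _ dE); ring.
Qed.

Definition homog_spinor n psi : Prop := forall s, euler (psi s) = n%:R * psi s.

Lemma monogenic_of_degreeE n psi :
  monogenic_of_degree n psi <-> (forall j s, DD j psi s = 0) /\ homog_spinor n psi.
Proof.
split=> [[/monogenicE mono hom]|[mono hom]]; first by split=> // s; apply/dhomog_euler.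
by split=> [|s]; [apply/monogenicE | apply/dhomog_euler].
Qed.

Lemma homog_spinor_act n x psi : homog_spinor n psi -> homog_spinor n (spinor_act x psi).
Proof.
have dE := derivation_euler; have dx := derivation_fa x; move=> hom s.
rewrite spinor_actP !sum_ord4 /trA !(derivationD dE, derivationM dE, derivationC dE) euler_fa !hom.
by rewrite (derivationM dx) (der_nat _ dx); ring.
Qed.

Lemma monogenic_of_degree_act n x psi :
  monogenic_of_degree n psi -> monogenic_of_degree n (spinor_act x psi).
Proof.
move=> Mpsi; have [_ hom] := (monogenic_of_degreeE n psi).1 Mpsi.
case: Mpsi => mono _; split; first exact: monogenic_act.
by move=> s; apply/dhomog_euler/homog_spinor_act.
Qed.

Lemma DD_comb a (u v : spinor F) j s : DD j (a *: u + v) s = a%:MP * DD j u s + DD j v s.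
Proof.
rewrite /DD mulr_sumr -big_split; apply: eq_bigr => r _ /=.
have dL := derivation_L F j s r.
by rewrite spinor_comb (derivationD dL) (derivationM dL) (derivationC dL) mul0r add0r.
Qed.

Lemma monogenic_subspace : subspace (@monogenic F).
Proof.
split=> [|a u v /monogenicE Du /monogenicE Dv]; apply/monogenicE => j s.
  by rewrite /DD big1 // => r _; rewrite ffunE (derivation0 (derivation_L F j s r)).
by rewrite DD_comb Du Dv mulr0 addr0.
Qed.

Lemma monogenic_of_degree_subspace n : subspace (@monogenic_of_degree F n).
Proof.
have [m0 mlin] := monogenic_subspace.
split=> [|a u v [mu hu] [mv hv]]; first by split=> // s; rewrite ffunE rpred0.
by split=> [|s]; [apply: mlin | rewrite spinor_comb mul_mpolyC rpredD ?rpredZ].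
Qed.

Lemma monogenic_of_degree_stable n :
  stable (@spinor_act F) (@monogenic_of_degree F n).
Proof.
split; first exact: monogenic_of_degree_subspace.
by move=> x u; apply: monogenic_of_degree_act.
Qed.

(** The Dirac operator lowers degrees by one, so the images of different homogeneous components
    share no monomial and vanish separately. *)
Lemma monogenic_sumE psi : monogenic_sum psi <-> monogenic psi.
Proof.
split=> [[n [phi [Mphi ->]]]|mono].
  by apply: (@subspace_sum _ _ (@monogenic F) _ _ _ _ monogenic_subspace) => k _; case: (Mphi k).
pose n := \max_(s < 4) mmeasure mnm_deg (psi s).
pose phi (k : nat) : spinor F := [ffun s => pihomog mnm_deg k (psi s)].
have hom (k : nat) s : euler (phi k s) = k%:R * phi k s by rewrite ffunE; apply/dhomog_euler/pihomogP.
have Dpsi : psi = \sum_(k < n) phi k.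
  apply/ffunP=> s; rewrite sum_ffunE {1}(pihomog_partitionE (mf := mnm_deg) (k := n) (p := psi s)).
    by apply: eq_bigr => k _; rewrite ffunE.
  exact: (leq_bigmax s).
have DDE (k : nat) j s m : (DD j (phi k) s)@_m != 0 -> k = (mnm_deg m).+1.
  have dE := derivation_euler; move=> nz; apply/eqP.
  have : euler (DD j (phi k) s) + DD j (phi k) s = k%:R * DD j (phi k) s.
    rewrite /DD (derivation_sum dE) -big_split mulr_sumr; apply: eq_bigr => r _ /=.
    have dL := derivation_L F j s r.
    by rewrite euler_L hom (derivationM dL) (der_nat _ dL) mul0r add0r.
  move/(congr1 (mcoeff m)); rewrite mcoeffD mcoeff_euler mcoeff_natM -[X in _ + X]mul1r -mulrDl natr1 => /(mulIf nz)/eqP.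
  by rewrite eqr_nat eq_sym.
(* Every member of the family has to be monogenic, so it is set to 0 from n on. *)
exists n, (fun k : nat => if (k < n)%N then phi k else 0); split=> [k|]; last first.
  by rewrite {1}Dpsi; apply: eq_bigr => k _; rewrite ltn_ord.
case: ifP => lt_kn; last exact: (monogenic_of_degree_subspace k).1.
apply/monogenic_of_degreeE; split=> // j s; apply/mpolyP=> m; rewrite mcoeff0.
apply/eqP/negPn/negP => nz; have Dk := DDE _ _ _ _ nz.
have /monogenicE/(_ j s)/(congr1 (mcoeff m)) := mono.
have DDsum : DD j psi s = \sum_(i < n) DD j (phi i) s.
  rewrite {1}Dpsi /DD exchange_big; apply: eq_bigr => r _ /=.
  by rewrite sum_ffunE (derivation_sum (derivation_L F j s r)).
rewrite DDsum raddf_sum mcoeff0 (bigD1 (Ordinal lt_kn)) //= big1 ?addr0 => [/eqP|i ne].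
  by rewrite (negPf nz).
apply/eqP/negPn/negP => nz'; case/eqP: ne; apply: val_inj => /=.
by rewrite Dk; apply: DDE nz'.
Qed.

End Degree.

(** * The raising operator of degree 2 *)

Section Raising.
Variable F : numFieldType.
Local Notation poly := {mpoly F[#|{: coord}|]}.
Local Notation var := (var F).
Local Notation X := (@X F).
Local Notation Xs := (@Xs F).
Local Notation t := (@t F).
Local Notation h := (@h F).
Local Notation dl := (@dl F).
Implicit Types (x y : g0 F) (f : poly) (psi : spinor F) (p q r s : 'I_4) (i j k : 'I_2).

Definition pairing (A B : 'I_4 -> 'I_4 -> poly) : poly := A i0 i1 * B i0 i1 + A i0 i2 * B i0 i2
  + A i0 i3 * B i0 i3 + A i1 i2 * B i1 i2 + A i1 i3 * B i1 i3 + A i2 i3 * B i2 i3.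

(** The inner product of columns j and k for the quadratic form on C^6; for j = k it is twice the
    Pfaffian of [X j]. *)
Definition qf j k : poly := locked_with qf_key (pairing (X j) (Xs k)).

Lemma qfE j k : qf j k = pairing (X j) (Xs k).
Proof. by rewrite /qf; case: qf_key. Qed.

Section DerivationRules.
Variable d : poly -> poly.
Hypothesis dd : derivation d.

Lemma derivation_pairing A B : d (pairing A B) =
  pairing (fun p q => d (A p q)) B + pairing A (fun p q => d (B p q)).
Proof.
by rewrite /pairing !(derivationD dd) !(derivationM dd); move: A B => A B; ring.
Qed.

Lemma derivation_qf j k : d (qf j k) =
  pairing (fun p q => d (X j p q)) (Xs k) + pairing (X j) (fun p q => d (Xs k p q)).
Proof. by rewrite qfE derivation_pairing. Qed.

Lemma derivation_contact0 u w a b : d (t * u - h * (a * w - b * u)) =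
  d t * u + t * d u - h * ((d a * w + a * d w) - (d b * u + b * d u)).
Proof.
by rewrite (derivationB dd) !(derivationM dd) (derivationB dd) !(derivationM dd) (derivationC dd); ring.
Qed.

Lemma derivation_contact1 u w a b : d (t * u + h * (a * w - b * u)) =
  d t * u + t * d u + h * ((d a * w + a * d w) - (d b * u + b * d u)).
Proof.
by rewrite (derivationD dd) !(derivationM dd) (derivationB dd) !(derivationM dd) (derivationC dd); ring.
Qed.

Lemma derivation_contact_t a b c : d (t ^+ 2 - h ^+ 2 * (a * b - c ^+ 2)) =
  2%:R * t * d t - h ^+ 2 * (d a * b + a * d b - 2%:R * c * d c).
Proof.
rewrite !expr2 (derivationB dd) !(derivationM dd) (derivationB dd) !(derivationM dd).
by rewrite (derivationC dd); ring.
Qed.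

End DerivationRules.

Local Notation q00 := (qf j0 j0).
Local Notation q01 := (qf j0 j1).
Local Notation q11 := (qf j1 j1).

Lemma qf_sym j k : qf j k = qf k j.
Proof. by rewrite !qfE /pairing !XsE /skew4 /=; move: (X j) (X k) => *; ring. Qed.

Lemma Xtab j : ((X j i1 i0 = - X j i0 i1) * (X j i2 i0 = - X j i0 i2) * (X j i3 i0 = - X j i0 i3)
  * (X j i2 i1 = - X j i1 i2) * (X j i3 i1 = - X j i1 i3) * (X j i3 i2 = - X j i2 i3)
  * (X j i0 i0 = 0) * (X j i1 i1 = 0) * (X j i2 i2 = 0) * (X j i3 i3 = 0))%type.
Proof. by rewrite XE /skew4. Qed.

Lemma Ltab j f : ((L j i1 i0 f = - L j i0 i1 f) * (L j i2 i0 f = - L j i0 i2 f)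
  * (L j i3 i0 f = - L j i0 i3 f) * (L j i2 i1 f = - L j i1 i2 f)
  * (L j i3 i1 f = - L j i1 i3 f) * (L j i3 i2 f = - L j i2 i3 f)
  * (L j i0 i0 f = 0) * (L j i1 i1 f = 0) * (L j i2 i2 f = 0) * (L j i3 i3 f = 0))%type.
Proof. by rewrite !L12E /skew4. Qed.

Lemma L_Xs i j p q r s : L i p q (Xs j r s) = (i == j)%:R *
  skew4 (dl p q i2 i3) (- dl p q i1 i3) (dl p q i1 i2) (dl p q i0 i3) (- dl p q i0 i2) (dl p q i0 i1) r s.
Proof.
have dL := derivation_L F i p q; rewrite XsE.
move: r s; do 2!apply: ord4_ind; rewrite /skew4 /= ?(derivationN dL) ?(derivation0 dL) ?(derivationN dL)
  ?L_X; ring.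
Qed.

Lemma L_qf i j k p q : L i p q (qf j k) = (i == j)%:R * Xs k p q + (i == k)%:R * Xs j p q.
Proof.
rewrite (derivation_qf (derivation_L F i p q)) /pairing !L_X !L_Xs /skew4 /=.
rewrite !XsE /skew4 /= /dl; move: (i == j) (i == k) (X j) (X k) => a b u w.
by move: p q; do 2!apply: ord4_ind; rewrite /=; ring.
Qed.

Lemma dT_qf j k : dT (qf j k) = 0.
Proof.
rewrite (derivation_qf (derivation_dT F)) /pairing !dT_X !dT_Xs.
by rewrite !mul0r !mulr0 !addr0.
Qed.

Lemma euler_qf j k : euler (qf j k) = 2%:R * qf j k.
Proof.
rewrite (derivation_qf (derivation_euler F)) qfE /pairing !euler_X !euler_Xs.
move: (X j) (Xs k) => *; ring.
Qed.

Lemma fa_qf x j k : fa x (qf j k) = \sum_i (AA x i j * qf i k + AA x i k * qf j i).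
Proof.
rewrite (derivation_qf (derivation_fa x)) sum_ord2 !qfE /pairing !faX !faXs.
rewrite !sum_ord2 !sum_ord4 !XsE /skew4 /= !Xtab (ZZ_trace x).
move: (ZZ x) (AA x) (X j) (X k) (X j0) (X j1) => *; ring.
Qed.

(** The vector field part of the element of g_2. The cubic corrections to t X_j, and the determinant
    of the inner products in the x_12 component, make its commutators with the fields L combinations
    of the fields L again, as in [L_vq0] and [L_vq1]. *)
Definition vq_coef (c : coord) : poly :=
  if c is Some (k, i, j) then
    if j == j0 then t * var (Some (k, i, j0)) - h * (q00 * var (Some (k, i, j1)) - q01 * var (Some (k, i, j0)))
    else t * var (Some (k, i, j1)) + h * (q11 * var (Some (k, i, j0)) - q01 * var (Some (k, i, j1)))
  else t ^+ 2 - h ^+ 2 * (q00 * q11 - q01 ^+ 2).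

Definition vq f : poly := vfield vq_coef f.

Lemma derivation_vq : derivation vq. Proof. exact: derivation_vfield. Qed.

Lemma vq_t : vq t = t ^+ 2 - h ^+ 2 * (q00 * q11 - q01 ^+ 2).
Proof. exact: vfield_var. Qed.

Lemma vq_X0 p q : vq (X j0 p q) = t * X j0 p q - h * (q00 * X j1 p q - q01 * X j0 p q).
Proof.
have dv := derivation_vq; move: p q; do 2!apply: ord4_ind; rewrite !XE /skew4 /=
  ?(derivationN dv) ?(derivation0 dv) ?(derivationN dv) /vq ?vfield_var /vq_coef /=; ring.
Qed.

Lemma vq_X1 p q : vq (X j1 p q) = t * X j1 p q + h * (q11 * X j0 p q - q01 * X j1 p q).
Proof.
have dv := derivation_vq; move: p q; do 2!apply: ord4_ind; rewrite !XE /skew4 /=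
  ?(derivationN dv) ?(derivation0 dv) ?(derivationN dv) /vq ?vfield_var /vq_coef /=; ring.
Qed.

Lemma vq_Xs0 p q : vq (Xs j0 p q) = t * Xs j0 p q - h * (q00 * Xs j1 p q - q01 * Xs j0 p q).
Proof.
have dv := derivation_vq; move: p q; do 2!apply: ord4_ind; rewrite !XsE /skew4 /=
  ?(derivationN dv) ?(derivation0 dv) ?vq_X0; move: (X j0) (X j1) q00 q01 => *; ring.
Qed.

Lemma vq_Xs1 p q : vq (Xs j1 p q) = t * Xs j1 p q + h * (q11 * Xs j0 p q - q01 * Xs j1 p q).
Proof.
have dv := derivation_vq; move: p q; do 2!apply: ord4_ind; rewrite !XsE /skew4 /=
  ?(derivationN dv) ?(derivation0 dv) ?vq_X1; move: (X j0) (X j1) q11 q01 => *; ring.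
Qed.

(** With [euler_dT] and [euler_vq] this says that [dT], [euler] and [vq] span a copy of sl(2), the
    one formed by g_{-2}, the grading element and g_2. *)
Lemma dT_vq f : dT (vq f) = vq (dT f) + euler f.
Proof.
have dT' := derivation_dT F; have dv := derivation_vq.
apply: (derivation_comm_eqX dT' dv (derivation_euler F)).
  rewrite vq_t (derivation_contact_t dT') dT_t (derivation1 dv) euler_t !dT_qf; ring.
move=> j p q; rewrite euler_X dT_X (derivation0 dv) subr0; move: j; apply: ord2_ind.
  by rewrite vq_X0 (derivation_contact0 dT') dT_t !dT_X !dT_qf; ring.
by rewrite vq_X1 (derivation_contact1 dT') dT_t !dT_X !dT_qf; ring.
Qed.

Lemma euler_vq f : euler (vq f) = vq (euler f) + 2%:R * vq f.
Proof.
have dE := derivation_euler F; have dv := derivation_vq.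
apply: (derivation_comm_eqX dE dv (derivation_mul _ dv)).
  rewrite euler_t (derivationM dv) (der_nat _ dv) vq_t.
  rewrite (derivation_contact_t dE) euler_t !euler_qf; ring.
move=> j p q; rewrite euler_X; move: j; apply: ord2_ind.
  by rewrite vq_X0 (derivation_contact0 dE) euler_t !euler_X !euler_qf; ring.
by rewrite vq_X1 (derivation_contact1 dE) euler_t !euler_X !euler_qf; ring.
Qed.

Lemma fa_vq x f : fa x (vq f) = vq (fa x f) + trA x * vq f.
Proof.
have dx := derivation_fa x; have dv := derivation_vq; have vC := derivationC dv.
have q10 := qf_sym j1 j0.
apply: (derivation_comm_eqX dx dv (derivation_mul _ dv)).
  rewrite faT (derivationM dv) /trA (derivationD dv) !vC vq_t.
  rewrite (derivation_contact_t dx) faT !fa_qf !sum_ord2 q10 /trA; ring.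
move=> j p q; rewrite faX !sum_ord2 !sum_ord4.
rewrite (derivationB dv) !(derivationD dv) !(derivationM dv) !vC; move: j; apply: ord2_ind.
  rewrite !vq_X0 !vq_X1 (derivation_contact0 dx) faT !fa_qf !faX !sum_ord2 !sum_ord4 q10 /trA.
  move: (ZZ x) (AA x) (X j0) (X j1) q00 q01 q11 => *; ring.
rewrite !vq_X0 !vq_X1 (derivation_contact1 dx) faT !fa_qf !faX !sum_ord2 !sum_ord4 q10 /trA.
move: (ZZ x) (AA x) (X j0) (X j1) q00 q01 q11 => *; ring.
Qed.

End Raising.

Section RaisingOperator.
Variable F : numFieldType.
Local Notation poly := {mpoly F[#|{: coord}|]}.
Local Notation X := (@X F).
Local Notation Xs := (@Xs F).
Local Notation t := (@t F).
Local Notation h := (@h F).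
Local Notation sg := (@sg F).
Local Notation dl := (@dl F).
Local Notation q00 := (@qf F j0 j0).
Local Notation q01 := (@qf F j0 j1).
Local Notation q11 := (@qf F j1 j1).
Local Notation vq := (@vq F).
Implicit Types (x y : g0 F) (f : poly) (psi : spinor F) (p q r s : 'I_4) (i j k : 'I_2).

Definition dot k j f : poly := pairing (X k) (fun p q => L j p q f).

Lemma derivation_dot k j : derivation (dot k j).
Proof.
rewrite /dot /pairing; do 5?[apply: derivation_add];
  by apply/derivation_mul/derivation_L.
Qed.

Lemma dot_X k j i r s : dot k j (X i r s) = (j == i)%:R * X k r s.
Proof.
rewrite /dot /pairing !L_X /dl; move: (j == i) => b.
by move: r s; do 2!apply: ord4_ind; rewrite /= ?Xtab; move: (X k) => *; ring.
Qed.

Lemma dot_t k j : dot k j t = sg j * h * qf F k (rev_ord j).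
Proof. by rewrite /dot qfE /pairing !L_t; ring. Qed.

Lemma revs : (rev_ord j0 = j1) * (rev_ord j1 = j0).
Proof. by split; apply: val_inj. Qed.

Lemma sgs : (sg j0 = 1) * (sg j1 = -1).
Proof. by rewrite /sg /= expr0 expr1. Qed.

Lemma L_vq0 p q f : L j0 p q (vq f) = vq (L j0 p q f) +
  ((t + h * q01) * L j0 p q f + h * q11 * L j1 p q f +
   2%:R * h * (Xs j1 p q * dot j0 j0 f - Xs j0 p q * dot j1 j0 f)).
Proof.
have dL := derivation_L F j0 p q; have dv := derivation_vq F.
have dLi i := derivation_L F i p q; have dd k i := derivation_dot k i.
apply: (derivation_comm_eqX dL dv (d'' := fun f => (t + h * q01) * L j0 p q f
   + h * q11 * L j1 p q f + 2%:R * h * (Xs j1 p q * dot j0 j0 f - Xs j0 p q * dot j1 j0 f))).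
- apply: derivation_add; first by apply: derivation_add; apply: derivation_mul.
  by apply/derivation_mul/derivation_add; [|apply: derivation_opp]; apply: derivation_mul.
- rewrite vq_t (derivation_contact_t dL) !L_t !revs !sgs !L_qf !dot_t !revs !sgs /=.
  rewrite (derivationM dv) (derivationM dv) (derivation1 dv) (derivationC dv) vq_Xs1 ?(qf_sym F j1 j0).
  by ring.
move=> i r s; rewrite !L_X !dot_X (derivationM dv) (der_nat _ dv) (der_dl _ _ _ _ dv).
move: i; apply: ord2_ind; rewrite /=.
  by rewrite vq_X0 (derivation_contact0 dL) L_t !L_X !L_qf revs !sgs /=; ring.
by rewrite vq_X1 (derivation_contact1 dL) L_t !L_X !L_qf revs !sgs /=; ring.
Qed.

Lemma L_vq1 p q f : L j1 p q (vq f) = vq (L j1 p q f) +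
  ((t - h * q01) * L j1 p q f - h * q00 * L j0 p q f +
   2%:R * h * (Xs j1 p q * dot j0 j1 f - Xs j0 p q * dot j1 j1 f)).
Proof.
have dL := derivation_L F j1 p q; have dv := derivation_vq F.
have dLi i := derivation_L F i p q; have dd k i := derivation_dot k i.
apply: (derivation_comm_eqX dL dv (d'' := fun f => (t - h * q01) * L j1 p q f
   - h * q00 * L j0 p q f + 2%:R * h * (Xs j1 p q * dot j0 j1 f - Xs j0 p q * dot j1 j1 f))).
- apply: derivation_add.
    by apply: derivation_add; [|apply: derivation_opp]; apply: derivation_mul.
  by apply/derivation_mul/derivation_add; [|apply: derivation_opp]; apply: derivation_mul.
- rewrite vq_t (derivation_contact_t dL) !L_t !revs !sgs !L_qf !dot_t !revs !sgs /=.
  rewrite (derivationM dv) (derivationM dv) (derivationN dv) (derivation1 dv) (derivationC dv) vq_Xs0 ?(qf_sym F j1 j0).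
  by ring.
move=> i r s; rewrite !L_X !dot_X (derivationM dv) (der_nat _ dv) (der_dl _ _ _ _ dv).
move: i; apply: ord2_ind; rewrite /=.
  by rewrite vq_X0 (derivation_contact0 dL) L_t !L_X !L_qf revs !sgs /=; ring.
by rewrite vq_X1 (derivation_contact1 dL) L_t !L_X !L_qf revs !sgs /=; ring.
Qed.

(* The operator by which the element of g_2 raising degrees acts on sections. *)
Definition NN r s : poly := \sum_u (X j0 r u * Xs j1 u s - X j1 r u * Xs j0 u s).

Definition raising psi : spinor F :=
  [ffun r => vq (psi r) + 5%:R * t * psi r + h * \sum_s NN r s * psi s].

Lemma sum_dl (Y : 'I_4 -> poly) s : \sum_r \sum_v dl s r r v * Y v = - 3%:R * Y s.
Proof. by rewrite !sum_ord4 /dl; move: s; apply: ord4_ind; rewrite /=; ring. Qed.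

Lemma sum_X_L_Xs k i j s u :
  \sum_r \sum_v X k r v * L j s r (Xs i v u) = 2%:R * (j == i)%:R * Xs k s u.
Proof.
transitivity ((j == i)%:R * \sum_r \sum_v X k r v *
  skew4 (dl s r i2 i3) (- dl s r i1 i3) (dl s r i1 i2) (dl s r i0 i3) (- dl s r i0 i2) (dl s r i0 i1) v u).
  rewrite mulr_sumr; apply: eq_bigr => r _; rewrite mulr_sumr; apply: eq_bigr => v _.
  by rewrite L_Xs mulrCA.
rewrite -mulrA mulrCA; congr (_ * _); rewrite XsE !sum_ord4.
move: s u; do 2!apply: ord4_ind; rewrite /skew4 /dl /= ?Xtab;
  move: (X k i0 i1) (X k i0 i2) (X k i0 i3) (X k i1 i2) (X k i1 i3) (X k i2 i3) => *; ring.
Qed.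

(** The constant is - 3 - 2, from differentiating the factors [X] and [Xs] of [NN]. It matches the
    multiplier 5 t in [raising], where 5 is twice the weight 5/2 of C_nu. *)
Lemma L_NN_sum j s u : \sum_r L j s r (NN r u) = - 5%:R * sg j * Xs (rev_ord j) s u.
Proof.
have dL r := derivation_L F j s r.
transitivity (
  \sum_r \sum_v dl s r r v * ((j == j0)%:R * Xs j1 v u - (j == j1)%:R * Xs j0 v u)
  + (\sum_r \sum_v X j0 r v * L j s r (Xs j1 v u) - \sum_r \sum_v X j1 r v * L j s r (Xs j0 v u))).
  rewrite -sumrB -big_split; apply: eq_bigr => r _ /=.
  rewrite /NN (derivation_sum (dL r)) -sumrB -big_split; apply: eq_bigr => v _ /=.
  rewrite (derivationB (dL r)) !(derivationM (dL r)) !L_X; ring.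
rewrite sum_dl !sum_X_L_Xs; move: j {dL}; apply: ord2_ind; rewrite revs sgs /=; ring.
Qed.

(** An algebraic identity, valid for any operators antisymmetric in their indices. The terms with
    [dot] left over by [vq] and the terms with [NN] combine into multiples of the Dirac
    equations. *)
Lemma DD_dot psi j s :
  2%:R * \sum_r (Xs j1 s r * dot j0 j (psi r) - Xs j0 s r * dot j1 j (psi r))
    + \sum_r \sum_u NN r u * L j s r (psi u)
  = \sum_p (\sum_v (Xs j0 s v * X j1 v p - Xs j1 s v * X j0 v p)) * DD j psi p.
Proof.
have tab := @Ltab F j; rewrite /DD /NN /dot /pairing !sum_ord4.
move: (L j) tab (psi i0) (psi i1) (psi i2) (psi i3) => Lj tab u0 u1 u2 u3.
move: s; apply: ord4_ind; rewrite !tab ?XsE /skew4 /= ?Xtab.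
all: move: (Lj i0 i1) (Lj i0 i2) (Lj i0 i3) (Lj i1 i2) (Lj i1 i3) (Lj i2 i3) => l01 l02 l03 l12 l13 l23.
all: move: (X j0 i0 i1) (X j0 i0 i2) (X j0 i0 i3) (X j0 i1 i2) (X j0 i1 i3) (X j0 i2 i3).
all: move: (X j1 i0 i1) (X j1 i0 i2) (X j1 i0 i3) (X j1 i1 i2) (X j1 i1 i3) (X j1 i2 i3).
all: move=> *; ring.
Qed.

Lemma sum_L_vq psi j s : \sum_r L j s r (vq (psi r)) =
  vq (DD j psi s) + (t + sg j * h * q01) * DD j psi s
  + sg j * h * qf F (rev_ord j) (rev_ord j) * DD (rev_ord j) psi s
  + 2%:R * h * \sum_r (Xs j1 s r * dot j0 j (psi r) - Xs j0 s r * dot j1 j (psi r)).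
Proof.
have dv := derivation_vq F; move: j; apply: ord2_ind; rewrite !revs !sgs.
  under eq_bigr do rewrite L_vq0.
  rewrite /DD (derivation_sum dv) !sum_ord4.
  move: (L j0) (L j1) (dot j0 j0) (dot j1 j0) (psi i0) (psi i1) (psi i2) (psi i3) vq {dv} => *; ring.
under eq_bigr do rewrite L_vq1.
rewrite /DD (derivation_sum dv) !sum_ord4.
move: (L j0) (L j1) (dot j0 j1) (dot j1 j1) (psi i0) (psi i1) (psi i2) (psi i3) vq {dv} => *; ring.
Qed.

Lemma monogenic_raising psi : monogenic psi -> monogenic (raising psi).
Proof.
move=> /monogenicE D0; apply/monogenicE => j s.
have dv := derivation_vq F; have dL i u v := derivation_L F i u v.
have LQ r : L j s r (raising psi r) = L j s r (vq (psi r))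
    + (5%:R * (sg j * h * Xs (rev_ord j) s r) * psi r + 5%:R * t * L j s r (psi r))
    + (h * \sum_u L j s r (NN r u) * psi u + h * \sum_u NN r u * L j s r (psi u)).
  rewrite ffunE; move: (vq (psi r)) => V.
  rewrite !(derivationD (dL _ _ _)) !(derivationM (dL _ _ _)) (der_nat _ (dL _ _ _)).
  rewrite (derivationC (dL _ _ _)) (derivation_sum (dL _ _ _)) !mul0r !add0r L_t -mulrDr -big_split.
  by congr (_ + _ + _ * _); apply: eq_bigr => u _; apply: (derivationM (dL _ _ _)).
(* Differentiating the entries of [NN] cancels differentiating the coefficient 5 t. *)
have zero : \sum_r h * \sum_u L j s r (NN r u) * psi u
    = - \sum_r 5%:R * (sg j * h * Xs (rev_ord j) s r) * psi r.
  rewrite -mulr_sumr exchange_big mulr_sumr -sumrN; apply: eq_bigr => u _ /=.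
  by rewrite -mulr_suml L_NN_sum; ring.
rewrite /DD; under eq_bigr do rewrite LQ.
have split5 (a b c d e : 'I_4 -> poly) : \sum_r (a r + (b r + c r) + (d r + e r))
    = \sum_r a r + (\sum_r b r + \sum_r c r) + (\sum_r d r + \sum_r e r).
  by rewrite !big_split.
rewrite (split5 (fun r => L j s r (vq (psi r)))) sum_L_vq zero -!mulr_sumr -/(DD j psi s) !D0 (derivation0 dv).
set S := \sum_r (_ - _); set N := \sum_r (\sum_u (_ * _)).
have : 2%:R * S + N = 0 by rewrite DD_dot big1 // => p _; rewrite D0 mulr0.
move=> /(congr1 ( *%R h)); rewrite mulr0 => e; rewrite -[RHS]e; ring.
Qed.

End RaisingOperator.

Section RaisingLaws.
Variable F : numFieldType.
Local Notation poly := {mpoly F[#|{: coord}|]}.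
Local Notation X := (@X F).
Local Notation Xs := (@Xs F).
Local Notation t := (@t F).
Local Notation h := (@h F).
Local Notation vq := (@vq F).
Implicit Types (x y : g0 F) (f : poly) (psi : spinor F) (p q r s : 'I_4) (i j k : 'I_2).

Lemma raisingE psi r : raising psi r =
  vq (psi r) + 5%:R * t * psi r + h * \sum_s NN F r s * psi s.
Proof. by rewrite ffunE. Qed.

Lemma raisingZ a psi : raising (a *: psi) = a *: raising psi.
Proof.
have dv := derivation_vq F; apply/ffunP=> r.
rewrite [RHS]ffunE -mul_mpolyC !raisingE.
have E s : (a *: psi) s = a%:MP * psi s by rewrite ffunE mul_mpolyC.
have -> : \sum_s NN F r s * (a *: psi) s = a%:MP * \sum_s NN F r s * psi s.
  by rewrite mulr_sumr; apply: eq_bigr => s _; rewrite E; ring.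
by rewrite E (derivationM dv) (derivationC dv); ring.
Qed.

Lemma euler_NN r s : euler (NN F r s) = 2%:R * NN F r s.
Proof.
have dE := derivation_euler F; rewrite /NN (derivation_sum dE) mulr_sumr.
apply: eq_bigr => u _; rewrite (derivationB dE) !(derivationM dE) !euler_X !euler_Xs; ring.
Qed.

Lemma raising_homog n psi : homog_spinor n psi -> homog_spinor n.+2 (raising psi).
Proof.
have dE := derivation_euler F; have dv := derivation_vq F; move=> hom r.
rewrite raisingE !(derivationD dE) euler_vq !(derivationM dE) (der_nat _ dE) euler_t.
rewrite (derivationC dE) (derivation_sum dE) hom (derivationM dv) (der_nat _ dv).
have -> : \sum_s euler (NN F r s * psi s) = n.+2%:R * \sum_s NN F r s * psi s.
  rewrite mulr_sumr; apply: eq_bigr => s _.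
  by rewrite (derivationM dE) euler_NN hom -(addn2 n) natrD; ring.
by rewrite -(addn2 n) natrD; ring.
Qed.

Lemma monogenic_of_degree_raising n psi :
  monogenic_of_degree n psi -> monogenic_of_degree n.+2 (raising psi).
Proof.
move=> /monogenic_of_degreeE[D0 hom]; apply/monogenic_of_degreeE; split.
  by apply/monogenicE/monogenic_raising/monogenicE.
exact: raising_homog.
Qed.

Lemma fa_NN x r s : fa x (NN F r s) =
  trA x * NN F r s - \sum_u (ZZ x r u * NN F u s - NN F r u * ZZ x u s).
Proof.
have dd := derivation_fa x; rewrite /NN /trA (derivation_sum dd) !sum_ord4.
rewrite !(derivationB dd) !(derivationM dd) !faX !faXs !sum_ord2 !sum_ord4.
move: (ZZ x) (AA x) (X j0) (X j1) (Xs j0) (Xs j1) => *.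
ring.
Qed.

(** The trace is the character of gl(2) on g_2, since A Y + Y A^T = tr(A) Y for a skew 2 x 2 matrix
    Y. *)
Lemma raising_act x psi :
  spinor_act x (raising psi) = raising (spinor_act x psi) + \tr x.1 *: raising psi.
Proof.
have dd := derivation_fa x; have dv := derivation_vq F.
have actP := @spinor_actP F; move: (@spinor_act F) actP => act actP.
apply/ffunP=> s; rewrite [RHS]ffunE [X in _ = _ + X]ffunE -mul_mpolyC trAE.
have faQ : fa x (raising psi s) = vq (fa x (psi s)) + trA x * vq (psi s)
    + 5%:R * (trA x * t * psi s + t * fa x (psi s))
    + h * \sum_u (fa x (NN F s u) * psi u + NN F s u * fa x (psi u)).
  rewrite -(fa_vq x (psi s)) raisingE; move: (vq (psi s)) => V.
  rewrite !(derivationD dd) !(derivationM dd) (der_nat _ dd) faT (derivationC dd) (derivation_sum dd).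
  have -> : \sum_u fa x (NN F s u * psi u)
      = \sum_u (fa x (NN F s u) * psi u + NN F s u * fa x (psi u)).
    by apply: eq_bigr => u _; apply: (derivationM dd).
  by ring.
have vqA : vq (act x psi s) = (5%:R / 2%:R)%:MP * trA x * vq (psi s)
    + \sum_r ZZ x s r * vq (psi r) + vq (fa x (psi s)).
  rewrite actP !sum_ord4 /trA !(derivationD dv) !(derivationM dv) (derivationD dv) !(derivationC dv).
  by move: (vq (fa x _)) => *; ring.
rewrite actP faQ (raisingE (act x psi)) vqA.
rewrite !sum_ord4 !fa_NN !raisingE !actP !sum_ord4.
move: (NN F) (ZZ x) (trA x) vq (fa x) (psi i0) (psi i1) (psi i2) (psi i3) (psi s) (_ / _)%:MP.
move=> *; ring.
Qed.

Definition dT_spinor psi : spinor F := [ffun s => dT (psi s)].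

(** The degree n comes from [dT, vq] = euler, the 5 from differentiating 5 t. *)
Lemma dT_raising n psi : homog_spinor n psi ->
  dT_spinor (raising psi) = raising (dT_spinor psi) + (n + 5)%:R *: psi.
Proof.
have dT' := derivation_dT F; move=> hom; apply/ffunP=> s.
rewrite [RHS]ffunE [X in _ = _ + X]ffunE -mul_mpolyC mpolyC_nat !ffunE.
move: (dT_vq (psi s)); rewrite hom; move: (vq (psi s)) (vq (dT (psi s))) => V V' eV.
rewrite !(derivationD dT') !(derivationM dT') (der_nat _ dT') dT_t (derivationC dT') eV.
rewrite (derivation_sum dT') natrD.
have -> : \sum_u dT (NN F s u * psi u) = \sum_u NN F s u * dT_spinor psi u.
  apply: eq_bigr => u _; rewrite ffunE (derivationM dT').
  rewrite {1}/NN (derivation_sum dT') big1 ?mul0r ?add0r // => w _.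
  by rewrite (derivationB dT') !(derivationM dT') !dT_X !dT_Xs !mul0r !mulr0 !addr0 subrr.
ring.
Qed.

Lemma dT_spinor_act x psi :
  dT_spinor (spinor_act x psi) = spinor_act x (dT_spinor psi) + \tr x.1 *: dT_spinor psi.
Proof.
have dT' := derivation_dT F.
have actP := @spinor_actP F; move: (@spinor_act F) actP => act actP.
apply/ffunP=> s; rewrite [RHS]ffunE [X in _ = _ + X]ffunE -mul_mpolyC trAE ffunE !actP !ffunE.
rewrite !(derivationD dT') !(derivationM dT') (derivation_sum dT') (derivationC dT') fa_dT.
rewrite /trA (derivationD dT') !(derivationC dT').
under eq_bigr do rewrite (derivationM dT') (derivationC dT') mul0r add0r.
under [X in _ = _ + X + _ + _]eq_bigr do rewrite ffunE.
ring.
Qed.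

Lemma dT_L j p q f : dT (L j p q f) = L j p q (dT f).
Proof.
have dT' := derivation_dT F; have dL := derivation_L F j p q.
rewrite (derivation_comm_eqX dT' dL (d'' := fun=> 0)) ?addr0 //; first exact: derivation_zero.
  rewrite L_t dT_t (derivation1 dL) !(derivationM dT') (der_sg _ dT') (derivationC dT') dT_Xs; ring.
move=> i r s; rewrite L_X dT_X (derivation0 dL) (derivationM dT') (der_nat _ dT') (der_dl _ _ _ _ dT'); ring.
Qed.

Lemma monogenic_of_degree_dT n psi :
  monogenic_of_degree n.+2 psi -> monogenic_of_degree n (dT_spinor psi).
Proof.
move=> /monogenic_of_degreeE[D0 hom]; apply/monogenic_of_degreeE.
have dT' := derivation_dT F; split=> [j s|s].
  rewrite -(derivation0 dT') -(D0 j s) /DD (derivation_sum dT').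
  by apply: eq_bigr => r _; rewrite ffunE dT_L.
rewrite ffunE; apply: (addIr (2%:R * dT (psi s))); rewrite euler_dT hom.
by rewrite (derivationM dT') (der_nat _ dT') -(addn2 n) natrD; ring.
Qed.

Lemma dT_low n psi : (n < 2)%N -> homog_spinor n psi -> dT_spinor psi = 0.
Proof.
move=> lt_n2 hom; apply/ffunP=> s; rewrite !ffunE; apply: (euler_neg lt_n2).
have dT' := derivation_dT F.
by rewrite euler_dT hom (derivationM dT') (der_nat _ dT') mul0r add0r.
Qed.

End RaisingLaws.

(** * The highest weight vectors and their weights *)

Section HighestWeightVectors.
Variable F : numFieldType.
Local Notation poly := {mpoly F[#|{: coord}|]}.
Local Notation X := (@X F).
Implicit Types (x : g0 F) (f : poly) (psi : spinor F) (p q r s : 'I_4) (i j k : 'I_2).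

Lemma derivation_eigen_exp (d : poly -> poly) u c n : derivation d ->
  d u = c * u -> d (u ^+ n) = n%:R * c * u ^+ n.
Proof.
move=> dd du; case: n => [|n]; first by rewrite expr0 (derivation1 dd) !mul0r.
by rewrite (derivation_exp dd) du [u ^+ n.+1]exprS; ring.
Qed.

Definition yy : poly := X j0 i2 i3.
Definition Delta : poly := X j0 i2 i3 * X j1 i1 i3 - X j0 i1 i3 * X j1 i2 i3.
Definition hw_poly a b : poly := yy ^+ b * Delta ^+ a.
Definition hw_spinor0 a b : spinor F := [ffun s => if s == i0 then hw_poly a b else 0].
Definition hw_spinor a b l : spinor F := iter l (@raising F) (hw_spinor0 a b).

Lemma derivation_hw_poly (d : poly -> poly) c c' a b : derivation d ->
  d yy = c * yy -> d Delta = c' * Delta ->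
  d (hw_poly a b) = (b%:R * c + a%:R * c') * hw_poly a b.
Proof.
move=> dd dy dD; rewrite /hw_poly (derivationM dd).
by rewrite (derivation_eigen_exp _ dd dy) (derivation_eigen_exp _ dd dD); ring.
Qed.

Lemma derivation_hw_poly0 (d : poly -> poly) a b : derivation d ->
  (forall j r s, (r != i0) && (s != i0) -> d (X j r s) = 0) -> d (hw_poly a b) = 0.
Proof.
move=> dd dX0; rewrite (@derivation_hw_poly d 0 0) // ?mulr0 ?addr0 ?mul0r //.
  by rewrite /yy dX0.
by rewrite /Delta (derivationB dd) !(derivationM dd) !dX0 //; ring.
Qed.

Lemma hw_poly_euler a b : euler (hw_poly a b) = (2 * a + b)%:R * hw_poly a b.
Proof.
have dE := derivation_euler F; rewrite (@derivation_hw_poly _ 1 2%:R) //.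
- by congr (_ * _); rewrite natrD natrM; ring.
- by rewrite /yy euler_X mul1r.
by rewrite /Delta (derivationB dE) !(derivationM dE) !euler_X; ring.
Qed.

Lemma hw_poly_neq0 a b : hw_poly a b != 0.
Proof.
(* A point at which [yy] takes the value 1 and [Delta] the value -1. *)
pose e (i : 'I_#|{: coord}|) : F :=
  match enum_val i with Some (k, i, j) => if (i == k0) == (j == j0) then 1 else 0 | None => 0 end.
apply/eqP=> /(congr1 (meval e)); rewrite meval0 /hw_poly /yy /Delta !XE /skew4 /=.
rewrite mevalM !rmorphXn /= mevalB !mevalM !mevalN !mevalXU /e !enum_rankK /=.
by rewrite mulr0 subr0 mul1r expr1n mul1r => /eqP; rewrite expf_eq0 oppr_eq0 oner_eq0 andbF.
Qed.

Lemma dT_hw_spinor0 a b : dT_spinor (hw_spinor0 a b) = 0.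
Proof.
have dT' := derivation_dT F; apply/ffunP=> s; rewrite !ffunE.
case: ifP => _; last exact: derivation0.
by rewrite (derivation_hw_poly0 _ _ dT') // => j r q _; rewrite dT_X.
Qed.

Lemma hw_spinor0_monogenic a b : monogenic_of_degree (2 * a + b) (hw_spinor0 a b).
Proof.
apply/monogenic_of_degreeE; split=> [j s|s]; last first.
  rewrite ffunE; case: ifP => _; first exact: hw_poly_euler.
  by rewrite (derivation0 (derivation_euler F)) mulr0.
rewrite /DD big1 // => r _; have dL := derivation_L F j s r; rewrite ffunE.
case: eqP => [->|_]; last exact: derivation0.
rewrite (derivation_hw_poly0 _ _ (derivation_L F j s i0)) // => i u v /andP[u0 v0].
by rewrite L_X /dl ![i0 == _]eq_sym (negPf u0) (negPf v0) !mulr0 subrr mulr0.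
Qed.

Lemma hw_spinor_monogenic a b l : monogenic_of_degree (2 * a + b + 2 * l) (hw_spinor a b l).
Proof.
elim: l => [|l IHl]; first by rewrite muln0 addn0; apply: hw_spinor0_monogenic.
by rewrite mulnS addnCA; apply: monogenic_of_degree_raising.
Qed.

(** The constants of [dT_raising] in the degrees 2a + b + 2i, for i from 0 to l, accumulate: the
    numbers 2a + b + 2i + 5 have sum (l + 1)(2a + b + 5 + l). *)
Lemma dT_hw_spinor a b l : dT_spinor (hw_spinor a b l.+1) =
  (l.+1 * (2 * a + b + 5 + l))%:R *: hw_spinor a b l.
Proof.
elim: l => [|l IHl]; rewrite [hw_spinor _ _ _.+1]/hw_spinor iterS -/(hw_spinor _ _ _).
  rewrite (@dT_raising _ (2 * a + b)) ?dT_hw_spinor0; last first.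
    by have /monogenic_of_degreeE[] := hw_spinor0_monogenic a b.
  by rewrite -[0](scale0r 0) raisingZ scale0r add0r mul1n addn0.
rewrite (@dT_raising _ (2 * a + b + 2 * l.+1)); last first.
  by have /monogenic_of_degreeE[] := hw_spinor_monogenic a b l.+1.
rewrite IHl raisingZ -/(hw_spinor a b l.+1) -scalerDl -natrD; congr (_%:R *: _).
by rewrite !mulnS !mulSn !mulnDr; ring.
Qed.

Lemma hw_spinor_neq0 a b l : hw_spinor a b l != 0.
Proof.
elim: l => [|l IHl].
  apply/eqP=> /ffunP/(_ i0); rewrite !ffunE eqxx => /eqP; apply/negP.
  exact: hw_poly_neq0.
apply: contraNneq IHl => v0; have := dT_hw_spinor a b l; rewrite v0.
have -> : dT_spinor (0 : spinor F) = 0.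
  by apply/ffunP=> s; rewrite !ffunE (derivation0 (derivation_dT F)).
have nz : (l.+1 * (2 * a + b + 5 + l))%:R != 0 :> F.
  by rewrite pnatr_eq0 -lt0n muln_gt0 /= !addn_gt0 !orbT.
by move/esym/eqP; rewrite scaler_eq0 (negPf nz).
Qed.

Definition upper_triangular n (A : 'M[F]_n) := forall i j : 'I_n, (j < i)%N -> A i j = 0.

Definition hw_weight a b l x : F :=
  (5%:R / 2%:R + (l + a + b)%:R) * x.1 j0 j0 + (5%:R / 2%:R + (l + a)%:R) * x.1 j1 j1
  + ((2 * a + b + 1)%:R * sl_mx x.2 i0 i0 + (a + b)%:R * sl_mx x.2 i1 i1 + a%:R * sl_mx x.2 i2 i2).

Lemma hw_spinor_act a b l x : upper_triangular x.1 -> upper_triangular (sl_mx x.2) ->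
  spinor_act x (hw_spinor a b l) = hw_weight a b l x *: hw_spinor a b l.
Proof.
move=> upA upZ; elim: l => [|l IHl]; last first.
  rewrite [hw_spinor _ _ _.+1]/hw_spinor iterS -/(hw_spinor _ _ _) raising_act IHl raisingZ -scalerDl.
  congr (_ *: _); rewrite /hw_weight /mxtrace sum_ord2 !addSn; ring.
have A10 : AA x j1 j0 = 0 by rewrite /AA upA // mpolyC0.
have ZZ0 p q : (q < p)%N -> ZZ x p q = 0 by move=> lt; rewrite /ZZ upZ // mpolyC0.
have Z0 := (ZZ0 i1 i0 isT, ZZ0 i2 i0 isT, ZZ0 i2 i1 isT, ZZ0 i3 i0 isT, ZZ0 i3 i1 isT, ZZ0 i3 i2 isT).
have dd := derivation_fa x.
have fy : fa x yy = (AA x j0 j0 - ZZ x i2 i2 - ZZ x i3 i3) * yy.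
  rewrite /yy faX sum_ord2 sum_ord4 A10 !Z0 !Xtab; ring.
have fD : fa x Delta =
    (AA x j0 j0 + AA x j1 j1 - ZZ x i1 i1 - ZZ x i2 i2 - 2%:R * ZZ x i3 i3) * Delta.
  rewrite /Delta (derivationB dd) !(derivationM dd) !faX !sum_ord2 !sum_ord4 A10.
  rewrite !Z0 !Xtab; ring.
have actP := @spinor_actP F; move: (@spinor_act F) actP => act actP.
apply/ffunP=> s; rewrite actP [RHS]ffunE -mul_mpolyC sum_ord4 !ffunE /=.
(* The weight of y^b Delta^a f_0 read off [fy] and [fD]; the stated form results from eliminating
   the last diagonal entry by the trace condition. *)
have -> : (hw_weight a b 0 x)%:MP = (5%:R / 2%:R)%:MP * trA x + ZZ x i0 i0
   + (b%:R * (AA x j0 j0 - ZZ x i2 i2 - ZZ x i3 i3) + a%:R *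
     (AA x j0 j0 + AA x j1 j1 - ZZ x i1 i1 - ZZ x i2 i2 - 2%:R * ZZ x i3 i3)).
  rewrite (ZZ_trace x) /hw_weight /trA /AA /ZZ !add0n.
  rewrite !(mpolyCD, mpolyCM) !mpolyC_nat; ring.
case: eqP => [->|ne]; first by rewrite (derivation_hw_poly _ _ dd fy fD); ring.
have lt0s : (0 < s)%N by rewrite lt0n; apply/eqP=> s0; apply: ne; apply: val_inj.
by rewrite (derivation0 dd) (ZZ0 s i0) //; ring.
Qed.

End HighestWeightVectors.

(** * Singular monogenic spinors *)

Section SingularPolynomials.
Variable F : numFieldType.
Local Notation poly := {mpoly F[#|{: coord}|]}.
Local Notation var := (var F).
Implicit Types (f g : poly) (j : 'I_2).
Implicit Type (m : 'X_{1..#|{: coord}|}).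

Lemma mcoeff_pder_eq0 c f m : pder c f = 0 -> m (enum_rank c) != 0%N -> f@_m = 0.
Proof.
move=> df0 nz; have := mcoeff_var_pder c f m; rewrite df0 mulr0 mcoeff0 => /esym/eqP.
by rewrite mulf_eq0 pnatr_eq0 (negPf nz) => /eqP.
Qed.

Lemma pder_comm c c' f : pder c (pder c' f) = pder c' (pder c f).
Proof. exact: mderiv_comm. Qed.

Local Notation u0 := (var (x2 k0 j0)).
Local Notation u1 := (var (x2 k0 j1)).
Local Notation w0 := (var (x2 k1 j0)).
Local Notation w1 := (var (x2 k1 j1)).
Local Notation du1 := (pder (x2 k0 j1)).
Local Notation dw0 := (pder (x2 k1 j0)).
Local Notation dw1 := (pder (x2 k1 j1)).

Definition four_vars (c : coord) : bool :=
  [|| c == x2 k0 j0, c == x2 k0 j1, c == x2 k1 j0 | c == x2 k1 j1].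

(** Polynomials in a 2 x 2 matrix of variables killed by a raising operator on rows and one on
    columns, as for the highest weight vectors of gl(2) x gl(2). The expected ones are the products
    of powers of the corner entry and of the determinant. *)
Definition singular_poly n f : Prop :=
  [/\ euler f = n%:R * f, forall c, ~~ four_vars c -> pder c f = 0,
      u0 * dw0 f + u1 * dw1 f = 0 & u0 * du1 f + w0 * dw1 f = 0].

Definition hw_span n f : Prop := forall U : poly -> Prop, subspace U ->
  (forall a b, (2 * a + b)%N = n -> U (hw_poly F a b)) -> U f.

Lemma hw_span_subspace n : subspace (hw_span n).
Proof.
split=> [U [] //|a f g sf sg U sU Uhw].
by apply: sU.2; [apply: sf | apply: sg].
Qed.

Lemma yyE : yy F = u0.
Proof. by rewrite /yy XE. Qed.

Lemma DeltaE : Delta F = w0 * u1 - u0 * w1.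
Proof. by rewrite /Delta !XE /skew4 /=; ring. Qed.

Definition raise_row f : poly := u0 * dw0 f + u1 * dw1 f.
Definition raise_col f : poly := u0 * du1 f + w0 * dw1 f.

Lemma derivation_raise_row : derivation raise_row.
Proof. by apply: derivation_add; apply/derivation_mul/derivation_pder. Qed.

Lemma derivation_raise_col : derivation raise_col.
Proof. by apply: derivation_add; apply/derivation_mul/derivation_pder. Qed.

Lemma derivation_hw_poly_kill (d : poly -> poly) a b : derivation d ->
  d u0 = 0 -> d (w0 * u1 - u0 * w1) = 0 -> d (hw_poly F a b) = 0.
Proof.
move=> dd d0 dD; rewrite (@derivation_hw_poly _ d 0 0) ?mulr0 ?addr0 ?mul0r //.
  by rewrite yyE.
by rewrite DeltaE.
Qed.

Lemma hw_poly_singular a b : singular_poly (2 * a + b) (hw_poly F a b).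
Proof.
have dd c := derivation_pder F c; split; first exact: hw_poly_euler.
- move=> c; rewrite /four_vars !negb_or => /and4P[/negPf n1 /negPf n2 /negPf n3 /negPf n4].
  apply: derivation_hw_poly_kill => //; first by rewrite pder_var n1 /=.
  rewrite (derivationB (dd c)) !(derivationM (dd c)) !pder_var n1 n2 n3 n4 /=; ring.
- apply: (derivation_hw_poly_kill _ _ derivation_raise_row); rewrite /raise_row.
    by rewrite !pder_var /=; ring.
  by rewrite !(derivationB (dd _)) !(derivationM (dd _)) !pder_var /=; ring.
- apply: (derivation_hw_poly_kill _ _ derivation_raise_col); rewrite /raise_col.
    by rewrite !pder_var /=; ring.
  by rewrite !(derivationB (dd _)) !(derivationM (dd _)) !pder_var /=; ring.
Qed.

Lemma singular_poly_subspace n : subspace (singular_poly n).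
Proof.
have dE := derivation_euler F; have dd c := derivation_pder F c.
split=> [|k f g [ef df rf cf] [eg dg rg cg]].
  split=> [|c _||]; rewrite ?(derivation0 dE) ?mulr0 // ?(derivation0 (dd c)) //.
    exact: (derivation0 derivation_raise_row).
  exact: (derivation0 derivation_raise_col).
split=> [|c nc||].
- rewrite (derivationD dE) (derivationZ dE) ef eg -!mul_mpolyC; ring.
- by rewrite (derivationD (dd c)) (derivationZ (dd c)) df // dg // scaler0 addr0.
- rewrite -[LHS]/(raise_row _) (derivationD derivation_raise_row).
  by rewrite (derivationZ derivation_raise_row) /raise_row rf rg scaler0 addr0.
- rewrite -[LHS]/(raise_col _) (derivationD derivation_raise_col).
  by rewrite (derivationZ derivation_raise_col) /raise_col cf cg scaler0 addr0.
Qed.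

Lemma hw_span_singular n f : hw_span n f -> singular_poly n f.
Proof.
apply; first exact: singular_poly_subspace.
by move=> a b <-; apply: hw_poly_singular.
Qed.

(* [dw1] commutes with the raising operators and maps the span of degree n + 1
   onto the span of degree n, up to powers of the determinant. *)
Lemma hw_span_dw1 n g : hw_span n g -> exists c f, hw_span n.+1 f /\
  g = dw1 f + c *: (if odd n then 0 else hw_poly F n./2 0).
Proof.
have dd := derivation_pder F (x2 k1 j1).
pose U g := exists c f, hw_span n.+1 f /\
  g = dw1 f + c *: (if odd n then 0 else hw_poly F n./2 0).
have sn := hw_span_subspace n.+1.
move=> sg; apply: (sg U) => [|a b Dn].
  split; first by exists 0, 0; rewrite scale0r addr0 (derivation0 dd); split=> //; case: sn.
  move=> k f1 f2 [c1 [g1 [s1 ->]]] [c2 [g2 [s2 ->]]].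
  exists (k * c1 + c2), (k *: g1 + g2); split; first exact: sn.2.
  rewrite (derivationD dd) (derivationZ dd).
  by rewrite scalerDr scalerDl scalerA addrACA.
case: b Dn => [|b] Dn.
  exists 1, 0; split; first by case: sn.
  rewrite (derivation0 dd) add0r scale1r -Dn addn0 oddM /=.
  by rewrite mul2n doubleK.
(* The derivative of y^b Delta^(a+1) by w1 is - (a + 1) y^(b+1) Delta^a. *)
exists 0, (- (a.+1%:R)^-1 *: hw_poly F a.+1 b); split.
  apply: subspaceZ sn _ => U' sU'; apply.
  by rewrite mulnS -Dn; lia.
have nz : a.+1%:R != 0 :> F by rewrite pnatr_eq0.
rewrite scale0r addr0 (derivationZ dd) /hw_poly (derivationM dd) (derivation_exp dd) yyE.
have -> : dw1 (u0 ^+ b) = 0.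
  have du : dw1 u0 = 0 * u0 by rewrite pder_var mul0r.
  by rewrite (derivation_eigen_exp b dd du) mulr0 mul0r.
rewrite DeltaE (derivationB dd) !(derivationM dd) !pder_var /= -mul_mpolyC.
have e : (- a.+1%:R^-1)%:MP * a.+1%:R = -1 :> poly.
  have -> : a.+1%:R = (a.+1%:R)%:MP :> poly by rewrite mpolyC_nat.
  by rewrite -mpolyCM mulNr mulVf // mpolyCN.
transitivity (- ((- a.+1%:R^-1)%:MP * a.+1%:R) * (u0 ^+ b.+1 * (w0 * u1 - u0 * w1) ^+ a) : poly).
  by rewrite e; ring.
rewrite exprS; ring.
Qed.

Lemma euler_pder c n f : euler f = n%:R * f ->
  euler (pder c f) + (coord_deg c)%:R * pder c f = n%:R * pder c f.
Proof.
have dE := derivation_euler F; have dc := derivation_pder F c; move=> ef.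
have comm : forall f, pder c (euler f) = euler (pder c f) + (coord_deg c)%:R * pder c f.
  apply: (derivation_comm_eq dc dE (derivation_mul _ dc)) => c'.
  rewrite euler_var (derivationM dc) (der_nat _ dc) !pder_var.
  case: eqVneq => [->|_]; first by rewrite (derivation1 dE) /=; ring.
  by rewrite (derivation0 dE) /=; ring.
by rewrite -comm ef (derivationM dc) (der_nat _ dc) mul0r add0r.
Qed.

Lemma one_var_poly n f : euler f = n%:R * f ->
  (forall c, c != x2 k0 j0 -> pder c f = 0) -> exists a, f = a *: u0 ^+ n.
Proof.
move=> ef df; pose m0 : 'X_{1..#|{: coord}|} := (U_(enum_rank (x2 k0 j0)) *+ n)%MM.
exists f@_m0; apply/mpolyP=> m; rewrite mcoeffZ /var mpolyXn mcoeffX -/m0.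
case: eqVneq => [<-|ne]; first by rewrite mulr1.
rewrite mulr0; apply/eqP; apply: contraNT ne => nz.
have mc c : c != x2 k0 j0 -> m (enum_rank c) = 0%N.
  by move=> /df dc; apply/eqP; apply: contraNT nz => mc; rewrite (mcoeff_pder_eq0 dc).
have /dhomogP hf := (dhomog_euler n f).2 ef.
have : mnm_deg m = n by apply: hf; rewrite mcoeff_msupp.
rewrite /mnm_deg (bigD1 (x2 k0 j0)) //= big1 => [|c /mc->]; last by rewrite muln0.
rewrite addn0 mul1n => mn.
apply/eqP/mnmP=> i; rewrite -(enum_valK i) mulmnE mnm1E (inj_eq enum_rank_inj).
by case: eqVneq => [<-|ne]; rewrite ?mul1n // mc // eq_sym.
Qed.

(** By induction the derivative of [f] by w1 has the expected form. Subtracting a preimage leaves f'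
    whose derivative by w1 is a multiple of a power of the determinant. Once this multiple is known
    to vanish, the two raising equations leave only a power of u0. *)
Lemma singular_polyP n f : singular_poly n f -> hw_span n f.
Proof.
have dd c := derivation_pder F c.
elim: n f => [|n IHn] f sf.
  have [ef df rf cf] := sf.
  have low c : pder c f = 0.
    apply: (@euler_neg _ 0 (coord_deg c)); first by case: c => [[[k i] j]|].
    by rewrite (euler_pder _ ef) !mul0r.
  have [a ->] := one_var_poly ef (fun c _ => low c).
  apply: (subspaceZ _ (hw_span_subspace 0)) => U sU hU.
  by have := hU 0%N 0%N erefl; rewrite /hw_poly !expr0 mulr1.
have [ef df rf cf] := sf.
have sg : singular_poly n (dw1 f).
  split.
  - apply: (addIr (1%:R * dw1 f)); rewrite (euler_pder (x2 k1 j1) ef).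
    by rewrite -natr1; ring.
  - by move=> c nc; rewrite pder_comm df // (derivation0 (dd _)).
  - have := congr1 dw1 rf; rewrite (derivation0 (dd _)) (derivationD (dd _)) !(derivationM (dd _)).
    by rewrite !pder_var /= !mul0r !add0r [dw1 (dw0 f)]pder_comm.
  - have := congr1 dw1 cf; rewrite (derivation0 (dd _)) (derivationD (dd _)) !(derivationM (dd _)).
    by rewrite !pder_var /= !mul0r !add0r [dw1 (du1 f)]pder_comm.
have [c [f1 [sf1 Dg]]] := hw_span_dw1 (IHn _ sg).
have sn := singular_poly_subspace n.+1.
have [e1 d1 r1 c1] := subspaceB sn sf (hw_span_singular sf1).
set f' := f - f1 in e1 d1 r1 c1.
have u0_neq0 : u0 != 0 by rewrite -msupp_eq0 /var msuppX.
have dw1f' : dw1 f' = c *: (if odd n then 0 else hw_poly F n./2 0).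
  by rewrite /f' (derivationB (dd _)) Dg addrAC subrr add0r.
have dw1f'0 : dw1 f' = 0.
  move: dw1f'; case: (odd n) => [|dw1f']; first by rewrite scaler0.
  (* At the point u0 = w1 = 0, u1 = w0 = 1 the determinant is 1 and the row equation reduces to c =
     0. *)
  pose e (i : 'I_#|{: coord}|) : F :=
    match enum_val i with Some (k, i, j) => if (i == k0) == (j == j0) then 0 else 1 | None => 0 end.
  have := congr1 (meval e) r1; rewrite dw1f' /hw_poly expr0 mul1r DeltaE meval0.
  rewrite mevalD !mevalM mevalZ rmorphXn /= mevalB !mevalM /var !mevalXU /e !enum_rankK /=.
  by rewrite !mul0r subr0 !mul1r add0r expr1n mulr1 => ->; rewrite scale0r.
have dw0f' : dw0 f' = 0.
  move/eqP: r1; rewrite dw1f'0 mulr0 addr0 mulf_eq0 (negPf u0_neq0) => /eqP //.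
have du1f' : du1 f' = 0.
  move/eqP: c1; rewrite dw1f'0 mulr0 addr0 mulf_eq0 (negPf u0_neq0) => /eqP //.
have one c' : c' != x2 k0 j0 -> pder c' f' = 0.
  move=> ne; case fv : (four_vars c'); last by rewrite d1 ?fv.
  by move: fv; rewrite /four_vars (negPf ne) /= => /or3P[] /eqP->.
have [a Df'] := one_var_poly e1 one.
rewrite -[f](subrK f1) -/f' Df'; apply: (subspaceD (hw_span_subspace _) _ sf1).
apply: (subspaceZ _ (hw_span_subspace _)) => U sU hU.
by have := hU 0%N n.+1 erefl; rewrite /hw_poly expr0 mulr1 yyE.
Qed.

End SingularPolynomials.

Section SingularSpinors.
Variable F : numFieldType.
Local Notation poly := {mpoly F[#|{: coord}|]}.
Local Notation var := (var F).
Local Notation X := (@X F).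
Implicit Types (x : g0 F) (f : poly) (psi : spinor F) (p q r s : 'I_4) (i j k : 'I_2).

Definition strictly_upper n (A : 'M[F]_n) := forall i j : 'I_n, (j <= i)%N -> A i j = 0.

Definition singular_spinor psi : Prop := forall x : g0 F,
  strictly_upper x.1 -> strictly_upper (sl_mx x.2) -> spinor_act x psi = 0.

Lemma delta_traceless p q : p != q -> (delta_mx p q : 'M[F]_4) \in @traceless F 4.
Proof.
move=> ne; rewrite inE /mxtrace big1 // => r _; rewrite mxE.
by case: eqP => [->|//]; rewrite (negPf ne).
Qed.

Definition sl_unit p q (ne : p != q) : g0 F := (0, SlMx (delta_traceless ne)).
Definition gl_unit : g0 F := (delta_mx j0 j1, 0).

Lemma fa_gl_unit f : fa gl_unit f = pairing (X j0) (fun p q => dX j1 p q f).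
Proof.
have dd := derivation_fa gl_unit.
apply: (derivation_eqX (d' := fun f => pairing (X j0) (fun p q => dX j1 p q f)) dd).
- rewrite /pairing; do 5?[apply: derivation_add]; by apply/derivation_mul/derivation_dX.
- by rewrite faT /trA /AA /pairing !mxE /= !dX_t mpolyC0; ring.
move=> j r s; rewrite faX sum_ord2 !sum_ord4 /ZZ /AA /pairing /= !mxE !dX_X /dl.
move: j; apply: ord2_ind; rewrite /= ?mulr0n ?mpolyC0 ?mulr1n ?mpolyC1; first by ring.
by move: r s; do 2!apply: ord4_ind; rewrite /= ?Xtab; ring.
Qed.

Lemma fa_sl_unit p q (ne : p != q) f :
  fa (sl_unit ne) f = \sum_j \sum_s X j q s * dX j s p f.
Proof.
have dd := derivation_fa (sl_unit ne).
have ZE r s : ZZ (sl_unit ne) r s = (p == r)%:R * (q == s)%:R.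
  by rewrite /ZZ /= mxE -natrM mulnb mpolyC_nat ![_ == r]eq_sym ![_ == s]eq_sym.
apply: (derivation_eqX (d' := fun f => \sum_j \sum_s X j q s * dX j s p f) dd).
- apply: derivation_bigsum => j; apply: derivation_bigsum => s.
  exact/derivation_mul/derivation_dX.
- rewrite faT /trA /AA !mxE mpolyC0 big1 => [|j _]; first by ring.
  by rewrite big1 // => s _; rewrite dX_t mulr0.
move=> j r s; rewrite faX big1 ?sub0r => [|k _]; last by rewrite /AA mxE mpolyC0 mul0r.
transitivity (\sum_i (i == j)%:R * \sum_u X j q u * dl F u p r s).
  rewrite [RHS](bigD1 j) //= [X in _ = _ + X]big1 => [|k ne_kj]; last by rewrite (negPf ne_kj) mul0r.
  rewrite addr0 eqxx mul1r dl_sum1; under eq_bigr do rewrite !ZE.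
  rewrite big_split /=.
  have pk (a : 'I_4 -> poly) b : \sum_u b * (q == u)%:R * a u = b * a q.
    by rewrite -(dl_pick a q) mulr_sumr; apply: eq_bigr => u _; ring.
  by rewrite !pk (X_anti F j q r); ring.
apply: eq_bigr => i _; rewrite mulr_sumr; apply: eq_bigr => u _; rewrite dX_X.
by case: eqVneq => [->|_]; rewrite /=; ring.
Qed.

(** Diagonal on monomials: it counts the variables whose matrix position involves the index p. Its
    eigenvalues are natural numbers, so it becomes injective after adding a positive integer. *)
Definition cartan p f : poly := \sum_j \sum_s X j p s * dX j p s f.

Lemma mcoeff_cartan p : exists cs : seq coord, forall f m,
  (cartan p f)@_m = (\sum_(c <- cs) m (enum_rank c))%:R * f@_m.
Proof.
suff [cs E] : exists cs : seq coord, forall f, cartan p f = \sum_(c <- cs) var c * pder c f.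
  exists cs => f m; rewrite E raddf_sum natr_sum mulr_suml; apply: eq_bigr => c _.
  exact: mcoeff_var_pder.
move: p; apply: ord4_ind.
- exists [:: x1 k0 j0; x1 k1 j0; x1 k2 j0; x1 k0 j1; x1 k1 j1; x1 k2 j1] => f.
  by rewrite /cartan !sum_ord2 !sum_ord4 !big_cons big_nil !XE /dX /skew4 /=; ring.
- exists [:: x1 k0 j0; x2 k2 j0; x2 k1 j0; x1 k0 j1; x2 k2 j1; x2 k1 j1] => f.
  by rewrite /cartan !sum_ord2 !sum_ord4 !big_cons big_nil !XE /dX /skew4 /=; ring.
- exists [:: x1 k1 j0; x2 k2 j0; x2 k0 j0; x1 k1 j1; x2 k2 j1; x2 k0 j1] => f.
  by rewrite /cartan !sum_ord2 !sum_ord4 !big_cons big_nil !XE /dX /skew4 /=; ring.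
- exists [:: x1 k2 j0; x2 k1 j0; x2 k0 j0; x1 k2 j1; x2 k1 j1; x2 k0 j1] => f.
  by rewrite /cartan !sum_ord2 !sum_ord4 !big_cons big_nil !XE /dX /skew4 /=; ring.
Qed.

Lemma cartan_eq0 n p f : (0 < n)%N -> n%:R * f + cartan p f = 0 -> f = 0.
Proof.
move=> n_gt0 e; have [cs E] := mcoeff_cartan p; apply/mpolyP=> m; rewrite mcoeff0.
have /eqP := congr1 (mcoeff m) e; rewrite mcoeffD mcoeff_natM E mcoeff0 -mulrDl -natrD.
by rewrite mulf_eq0 pnatr_eq0 addn_eq0 eqn0Ngt n_gt0 => /eqP.
Qed.

(** Eigenvalue 0 excludes every variable of row 0 of the matrices, that is, all x^1_ij. *)
Lemma cartan0_pder f (i : 'I_3) j : cartan i0 f = 0 -> pder (x1 i j) f = 0.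
Proof.
have dx : cartan i0 f = \sum_(c <- [:: x1 k0 j0; x1 k1 j0; x1 k2 j0; x1 k0 j1; x1 k1 j1; x1 k2 j1]) var c * pder c f.
  by rewrite /cartan !sum_ord2 !sum_ord4 !big_cons big_nil !XE /dX /skew4 /=; ring.
move=> e; apply/mpolyP=> m; rewrite mcoeff0 /pder mcoeff_deriv.
set m' := (m + _)%MM; suff -> : f@_m' = 0 by rewrite mul0rn.
have := congr1 (mcoeff m') e; rewrite dx raddf_sum mcoeff0.
under eq_bigr do rewrite /= mcoeff_var_pder.
rewrite -mulr_suml -natr_sum => /eqP; rewrite mulf_eq0 pnatr_eq0 sum_nat_seq_eq0 => /orP[/allP all0|/eqP//].
have : x1 i j \in [:: x1 k0 j0; x1 k1 j0; x1 k2 j0; x1 k0 j1; x1 k1 j1; x1 k2 j1].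
  by move: i j {m' all0}; apply: ord3_ind; apply: ord2_ind.
by move/all0; rewrite /m' mnmDE mnm1E eqxx addn1.
Qed.

Lemma coord_cases (P : coord -> Prop) : P x12 ->
  (forall (i : 'I_3) j, P (x1 i j)) -> (forall (i : 'I_3) j, P (x2 i j)) -> forall c, P c.
Proof.
have e0 : j0 = ord0 by apply: val_inj.
have e1 : j1 = ord_max by apply: val_inj.
move=> P12 P1 P2 [[[k i] j]|] //; move: k i; apply: ord2_ind => i.
  by rewrite e0; apply: P1.
by rewrite e1; apply: P2.
Qed.

Section Classification.
Variable psi : spinor F.
Hypotheses (mono : monogenic psi) (dT0 : dT_spinor psi = 0).
Hypothesis sing : singular_spinor psi.

Lemma dT_comp0 s : dT (psi s) = 0.
Proof. by have /ffunP/(_ s) := dT0; rewrite !ffunE. Qed.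

Lemma singular_dirac j s : \sum_r dX j s r (psi r) = 0.
Proof.
have /monogenicE/(_ j s) D0 := mono; rewrite -[RHS]D0; apply: eq_bigr => r _.
by rewrite /L dT_comp0 mulr0 addr0.
Qed.

(* Contracting the Dirac equations with X turns them into an identity between
   the gl(4)-operators. *)
Lemma singular_contract p :
  \sum_r \sum_j \sum_s X j p s * dX j s r (psi r) = 0.
Proof.
rewrite exchange_big big1 // => j _; rewrite exchange_big big1 // => s _.
by rewrite -mulr_sumr singular_dirac mulr0.
Qed.

Lemma singular_sl p q (ne : p != q) s : (p < q)%N ->
  (p == s)%:R * psi q + \sum_j \sum_u X j q u * dX j u p (psi s) = 0.
Proof.
move=> lt_pq.
have /sing H : strictly_upper (sl_unit ne).1 by move=> i j _; rewrite mxE.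
have /H/ffunP/(_ s) : strictly_upper (sl_mx (sl_unit ne).2).
  move=> i j le_ji; rewrite mxE; case: eqP => //= Di; case: eqP => //= Dj.
  by move: le_ji; rewrite Di Dj leqNgt lt_pq.
rewrite spinor_actP [RHS]ffunE fa_sl_unit => e; rewrite -[RHS]e; congr (_ + _).
rewrite /trA /AA !mxE mpolyC0 addr0 mulr0 mul0r add0r -(dl_pick psi q) mulr_sumr.
apply: eq_bigr => r _; rewrite /ZZ /= mxE mpolyC_nat ![_ == p]eq_sym ![_ == q]eq_sym.
by case: (p == s); case: (q == r); rewrite /=; ring.
Qed.

Lemma contract_diag p f : \sum_j \sum_s X j p s * dX j s p f = - cartan p f.
Proof.
rewrite /cartan -sumrN; apply: eq_bigr => j _; rewrite -sumrN; apply: eq_bigr => s _.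
by rewrite /dX skew4_anti mulrN.
Qed.

(** In the contracted equation for p, the p terms with r < p equal - psi_p by the raising operators,
    the diagonal term is - cartan psi_p, and the terms with r > p vanish once psi_r = 0. Descending
    from p = 3, this reads (p + cartan) psi_p = 0. *)
Lemma singular_head : [/\ psi i1 = 0, psi i2 = 0, psi i3 = 0 & cartan i0 (psi i0) = 0].
Proof.
pose ee r p s := \sum_j \sum_u X j p u * dX j u r (psi s).
have low p q (lt : (p < q)%N) : ee p q p = - psi q.
  have ne : p != q by rewrite -val_eqE neq_ltn lt.
  by have /eqP := singular_sl ne p lt; rewrite eqxx mul1r addrC addr_eq0 => /eqP.
have contr p : ee i0 p i0 + ee i1 p i1 + ee i2 p i2 + ee i3 p i3 = 0.
  by have := singular_contract p; rewrite sum_ord4.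
have diag p : ee p p p = - cartan p (psi p) by apply: contract_diag.
have zero r p s : psi s = 0 -> ee r p s = 0.
  move=> s0; rewrite /ee s0 big1 // => j _; rewrite big1 // => u _.
  by rewrite (derivation0 (derivation_dX F j u r)) mulr0.
have p3 : psi i3 = 0.
  apply: (@cartan_eq0 3 i3) => //; apply/eqP; rewrite -oppr_eq0 -(contr i3) (low i0 i3 isT) (low i1 i3 isT) (low i2 i3 isT) diag; apply/eqP; ring.
have p2 : psi i2 = 0.
  apply: (@cartan_eq0 2 i2) => //; apply/eqP; rewrite -oppr_eq0 -(contr i2) (low i0 i2 isT) (low i1 i2 isT) diag (zero _ _ _ p3).
  by apply/eqP; ring.
have p1 : psi i1 = 0.
  apply: (@cartan_eq0 1 i1) => //; apply/eqP; rewrite -oppr_eq0 -(contr i1) (low i0 i1 isT) diag (zero _ _ _ p3) (zero _ _ _ p2).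
  by apply/eqP; ring.
split=> //; apply/eqP; rewrite -oppr_eq0 -(contr i0) diag (zero _ _ _ p3) (zero _ _ _ p2) (zero _ _ _ p1).
by apply/eqP; ring.
Qed.

Lemma singular_head_poly n : homog_spinor n psi -> singular_poly n (psi i0).
Proof.
move=> hom; have [_ _ _ c0] := singular_head; set f := psi i0 in c0 *.
have dx (i : 'I_3) j : pder (x1 i j) f = 0 by apply: cartan0_pder.
have E p q (ne : p != q) (lt : (p < q)%N) (np : p != i0) : \sum_j \sum_u X j q u * dX j u p f = 0.
  by have := singular_sl ne i0 lt; rewrite (negPf np) mul0r add0r.
have r12 := E i1 i2 isT isT isT; have r13 := E i1 i3 isT isT isT; have r23 := E i2 i3 isT isT isT.
have rgl : fa gl_unit f = 0.
  have /sing H : strictly_upper gl_unit.1.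
    by move=> i j; rewrite mxE; move: i j; do 2!apply: ord2_ind.
  have /H/ffunP/(_ i0) : strictly_upper (sl_mx gl_unit.2) by move=> i j _; rewrite mxE.
  rewrite spinor_actP [RHS]ffunE => e; rewrite -[RHS]e; rewrite big1 => [|r _]; last by rewrite /ZZ mxE mpolyC0 mul0r.
  by rewrite /trA /AA !mxE mpolyC0; ring.
rewrite fa_gl_unit /pairing in rgl.
rewrite !sum_ord2 !sum_ord4 in r12 r13 r23.
rewrite !XE /dX /skew4 /= !dx in r12 r13 r23 rgl.
set u0 := var (x2 k0 j0) in r12 r13 r23 rgl *; set u1 := var (x2 k0 j1) in r12 r13 r23 rgl *.
set w0 := var (x2 k1 j0) in r12 r13 r23 rgl *; set w1 := var (x2 k1 j1) in r12 r13 r23 rgl *.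
(* A linear system for the two derivatives by x^2_3j, with determinant - Delta: both vanish, and
   four variables remain. *)
have e1 : u0 * pder (x2 k2 j0) f + u1 * pder (x2 k2 j1) f = 0 by rewrite -r13; ring.
have e2 : w0 * pder (x2 k2 j0) f + w1 * pder (x2 k2 j1) f = 0 by rewrite -r23; ring.
have nzD : w0 * u1 - u0 * w1 != 0.
  have := hw_poly_neq0 F 1 0; rewrite /hw_poly expr0 mul1r expr1; apply: contraNneq => <-.
  by rewrite DeltaE.
have d0 : pder (x2 k2 j0) f = 0.
  have /eqP : (w0 * u1 - u0 * w1) * pder (x2 k2 j0) f = 0.
    transitivity (u1 * (w0 * pder (x2 k2 j0) f + w1 * pder (x2 k2 j1) f)
      - w1 * (u0 * pder (x2 k2 j0) f + u1 * pder (x2 k2 j1) f)); first by ring.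
    by rewrite e1 e2 !mulr0 subrr.
  by rewrite mulf_eq0 (negPf nzD) => /eqP.
have d1 : pder (x2 k2 j1) f = 0.
  have /eqP : (w0 * u1 - u0 * w1) * pder (x2 k2 j1) f = 0.
    transitivity (w0 * (u0 * pder (x2 k2 j0) f + u1 * pder (x2 k2 j1) f)
      - u0 * (w0 * pder (x2 k2 j0) f + w1 * pder (x2 k2 j1) f)); first by ring.
    by rewrite e1 e2 !mulr0 subrr.
  by rewrite mulf_eq0 (negPf nzD) => /eqP.
split; first exact: hom.
- apply: (coord_cases (P := fun c => ~~ four_vars c -> pder c f = 0)) => //.
  + by move=> _; apply: dT_comp0.
  + by apply: ord3_ind; apply: ord2_ind => //= _.
- by rewrite -r12 /u0 /u1; ring.
- by rewrite -rgl d1 /u0 /w0; ring.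
Qed.

End Classification.

Definition hw_spinor_span n psi : Prop := forall U : spinor F -> Prop, subspace U ->
  (forall a b l, (2 * a + b + 2 * l)%N = n -> U (hw_spinor F a b l)) -> U psi.

Lemma hw_spinor_span_subspace n : subspace (hw_spinor_span n).
Proof.
split=> [U [] //|a f g sf sg U sU Uhw].
by apply: sU.2; [apply: sf | apply: sg].
Qed.

Lemma classical_singular n psi : monogenic_of_degree n psi -> dT_spinor psi = 0 ->
  singular_spinor psi -> hw_spinor_span n psi.
Proof.
move=> /monogenic_of_degreeE[D0 hom] dT0 sing; have /monogenicE mono := D0.
have [p1 p2 p3 _] := singular_head mono dT0 sing.
have /singular_polyP := singular_head_poly mono dT0 sing hom.
pose emb f : spinor F := [ffun s => if s == i0 then f else 0].
have Dpsi : psi = emb (psi i0).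
  by apply/ffunP; apply: ord4_ind; rewrite ffunE.
move=> span; rewrite Dpsi; apply: (span (fun f => hw_spinor_span n (emb f))).
  split=> [|a f g sf sg].
    rewrite (_ : emb 0 = 0); first by case: (hw_spinor_span_subspace n).
    by apply/ffunP=> s; rewrite !ffunE; case: ifP.
  rewrite (_ : emb (a *: f + g) = a *: emb f + emb g); first exact: (hw_spinor_span_subspace n).2.
  by apply/ffunP=> s; rewrite !ffunE; case: ifP; rewrite ?scaler0 ?addr0.
by move=> a b Dn U sU hU; have := hU a b 0%N; rewrite muln0 addn0; apply.
Qed.

Lemma singular_dT psi : singular_spinor psi -> singular_spinor (dT_spinor psi).
Proof.
move=> sing x upA upZ; have := dT_spinor_act x psi; rewrite (sing x) //.
have -> : \tr x.1 = 0 by rewrite /mxtrace big1 // => i _; apply: upA.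
rewrite scale0r addr0 => <-; apply/ffunP=> s; rewrite !ffunE.
exact: (derivation0 (derivation_dT F)).
Qed.

Lemma hw_spinor_singular a b l : singular_spinor (hw_spinor F a b l).
Proof.
move=> x upA upZ; rewrite hw_spinor_act => [|i j lt|i j lt]; last 2 first.
- by apply: upA; apply: ltnW.
- by apply: upZ; apply: ltnW.
by rewrite /hw_weight !upA // !upZ // !mulr0 !addr0 scale0r.
Qed.

Lemma singular_spinor_subspace : subspace singular_spinor.
Proof.
split=> [|a u v su sv] x upA upZ.
  by have := spinor_act_linr x (-1) (0 : spinor F) 0; rewrite scaler0 addr0 scaleN1r addNr.
by rewrite spinor_act_linr su // sv // scaler0 addr0.
Qed.

Lemma dT_spinor_comb a u v : dT_spinor (a *: u + v) = a *: dT_spinor u + dT_spinor v :> spinor F.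
Proof.
have dd := derivation_dT F; apply/ffunP=> s; rewrite !ffunE.
by rewrite (derivationD dd) (derivationZ dd).
Qed.

Lemma singular_monogenic n psi : monogenic_of_degree n psi -> singular_spinor psi ->
  hw_spinor_span n psi.
Proof.
elim/ltn_ind: n psi => n IHn psi Mpsi sing.
have [lt_n2|] := ltnP n 2.
  apply: classical_singular => //; apply: (dT_low lt_n2).
  by case/monogenic_of_degreeE: Mpsi.
case: n IHn Mpsi => [|[|n]] // IHn Mpsi _.
have MT := monogenic_of_degree_dT Mpsi.
have span := IHn n (ltnW (ltnSn _)) _ MT (singular_dT sing).
(* The images under [dT_spinor] of singular monogenic combinations of the expected vectors. They
   include all expected vectors of degree n, because the constant in [dT_hw_spinor] is
   invertible. *)
pose U (phi : spinor F) := exists phi', [/\ hw_spinor_span n.+2 phi', monogenic_of_degree n.+2 phi',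
  singular_spinor phi' & dT_spinor phi' = phi].
have sS := hw_spinor_span_subspace n.+2; have sM := @monogenic_of_degree_subspace F n.+2.
have sSing := singular_spinor_subspace.
have [phi [sphi Mphi singphi Tphi]] : U (dT_spinor psi).
  apply: span => [|a b l Dn].
    split=> [|k _ _ [f [s1 m1 g1 <-]] [f' [s2 m2 g2 <-]]].
      exists 0; split; [by case: sS | by case: sM | by case: sSing |].
      by apply/ffunP=> s; rewrite !ffunE (derivation0 (derivation_dT F)).
    exists (k *: f + f'); split; [exact: sS.2 | exact: sM.2 | exact: sSing.2 | exact: dT_spinor_comb].
  pose c : F := (l.+1 * (2 * a + b + 5 + l))%:R.
  have nz : c != 0 by rewrite pnatr_eq0 -lt0n muln_gt0 /= !addn_gt0 !orbT.
  have Dn' : (2 * a + b + 2 * l.+1)%N = n.+2 by rewrite mulnS addnCA Dn.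
  exists (c^-1 *: hw_spinor F a b l.+1); split.
  - by apply: (subspaceZ _ sS) => V sV; apply.
  - by apply: (subspaceZ _ sM); rewrite -Dn'; apply: hw_spinor_monogenic.
  - by apply: (subspaceZ _ sSing); apply: hw_spinor_singular.
  have := dT_spinor_comb c^-1 (hw_spinor F a b l.+1) 0.
  rewrite addr0 => ->; rewrite dT_hw_spinor -/c scalerA mulVf // scale1r.
  rewrite (_ : dT_spinor 0 = 0) ?addr0 //.
  by apply/ffunP=> s; rewrite !ffunE (derivation0 (derivation_dT F)).
rewrite -[psi](subrK phi); apply: (subspaceD sS _ sphi); apply: classical_singular.
- exact: (subspaceB sM).
- have := dT_spinor_comb (-1) phi psi; rewrite !scaleN1r addrC => ->.
  by rewrite Tphi addNr.
- exact: (subspaceB sSing).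
Qed.

End SingularSpinors.

(** * The Fischer form *)

Section FischerForm.
Variable F : numClosedFieldType.
Local Notation poly := {mpoly F[#|{: coord}|]}.
Local Notation var := (var F).
Local Notation X := (@X F).
Local Notation t := (@t F).
Local Notation dl := (@dl F).
Implicit Types (x : g0 F) (f g : poly) (psi : spinor F) (p q r s : 'I_4) (i j k : 'I_2).
Implicit Type (m : 'X_{1..#|{: coord}|}).

(** In this form the adjoint is visible: multiplications and derivatives change places, which
    transposes the coefficient matrices. *)
Lemma fa_explicit x f : fa x f =
  \sum_j \sum_k AA x k j * pairing (X k) (fun p q => dX j p q f) + trA x * (t * dT f)
  - \sum_j \sum_p \sum_r ZZ x p r * \sum_q X j r q * dX j p q f.
Proof.
have dd := derivation_fa x; have dX' := derivation_dX F; have dT' := derivation_dT F.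
have dP k j : derivation (fun f => pairing (X k) (fun p q => dX j p q f)).
  by rewrite /pairing; do 5?[apply: derivation_add]; apply: derivation_mul.
apply: (derivation_eqX (d' := fun f =>
  \sum_j \sum_k AA x k j * pairing (X k) (fun p q => dX j p q f) + trA x * (t * dT f)
  - \sum_j \sum_p \sum_r ZZ x p r * \sum_q X j r q * dX j p q f) dd).
- apply: derivation_add; last apply: derivation_opp.
    apply: derivation_add; last by apply/derivation_mul/derivation_mul.
    by apply: derivation_bigsum => j; apply: derivation_bigsum => k; apply/derivation_mul/dP.
  apply: derivation_bigsum => j; apply: derivation_bigsum => p; apply: derivation_bigsum => r.
  by apply/derivation_mul/derivation_bigsum => q; apply: derivation_mul.
- rewrite faT dT_t [X in X + _ - _]big1 => [|j _]; last first.
    by rewrite big1 // => k _; rewrite /pairing !dX_t; ring.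
  rewrite [X in _ - X]big1 => [|j _]; first by ring.
  rewrite big1 // => p _; rewrite big1 // => r _; rewrite big1 ?mulr0 // => q _.
  by rewrite dX_t mulr0.
move=> i r s; rewrite faX dT_X !mulr0 addr0; congr (_ - _).
  rewrite [RHS](bigD1 i) //= [X in _ = _ + X]big1 ?addr0 => [|j ne_ji].
    apply: eq_bigr => k _; congr (_ * _); rewrite /pairing !dX_X eqxx !mul1r /dl.
    by move: r s; do 2!apply: ord4_ind; rewrite /= ?Xtab; move: (X k) => *; ring.
  by rewrite big1 // => k _; rewrite /pairing !dX_X (negPf ne_ji) !mul0r !mulr0 !addr0 mulr0.
rewrite [RHS](bigD1 i) //= [X in _ = _ + X]big1 ?addr0 => [|j ne_ji]; last first.
  rewrite big1 // => p _; rewrite big1 // => u _; rewrite big1 ?mulr0 // => q _.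
  by rewrite dX_X (negPf ne_ji) mul0r mulr0.
transitivity (\sum_p \sum_u ZZ x p u * (X i u s * (p == r)%:R - X i u r * (p == s)%:R)); last first.
  apply: eq_bigr => p _; apply: eq_bigr => u _; congr (_ * _); rewrite -dl_sum2.
  by apply: eq_bigr => q _; rewrite dX_X eqxx mul1r.
rewrite exchange_big; apply: eq_bigr => u _ /=.
transitivity (X i u s * (\sum_p ZZ x p u * (p == r)%:R) - X i u r * (\sum_p ZZ x p u * (p == s)%:R)).
  by rewrite !(dl_pick' (fun p => ZZ x p u)) (X_anti F i r u); ring.
by rewrite !mulr_sumr -sumrB; apply: eq_bigr => p _; ring.
Qed.

Definition mfact m : nat := \prod_i (m i)`!.

(** Monomials are orthogonal, and the squared norm is the product of the factorials of the
    exponents. Summing over the support of [g] makes linearity in [f] immediate. *)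
Definition pform f g : F := \sum_(m <- msupp g) (mfact m)%:R * (f@_m * (g@_m)^*).

Lemma pformE ms f g : uniq ms -> {subset msupp g <= ms} ->
  pform f g = \sum_(m <- ms) (mfact m)%:R * (f@_m * (g@_m)^*).
Proof.
move=> uniq_ms sub; rewrite /pform [RHS](bigID (mem (msupp g))) /=.
rewrite [X in _ = _ + X]big1 ?addr0 => [|m /memN_msupp_eq0 ->]; last by rewrite conjC0 !mulr0.
rewrite -[RHS]big_filter; apply: perm_big; apply: uniq_perm; rewrite ?msupp_uniq ?filter_uniq //.
by move=> m; rewrite mem_filter; case gm: (m \in msupp g) => //=; rewrite sub.
Qed.

Lemma pform_linear g : scalar (pform^~ g).
Proof.
move=> a f f'; rewrite /pform mulr_sumr -big_split; apply: eq_bigr => m _ /=.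
by rewrite mcoeffD mcoeffZ; ring.
Qed.

Lemma pformDl f f' g : pform (f + f') g = pform f g + pform f' g.
Proof. by rewrite -[f]scale1r pform_linear mul1r scale1r. Qed.

Lemma pform0l g : pform 0 g = 0.
Proof. by rewrite /pform big1 // => m _; rewrite mcoeff0 mul0r mulr0. Qed.

Lemma pformZl a f g : pform (a *: f) g = a * pform f g.
Proof. by rewrite -[a *: f]addr0 pform_linear pform0l addr0. Qed.

Lemma pformCl a f g : pform (a%:MP * f) g = a * pform f g.
Proof. by rewrite mul_mpolyC pformZl. Qed.

Lemma pform_suml I (r : seq I) (P : pred I) (f : I -> poly) g :
  pform (\sum_(i <- r | P i) f i) g = \sum_(i <- r | P i) pform (f i) g.
Proof. by apply: (big_morph (pform^~ g)) => [f1 f2|]; [apply: pformDl | apply: pform0l]. Qed.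

Lemma pform_sym f g : pform f g = (pform g f)^*.
Proof.
pose ms := undup (msupp f ++ msupp g).
rewrite (@pformE ms f g) ?undup_uniq // => [|m gm]; last by rewrite mem_undup mem_cat gm orbT.
rewrite (@pformE ms g f) ?undup_uniq // => [|m fm]; last by rewrite mem_undup mem_cat fm.
rewrite rmorph_sum; apply: eq_bigr => m _ /=.
by rewrite !rmorphM /= conjCK rmorph_nat [f@_m * _]mulrC.
Qed.

Lemma pformDr f g g' : pform f (g + g') = pform f g + pform f g'.
Proof. by rewrite pform_sym pformDl rmorphD /= -!(pform_sym f). Qed.

Lemma pform0r f : pform f 0 = 0.
Proof. by rewrite pform_sym pform0l conjC0. Qed.

Lemma pformNl f g : pform (- f) g = - pform f g.
Proof. by rewrite -scaleN1r pformZl mulN1r. Qed.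

Lemma pformNr f g : pform f (- g) = - pform f g.
Proof. by rewrite pform_sym pformNl rmorphN /= -pform_sym. Qed.

Lemma pformCr a f g : pform f (a%:MP * g) = a^* * pform f g.
Proof. by rewrite pform_sym pformCl rmorphM /= -pform_sym. Qed.

Lemma pform_sumr I (r : seq I) (P : pred I) f (g : I -> poly) :
  pform f (\sum_(i <- r | P i) g i) = \sum_(i <- r | P i) pform f (g i).
Proof. by apply: (big_morph (pform f)) => [g1 g2|]; [apply: pformDr | apply: pform0r]. Qed.

Lemma mfact_gt0 m : (0 < mfact m)%N.
Proof. by rewrite prodn_gt0 // => i; apply: fact_gt0. Qed.

Lemma pform_ge0 f : 0 <= pform f f.
Proof. by apply: sumr_ge0 => m _; rewrite mulr_ge0 ?ler0n ?mul_conjC_ge0. Qed.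

Lemma pform_definite f : pform f f = 0 -> f = 0.
Proof.
move/eqP; rewrite psumr_eq0 => [/allP f0|m _]; last by rewrite mulr_ge0 ?ler0n ?mul_conjC_ge0.
apply/mpolyP=> m; rewrite mcoeff0; have [fm|/memN_msupp_eq0//] := boolP (m \in msupp f).
have := f0 m fm; rewrite /= mulf_eq0 pnatr_eq0 -[_ == 0%N]negbK -lt0n mfact_gt0 /=.
by rewrite mul_conjC_eq0 => /eqP.
Qed.

Lemma pformX m g : pform 'X_[m] g = (mfact m)%:R * (g@_m)^*.
Proof.
rewrite /pform; have [gm|/memN_msupp_eq0 g0] := boolP (m \in msupp g).
  rewrite (bigD1_seq m) ?msupp_uniq //= mcoeffX eqxx mul1r big1 ?addr0 // => m' ne.
  by rewrite mcoeffX eq_sym (negPf ne) mul0r mulr0.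
rewrite g0 conjC0 mulr0 big1 // => m' _; rewrite mcoeffX.
by case: eqP => [<-|_]; rewrite ?g0 ?conjC0 ?mulr0 // mul0r mulr0.
Qed.

Lemma mfactU m c : mfact (m + U_(c)) = ((m c).+1 * mfact m)%N.
Proof.
rewrite /mfact (bigD1 c) //= [in RHS](bigD1 c) //= mulnA mnmDE mnm1E eqxx addn1 factS.
congr (_ * _)%N; apply: eq_bigr => i ne; rewrite mnmDE mnm1E eq_sym (negPf ne) addn0 //.
Qed.

(** Raising the exponent of a variable from e to e + 1 multiplies the factorial weight by e + 1, the
    factor that differentiation produces. *)
Lemma pform_var c f g : pform (var c * f) g = pform f (pder c g).
Proof.
rewrite [f]mpolyE mulr_sumr !pform_suml; apply: eq_bigr => m _.
rewrite -scalerAr !pformZl; congr (_ * _); rewrite /var -mpolyXD !pformX /pder mcoeff_deriv.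
by rewrite addmC mfactU rmorphMn /= -mulr_natr natrM; ring.
Qed.

Lemma pform_X j p q f g : pform (X j p q * f) g = pform f (dX j p q g).
Proof.
move: p q; do 2!apply: ord4_ind; rewrite XE /dX /skew4 /= ?mulNr ?mul0r ?opprK ?pformNl ?pform_var ?pform0l
  ?pformNr ?pform0r ?opprK //.
Qed.

Lemma pform_dX j p q f g : pform (dX j p q f) g = pform f (X j p q * g).
Proof. by rewrite pform_sym -pform_X -pform_sym. Qed.

Lemma pform_t f g : pform (t * f) g = pform f (dT g).
Proof. exact: pform_var. Qed.

Lemma pform_dT f g : pform (dT f) g = pform f (t * g).
Proof. by rewrite pform_sym -pform_t -pform_sym. Qed.

Lemma pform_pairing k j f g :
  pform (pairing (X k) (fun p q => dX j p q f)) g = pform f (pairing (X j) (fun p q => dX k p q g)).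
Proof. by rewrite /pairing !pformDl !pformDr !pform_X !pform_dX. Qed.

End FischerForm.

Section UnitaryAction.
Variable F : numClosedFieldType.
Local Notation poly := {mpoly F[#|{: coord}|]}.
Implicit Types (x : g0 F) (f g : poly) (psi : spinor F) (p q r s : 'I_4) (i j k : 'I_2).
Implicit Type (m : 'X_{1..#|{: coord}|}).

Definition sform (u v : spinor F) : F := \sum_s pform (u s) (v s).

Lemma sform_linear v : scalar (sform^~ v).
Proof.
move=> a u u'; rewrite /sform mulr_sumr -big_split; apply: eq_bigr => s _ /=.
by rewrite spinor_comb pformDl pformCl.
Qed.

Lemma sform_sym u v : sform u v = (sform v u)^*.
Proof. by rewrite /sform rmorph_sum; apply: eq_bigr => s _; rewrite pform_sym. Qed.

Lemma sform_definite u : sform u u = 0 -> u = 0.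
Proof.
move/eqP; rewrite psumr_eq0 => [/allP u0|s _]; last exact: pform_ge0.
apply/ffunP=> s; rewrite ffunE; apply: pform_definite; apply/eqP.
by apply: (u0 s); rewrite mem_index_enum.
Qed.

Definition fischer : hermitian_form (spinor F) :=
  HermitianForm sform_linear sform_sym sform_definite.

Definition conj_mx n (A : 'M[F]_n) : 'M[F]_n := \matrix_(i, j) (A j i)^*.

Lemma conj_mx_traceless (Z : sl_type F 4) : conj_mx (sl_mx Z) \in @traceless F 4.
Proof.
have := valP Z; rewrite !inE => /eqP trZ.
rewrite -(conjC0 F) -trZ rmorph_sum; apply/eqP/eq_bigr => i _; by rewrite mxE.
Qed.

Definition gl_star (A : gl F 2) : gl F 2 := conj_mx A.
Definition sl_star (Z : sl F 4) : sl F 4 := SlMx (conj_mx_traceless Z).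
Definition g0_star : g0 F -> g0 F := prod_star gl_star sl_star.

Lemma AA_star x i j : AA (g0_star x) i j = ((x.1 j i)^*)%:MP.
Proof. by rewrite /AA /= mxE. Qed.

Lemma ZZ_star x p q : ZZ (g0_star x) p q = ((sl_mx x.2 q p)^*)%:MP.
Proof. by rewrite /ZZ /= mxE. Qed.

Lemma pform_fa x f g : pform (fa x f) g = pform f (fa (g0_star x) g).
Proof.
rewrite !fa_explicit !pformDl !pformDr !pformNl !pformNr; congr (_ + _ - _).
- rewrite pform_suml pform_sumr; under eq_bigr do rewrite pform_suml.
  under [RHS]eq_bigr do rewrite pform_sumr.
  rewrite exchange_big; apply: eq_bigr => j _; apply: eq_bigr => k _ /=.
  by rewrite AA_star /AA pformCl pformCr conjCK pform_pairing.
- rewrite /trA !AA_star !mulrDl !pformDl !pformDr; congr (_ + _); rewrite /AA pformCl pformCr conjCK;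
  by rewrite pform_t pform_dT.
rewrite pform_suml pform_sumr; apply: eq_bigr => j _.
rewrite pform_suml pform_sumr; under eq_bigr do rewrite pform_suml.
under [RHS]eq_bigr do rewrite pform_sumr.
rewrite exchange_big; apply: eq_bigr => p _; apply: eq_bigr => r _ /=.
rewrite ZZ_star /ZZ pformCl pformCr conjCK; congr (_ * _).
rewrite pform_suml pform_sumr; apply: eq_bigr => q _.
by rewrite pform_X pform_dX.
Qed.

Lemma fischer_adjoint x u w :
  fischer (spinor_act x u) w = fischer u (spinor_act (g0_star x) w).
Proof.
have actP := @spinor_actP F; move: (@spinor_act F) actP => act actP.
rewrite /= /sform.
under eq_bigr do rewrite actP !pformDl pform_fa.
under [RHS]eq_bigr do rewrite actP !pformDr.
rewrite !big_split; congr (_ + _ + _); first (apply: eq_bigr => s _).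
  rewrite /= -mulrA pformCl -[in RHS]mulrA pformCr rmorphM fmorphV !rmorph_nat; congr (_ * _).
  by rewrite /trA !AA_star !mulrDl !pformDl !pformDr /AA !pformCl !pformCr !conjCK.
under eq_bigr do rewrite pform_suml.
under [RHS]eq_bigr do rewrite pform_sumr.
rewrite exchange_big; apply: eq_bigr => r _; apply: eq_bigr => s _ /=.
by rewrite ZZ_star /ZZ pformCl pformCr conjCK.
Qed.

Definition gl_np (A : gl F 2) : Prop := strictly_upper (A : 'M_2).
Definition gl_nm (A : gl F 2) : Prop := strictly_upper (A : 'M_2)^T.
Definition gl_bo (A : gl F 2) : Prop := upper_triangular (A : 'M_2).
Definition sl_np (Z : sl F 4) : Prop := strictly_upper (sl_mx Z).
Definition sl_nm (Z : sl F 4) : Prop := strictly_upper (sl_mx Z)^T.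
Definition sl_bo (Z : sl F 4) : Prop := upper_triangular (sl_mx Z).

Definition lower_part n (A : 'M[F]_n) : 'M[F]_n := \matrix_(i, j) if (j < i)%N then A i j else 0.

Lemma lower_part_strict n (A : 'M[F]_n) : strictly_upper (lower_part A)^T.
Proof. by move=> i j le_ij; rewrite !mxE ltnNge le_ij. Qed.

Lemma lower_part_sub n (A : 'M[F]_n) : upper_triangular (A - lower_part A).
Proof. by move=> i j lt_ij; rewrite !mxE lt_ij subrr. Qed.

Lemma lower_part_traceless (A : 'M[F]_4) : lower_part A \in @traceless F 4.
Proof. by rewrite inE /mxtrace big1 // => i _; rewrite mxE ltnn. Qed.

Lemma conj_mx_strict n (A : 'M[F]_n) : strictly_upper A^T -> strictly_upper (conj_mx A).
Proof. by move=> sA i j le_ij; rewrite mxE; have := sA _ _ le_ij; rewrite mxE => ->; rewrite conjC0. Qed.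

Lemma spinor_unitary : unitary_action fischer g0_star (prod_pred gl_np sl_np)
  (prod_pred gl_nm sl_nm) (prod_pred gl_bo sl_bo) (@spinor_act F).
Proof.
split.
- exact: spinor_act_linl.
- exact: spinor_act_linr.
- exact: spinor_act_br.
- exact: fischer_adjoint.
- by move=> x [nA nZ]; split; apply: conj_mx_strict.
- move=> [A Z]; pose L := SlMx (lower_part_traceless (sl_mx Z)) : sl F 4.
  exists ((lower_part A, L) : g0 F), ((A - lower_part A, Z - L) : g0 F); split.
  + by congr (_, _); rewrite addrC subrK.
  + by split; apply: lower_part_strict.
  + by split; [apply: lower_part_sub | apply: (lower_part_sub (sl_mx Z))].
Qed.

Lemma gl_zero : [/\ gl_star 0 = 0, gl_np 0, gl_nm 0 & gl_bo 0].
Proof.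
split; [by apply/matrixP=> i j; rewrite !mxE conjC0 | | |];
  by move=> i j _; rewrite !mxE.
Qed.

Lemma sl_zero : [/\ sl_star 0 = 0, sl_np 0, sl_nm 0 & sl_bo 0].
Proof.
split; [by apply/val_inj/matrixP=> i j; rewrite !mxE conjC0 | | |];
  by move=> i j _; rewrite !mxE.
Qed.

End UnitaryAction.

(** * Heights, nilpotency of the raising operators, finite dimension *)

Section Finiteness.
Variable F : numClosedFieldType.
Local Notation N := #|{: coord}|.
Local Notation poly := {mpoly F[N]}.
Local Notation var := (var F).
Local Notation X := (@X F).
Implicit Types (x : g0 F) (f g : poly) (psi : spinor F) (p q r s : 'I_4) (i j k : 'I_2).
Implicit Type (m : 'X_{1..N}).

(* A grading by which every raising operator strictly increases degrees: the
   variable X_j^{pq} has height p + q + [j = 0]. *)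
Definition coord_ht (c : coord) : nat :=
  match c with
  | Some (k, i, j) => (if k == j0 then i.+1 else match nat_of_ord i with 0 => 5 | 1 => 4 | _ => 3 end) + (j == j0)
  | None => 0
  end.

Definition X_ht j p q : nat := p + q + (j == j0).

Definition mnm_ht m : nat := (\sum_c coord_ht c * m (enum_rank c))%N.

Definition ht_ge (n : nat) f : Prop := forall m, f@_m != 0 -> (n <= mnm_ht m)%N.

Lemma ht_ge_le n n' f : (n <= n')%N -> ht_ge n' f -> ht_ge n f.
Proof. by move=> le_nn' hf m /hf; apply: leq_trans. Qed.

Lemma ht_ge0 n : ht_ge n 0.
Proof. by move=> m; rewrite mcoeff0 eqxx. Qed.

Lemma ht_geD n f g : ht_ge n f -> ht_ge n g -> ht_ge n (f + g).
Proof.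
move=> hf hg m; rewrite mcoeffD => nz.
have [f0|nf] := eqVneq f@_m 0; last exact: hf.
by apply: hg; move: nz; rewrite f0 add0r.
Qed.

Lemma ht_geC n a f : ht_ge n f -> ht_ge n (a%:MP * f).
Proof. by move=> hf m; rewrite mcoeffCM mulf_eq0 negb_or => /andP[_ /hf]. Qed.

Lemma ht_geN n f : ht_ge n f -> ht_ge n (- f).
Proof. by move=> hf m; rewrite mcoeffN oppr_eq0 => /hf. Qed.

Lemma ht_ge_sum n I (r : seq I) (P : pred I) (f : I -> poly) :
  (forall a : I, P a -> ht_ge n (f a)) -> ht_ge n (\sum_(a <- r | P a) f a).
Proof. by move=> hf; apply: big_ind => //; [apply: ht_ge0 | apply: ht_geD]. Qed.

Lemma mnm_htU m c : mnm_ht (m + U_(enum_rank c)) = (mnm_ht m + coord_ht c)%N.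
Proof.
rewrite /mnm_ht (bigD1 c) //= [in RHS](bigD1 c) //= mnmDE mnm1E eqxx mulnDr muln1.
rewrite addnAC; congr (_ + _ + _)%N; apply: eq_bigr => c' ne.
by rewrite mnmDE mnm1E (inj_eq enum_rank_inj) eq_sym (negPf ne) addn0.
Qed.

Lemma ht_ge_pder n c f : ht_ge n f -> ht_ge (n - coord_ht c) (pder c f).
Proof.
move=> hf m; rewrite /pder mcoeff_deriv => nz; rewrite leq_subLR addnC -mnm_htU; apply: hf.
by apply: contraNneq nz => ->; rewrite mul0rn.
Qed.

Lemma ht_ge_var n c f : ht_ge n f -> ht_ge (n + coord_ht c) (var c * f).
Proof.
move=> hf m; have := mcoeff_msupp (var c * f) m; rewrite mulrC => <-.
rewrite /var (perm_mem (msuppMX _ _)) => /mapP[m' fm' ->].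
by rewrite addmC mnm_htU leq_add2r; apply: hf; rewrite -mcoeff_msupp.
Qed.

Lemma ht_ge_dX n j p q f : ht_ge n f -> ht_ge (n - X_ht j p q) (dX j p q f).
Proof.
move=> hf; have hpder d c : coord_ht c = d -> ht_ge (n - d) (pder c f).
  by move=> <-; apply: ht_ge_pder.
move: p q; do 2!apply: ord4_ind; rewrite /dX /skew4 /=; try (exact: ht_ge0).
all: do ?apply: ht_geN; exact: hpder.
Qed.

Lemma ht_ge_X n j p q f : ht_ge n f -> ht_ge (n + X_ht j p q) (X j p q * f).
Proof.
move=> hf; have hvar d c : coord_ht c = d -> ht_ge (n + d) (var c * f).
  by move=> <-; apply: ht_ge_var.
move: p q; do 2!apply: ord4_ind; rewrite XE /skew4 /= ?mulNr ?opprK ?mul0r; try (exact: ht_ge0).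
all: do ?apply: ht_geN; exact: hvar.
Qed.

Lemma ht_ge_XdX n d k j r p q q' f : (X_ht j p q + d <= X_ht k r q')%N ->
  ht_ge n f -> ht_ge (n + d) (X k r q' * dX j p q f).
Proof.
move=> le hf; apply: (ht_ge_le _ (ht_ge_X (ht_ge_dX hf))); lia.
Qed.

Lemma ht_ge_fa n x f : strictly_upper x.1 -> strictly_upper (sl_mx x.2) ->
  ht_ge n f -> ht_ge n.+1 (fa x f).
Proof.
move=> sA sZ hf; have A0 i j : (j <= i)%N -> AA x i j = 0 by move=> le; rewrite /AA sA ?mpolyC0.
rewrite fa_explicit -addn1 /trA !A0 // addr0 mul0r addr0; apply: ht_geD; last first.
  apply: ht_geN; apply: ht_ge_sum => j _; apply: ht_ge_sum => p _; apply: ht_ge_sum => r _.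
  have [le_rp|lt_pr] := leqP r p; first by rewrite /ZZ sZ // mpolyC0 mul0r; apply: ht_ge0.
  apply: ht_geC; apply: ht_ge_sum => q _; apply: ht_ge_XdX hf; rewrite /X_ht; lia.
apply: ht_ge_sum => j _; apply: ht_ge_sum => k _.
have [le_jk|lt_kj] := leqP j k; first by rewrite A0 // mul0r; apply: ht_ge0.
apply: ht_geC.
have ek : k = j0 by apply: val_inj; move: lt_kj; case: j => [[|[|//]] //] /= _; case: (nat_of_ord k).
have ej : j = j1 by apply: val_inj; move: lt_kj; case: j => [[|[|//]] //] /= _; case: (nat_of_ord k).
by rewrite /pairing ek ej; do 5?[apply: ht_geD]; apply: ht_ge_XdX hf; rewrite /X_ht.
Qed.

(** The basis spinor f_s counts with height 3 - s, so that sl(4) raises heights on the values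
    too. *)
Definition spinor_ht_ge n psi : Prop := forall s, ht_ge (n + s - 3) (psi s).

Lemma spinor_ht_ge_act n x psi : strictly_upper x.1 -> strictly_upper (sl_mx x.2) ->
  spinor_ht_ge n psi -> spinor_ht_ge n.+1 (spinor_act x psi).
Proof.
move=> sA sZ hpsi s; rewrite spinor_actP.
have -> : trA x = 0 by rewrite /trA /AA !sA // mpolyC0 addr0.
rewrite mulr0 mul0r add0r; apply: ht_geD; last first.
  by apply: (ht_ge_le _ (ht_ge_fa sA sZ (hpsi s))); lia.
apply: ht_ge_sum => r _; have [le_rs|lt_sr] := leqP r s.
  by rewrite /ZZ sZ // mpolyC0 mul0r; apply: ht_ge0.
by apply: ht_geC; apply: (ht_ge_le _ (hpsi r)); lia.
Qed.

Lemma mnm_ht_le m : (mnm_ht m <= 6 * mnm_deg m)%N.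
Proof.
rewrite /mnm_ht /mnm_deg big_distrr /=; apply: leq_sum => c _; rewrite mulnA leq_mul2r.
apply/orP; right; case: c => [[[k i] j]|] //=.
by case: (j == j0); case: (k == j0); case: i => [[|[|[|//]]] //].
Qed.

Lemma monogenic_nilpotent n :
  nilpotent_on (@spinor_act F) (prod_pred (@gl_np F) (@sl_np F)) (@monogenic_of_degree F n).
Proof.
(* Coordinates have height at most 6 per unit of degree and basis spinors height at most 3, so a
   nonzero spinor of degree n has height at most 6n + 3. *)
exists (6 * n + 4)%N, (fun h psi => homog_spinor n psi /\ spinor_ht_ge h psi); split.
- move=> psi /monogenic_of_degreeE[_ hom]; split=> // s m _; have := ltn_ord s; lia.
- move=> psi [hom hpsi]; apply/ffunP=> s; rewrite ffunE; apply/mpolyP=> m; rewrite mcoeff0.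
  apply/eqP/negPn/negP => nz; have := hpsi s m nz; have := mnm_ht_le m.
  have /dhomogP hf := (dhomog_euler n (psi s)).2 (hom s).
  have -> : mnm_deg m = n by apply: hf; rewrite mcoeff_msupp.
  have := ltn_ord s; lia.
- move=> x h psi [sA sZ] [hom hpsi]; split; last exact: spinor_ht_ge_act.
  exact: homog_spinor_act.
Qed.

Lemma mdeg_le_mnm_deg m : (mdeg m <= mnm_deg m)%N.
Proof.
rewrite mdegE /mnm_deg (reindex (@enum_rank {: coord})) /=; last first.
  by apply: onW_bij; exists enum_val; [apply: enum_rankK | apply: enum_valK].
by apply: leq_sum => -[[[k i] j]|] _; rewrite /= ?mul1n // leq_pmull.
Qed.

Section BoundedSpinors.
Variable n : nat.
Local Notation T := ('I_4 * 'X_{1..N < n.+1})%type.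

Definition mono_spinor (a : 'I_#|{: T}|) : spinor F :=
  [ffun s => if s == (enum_val a).1 then 'X_[(enum_val a).2] else 0].

Lemma lincomb_mono_spinor (c : 'cV_#|{: T}|) s m : 
  (lincomb mono_spinor c s)@_m =
    if insub m is Some b then c (enum_rank (s, b : 'X_{1..N < n.+1})) 0 else 0.
Proof.
rewrite /lincomb sum_ffunE raddf_sum /=.
have E a : ((c a 0 *: mono_spinor a) s)@_m =
    c a 0 * (if (s == (enum_val a).1) && ((enum_val a).2 == m :> 'X_{1..N}) then 1 else 0).
  by rewrite !ffunE mcoeffZ; case: eqP => _ /=; rewrite ?mcoeff0 // mcoeffX; case: eqP.
under eq_bigr do rewrite E.
case: insubP => [b lt_m Db|nlt].
  rewrite (bigD1 (enum_rank (s, b))) //= enum_rankK /= eqxx Db eqxx mulr1 big1 ?addr0 // => a ne.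
  case: andP => [[/eqP Ds /eqP Dm]|]; last by rewrite mulr0.
  case/eqP: ne; rewrite -[a]enum_valK; congr enum_rank; case: (enum_val a) Ds Dm => s' b' /= <- Db'.
  by congr (_, _); apply: val_inj; rewrite /= Db' Db.
rewrite big1 // => a _; case: andP => [[_ /eqP Dm]|]; last by rewrite mulr0.
by case/negP: nlt; rewrite -Dm; case: (enum_val a) => s' [b' lt_b'].
Qed.

Lemma mono_spinor_basis : is_basis mono_spinor (fun psi => forall s m, (n < mdeg m)%N -> (psi s)@_m = 0).
Proof.
split=> [c lc0|psi].
  apply/colP=> a; rewrite mxE; have := lincomb_mono_spinor c (enum_val a).1 (enum_val a).2.
  by rewrite lc0 ffunE mcoeff0 valK -surjective_pairing enum_valK.
split=> [hpsi|[c ->] s m lt_nm]; last first.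
  by rewrite lincomb_mono_spinor insubF // ltnS leqNgt lt_nm.
exists (\col_(a < #|{: T}|) (psi (enum_val a).1)@_(enum_val a).2); apply/ffunP=> s; apply/mpolyP=> m.
rewrite lincomb_mono_spinor; case: insubP => [b lt_m Db|]; first by rewrite mxE enum_rankK /= Db.
by rewrite -ltnNge => /hpsi->.
Qed.

End BoundedSpinors.

(** Every coordinate has weighted degree at least 1, so the weighted degree bounds the total degree
    and only finitely many monomials occur. *)
Lemma monogenic_finite n : exists d (b : 'I_d -> spinor F), is_basis b (@monogenic_of_degree F n).
Proof.
apply: (subspace_basis (mono_spinor_basis n) (monogenic_of_degree_subspace F n)).
move=> psi /monogenic_of_degreeE[_ hom] s m lt_nm.
have hf := (dhomog_euler n (psi s)).2 (hom s).
apply: (dhomog_nemf_coeff hf); rewrite neq_ltn orbC.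
by rewrite (leq_trans lt_nm) // mdeg_le_mnm_deg.
Qed.

End Finiteness.

(** * The decomposition *)

Section CyclicSums.
Variables (K : numClosedFieldType) (S : lmodType K) (form : hermitian_form S).
Variables (g : lieAlgebra K) (star : g -> g) (np nm bo : g -> Prop).
Variable act : g -> S -> S.
Hypothesis uact : unitary_action form star np nm bo act.
Variables (I : eqType) (v : I -> S) (M : S -> Prop).
Hypothesis hv : forall i, hw_vector np bo act (v i).
Hypothesis orth_v : forall i j, i != j -> form (v i) (v j) = 0.

Lemma iso_direct_sum_cyclic (T : I -> lieModule g) (Phi : forall i, {linear T i -> S}) :
  (forall i, equivariant (@lmod_act _ _ (T i)) act (Phi i)) ->
  (forall i, injective (Phi i)) ->
  (forall i u, cyclic act (v i) u <-> exists t, u = Phi i t) ->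
  stable act M -> (forall i, M (v i)) ->
  (forall w, M w -> exists (s : seq I) (u : I -> S),
     [/\ uniq s, forall i, cyclic act (v i) (u i) & w = \sum_(i <- s) u i]) ->
  iso_direct_sum act M T.
Proof.
move=> Phi_eq Phi_inj imPhi stM Mv decM; exists Phi; split=> [||s t uniq_s sum0 i si].
- exact: Phi_eq.
- move=> w; split=> [/decM[s [u [uniq_s cu ->]]]|[s [t [_ ->]]]]; last first.
    apply: (@subspace_sum _ _ M _ _ _ _ stM.1) => i _.
    have : cyclic act (v i) (Phi i (t i)) by apply/imPhi; exists (t i).
    by apply.
  pose c i := constructive_indefinite_description _ ((imPhi i (u i)).1 (cu i)).
  exists s, (fun i => sval (c i)); split=> //.
  by apply: eq_bigr => i _; apply: (svalP (c i)).
- apply: (Phi_inj i); rewrite linear0.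
  apply: (cyclic_independent uact hv orth_v uniq_s _ sum0) => // j.
  by apply/imPhi; exists (t j).
Qed.

End CyclicSums.

Local Notation index := (nat * nat * nat)%type.

Section HighestWeightModules.
Variable F : numClosedFieldType.
Local Notation act := (@spinor_act F).
Implicit Types (x : g0 F) (s : index).

Definition index_deg s : nat := (2 * s.1.1 + s.1.2 + 2 * s.2)%N.
Definition hwv s : spinor F := hw_spinor F s.1.1 s.1.2 s.2.
Definition hww s x : F := hw_weight s.1.1 s.1.2 s.2 x.

Lemma hwv_act s x : upper_triangular x.1 -> upper_triangular (sl_mx x.2) ->
  act x (hwv s) = hww s x *: hwv s.
Proof. exact: hw_spinor_act. Qed.

Lemma hwv_neq0 s : hwv s != 0.
Proof. exact: hw_spinor_neq0. Qed.

Lemma hwv_hw_vector s : hw_vector (prod_pred (@gl_np F) (@sl_np F))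
  (prod_pred (@gl_bo F) (@sl_bo F)) act (hwv s).
Proof.
split; first exact: hwv_neq0.
  by move=> x [upA upZ]; apply: hw_spinor_singular.
by move=> x [upA upZ]; exists (hww s x); apply: hwv_act.
Qed.

Lemma hwv_monogenic s : monogenic_of_degree (index_deg s) (hwv s).
Proof. exact: hw_spinor_monogenic. Qed.

Lemma hww_star s x : hww s (g0_star x) = (hww s x)^*.
Proof. by rewrite /hww /hw_weight /= !mxE !(rmorphD, rmorphM, fmorphV, rmorph_nat). Qed.

Lemma coroot_traceless (p q : 'I_4) : (delta_mx p p - delta_mx q q : 'M[F]_4) \in @traceless F 4.
Proof.
have tr1 r : \tr (delta_mx r r : 'M[F]_4) = 1.
  by rewrite /mxtrace (bigD1 r) //= big1 ?addr0 ?mxE ?eqxx // => i /negPf ne; rewrite mxE ne.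
by rewrite inE raddfB /= !tr1 subrr.
Qed.

Definition coroot p q : sl F 4 := SlMx (coroot_traceless p q).

Lemma coroot_star p q : sl_star (coroot p q) = coroot p q.
Proof.
apply/val_inj/matrixP=> i j; rewrite !mxE rmorphB /= !rmorph_nat.
by rewrite ![(j == _) && _]andbC.
Qed.

Lemma diag_upper n (A : 'M[F]_n) : is_diag_mx A -> upper_triangular A.
Proof. by move=> /is_diag_mxP dA i j lt; apply: dA; rewrite neq_ltn lt orbT. Qed.

Lemma delta_diag n (p : 'I_n) : is_diag_mx (delta_mx p p : 'M[F]_n).
Proof.
apply/is_diag_mxP=> i j ne; rewrite mxE; case: andP => // -[/eqP ip /eqP jp].
by rewrite ip jp eqxx in ne.
Qed.

Lemma coroot_diag p q : is_diag_mx (sl_mx (coroot p q)).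
Proof.
have /is_diag_mxP dp := delta_diag p; have /is_diag_mxP dq := delta_diag q.
by apply/is_diag_mxP=> i j ne; move: (dp _ _ ne) (dq _ _ ne); rewrite !mxE => -> ->; rewrite subrr.
Qed.

(** Two coroots of sl(4) recover a + 1 and b, and a diagonal unit of gl(2) then recovers l. The test
    elements are self-adjoint, so that agreement on such elements suffices in [hwv_orth]. *)
Lemma hww_inj s s' :
  (forall x, g0_star x = x -> is_diag_mx x.1 -> is_diag_mx (sl_mx x.2) -> hww s x = hww s' x) ->
  s = s'.
Proof.
case: s s' => [[a b] l] [[a' b'] l'] eq_w.
have sl_eq p q : hww (a, b, l) (0, coroot p q) = hww (a', b', l') (0, coroot p q).
  apply: eq_w; [|exact: mx0_is_diag|exact: coroot_diag].
  by congr (_, _); [case: (gl_zero F) | exact: coroot_star].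
have D0 n m : (n <= m)%N -> m%:R - n%:R = (m - n)%:R :> F by move=> ?; rewrite natrB.
have /eqP := sl_eq i0 i1; rewrite /hww /hw_weight /= !mxE /= !(oppr0, mulr0, mulr1, add0r, addr0, subr0, sub0r, mulrN1).
rewrite !D0 ?eqr_nat; [move=> ea | lia..].
have /eqP := sl_eq i1 i2; rewrite /hww /hw_weight /= !mxE /= !(oppr0, mulr0, mulr1, add0r, addr0, subr0, sub0r, mulrN1).
rewrite !D0 ?eqr_nat; [move=> eb | lia..].
have : hww (a, b, l) (delta_mx j0 j0, 0) = hww (a', b', l') (delta_mx j0 j0, 0).
  apply: eq_w; [|exact: delta_diag|exact: mx0_is_diag].
  congr (_, _); last by case: (sl_zero F).
  by apply/matrixP=> i j; rewrite !mxE rmorph_nat andbC.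
rewrite /hww /hw_weight /= !mxE /= !(mulr0, mulr1, add0r, addr0, subr0).
move/addrI/eqP; rewrite eqr_nat => el.
by congr (_, _, _); lia.
Qed.

(** Eigenvectors of self-adjoint operators for different eigenvalues are orthogonal. *)
Lemma hwv_orth s s' : s != s' -> fischer F (hwv s) (hwv s') = 0.
Proof.
move=> ne; apply/eqP/negPn/negP => nz; case/eqP: ne; apply: hww_inj => x sx dA dZ.
have uA := diag_upper dA; have uZ := diag_upper dZ.
have := fischer_adjoint x (hwv s) (hwv s').
rewrite sx !hwv_act // hformZl hformZr -hww_star sx.
by move/mulIf; apply.
Qed.

Lemma hwv_module s : exists (W : mxLieRep (gl F 2)) (V : mxLieRep (sl F 4))
    (Phi : {linear tensor_module W V -> spinor F}),
  [/\ is_irrep_gl W (W_weight F s), is_irrep_sl V (V_weight F s),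
      irreducible_module (tensor_module W V),
      equivariant (@lmod_act _ _ (tensor_module W V)) act Phi
    & injective Phi /\ forall u, cyclic act (hwv s) u <-> exists m, u = Phi m].
Proof.
have [d [b bM]] := monogenic_finite F (index_deg s).
have [W [V [Phi [[irrW irrV irrWV] [w nz_w ww] [v nz_v wv] Phi_eq Phi_iso]]]] :=
  tensor_isomorphism (spinor_unitary F) (gl_zero F) (sl_zero F) (hwv_hw_vector s)
    (monogenic_of_degree_stable F (index_deg s)) (hwv_monogenic s) bM
    (monogenic_nilpotent F (index_deg s)).
have up0 n : upper_triangular (0 : 'M[F]_n) by move=> i j _; rewrite mxE.
have su n (A : 'M[F]_n) : strictly_upper A -> upper_triangular A.
  by move=> sA i j lt; apply/sA/ltnW.
exists W, V, Phi; split=> //; split=> //; [exists w | exists v]; split=> // x xP.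
- rewrite (ww x 0) ?scale0r // /act_fst hwv_act //=; last exact: su.
  by rewrite /hww /hw_weight /= !xP // !mxE !mulr0 !addr0 scale0r.
- apply: ww; rewrite /act_fst hwv_act //=; last exact: diag_upper.
  congr (_ *: _); rewrite /hww /hw_weight /= sum_ord2 !mxE !mulr0 !addr0 ?scale0r.
  by case: (s) => [[a c] l].
- rewrite (wv x 0) ?scale0r // /act_snd hwv_act //=; last exact: su.
  by rewrite /hww /hw_weight /= !xP // !mxE !mulr0 !addr0 ?scale0r.
- apply: wv; rewrite /act_snd hwv_act //=; last exact: diag_upper.
  congr (_ *: _); rewrite /hww /hw_weight /= sum_ord4 !mxE !mulr0 !add0r.
  by case: (s) => [[a c] l]; rewrite mul0r addr0.
Qed.

Let W_spec s := constructive_indefinite_description _ (hwv_module s).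
Definition W_mod s : mxLieRep (gl F 2) := sval (W_spec s).
Let V_spec s := constructive_indefinite_description _ (svalP (W_spec s)).
Definition V_mod s : mxLieRep (sl F 4) := sval (V_spec s).
Let emb_spec s := constructive_indefinite_description _ (svalP (V_spec s)).
Definition emb s : {linear tensor_module (W_mod s) (V_mod s) -> spinor F} := sval (emb_spec s).

Lemma embP s :
  [/\ is_irrep_gl (W_mod s) (W_weight F s), is_irrep_sl (V_mod s) (V_weight F s),
      irreducible_module (tensor_module (W_mod s) (V_mod s)),
      equivariant (@lmod_act _ _ (tensor_module (W_mod s) (V_mod s))) act (emb s)
    & injective (emb s) /\ forall u, cyclic act (hwv s) u <-> exists m, u = emb s m].
Proof. exact: (svalP (emb_spec s)). Qed.

(** An isomorphism carries one highest weight vector to a singular vector of the same weight. By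
    [cyclic_singular] this is a multiple of the other highest weight vector, so the weights
    agree. *)
Lemma tensor_module_inj s s' :
  isomorphic_modules (tensor_module (W_mod s) (V_mod s)) (tensor_module (W_mod s') (V_mod s')) ->
  s = s'.
Proof.
case=> f [f_bij f_eq]; have [_ _ _ emb_eq [emb_inj imemb]] := embP s.
have [_ _ _ emb_eq' [emb_inj' imemb']] := embP s'.
have [m Dm] := (imemb (hwv s)).1 (@cyclic_refl _ _ _ _ _).
have nz_fm : emb s' (f m) != 0.
  rewrite -(linear0 (emb s')) (inj_eq emb_inj') -(linear0 f) (inj_eq (bij_inj f_bij)).
  by rewrite -(inj_eq emb_inj) linear0 -Dm; apply: hwv_neq0.
have eig x c : act x (hwv s) = c *: hwv s -> act x (emb s' (f m)) = c *: emb s' (f m).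
  rewrite Dm -emb_eq -linearZ => /emb_inj; rewrite -emb_eq' -f_eq => ->.
  by rewrite !linearZ.
have cfm : cyclic act (hwv s') (emb s' (f m)) by apply/imemb'; exists (f m).
have [|c Dfm] := cyclic_singular (spinor_unitary F) (hwv_hw_vector s') cfm.
  move=> x npx; rewrite (eig x 0) ?scale0r //; have [_ -> //] := hwv_hw_vector s.
have nz_c : c != 0 by apply: contraNneq nz_fm => c0; rewrite Dfm c0 scale0r.
apply: hww_inj => x _ dA dZ; have uA := diag_upper dA; have uZ := diag_upper dZ.
have := eig x _ (hwv_act s uA uZ).
rewrite Dfm (actZ (spinor_unitary F)) hwv_act // !scalerA => /eqP.
rewrite -subr_eq0 -scalerBl scaler_eq0 (negPf (hwv_neq0 s')) orbF.
by rewrite [hww s x * c]mulrC -mulrBr mulf_eq0 (negPf nz_c) subr_eq0 => /eqP->.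
Qed.

End HighestWeightModules.

Section Decomposition.
Variable F : numClosedFieldType.
Local Notation act := (@spinor_act F).
Local Notation hwv := (hwv F).
Implicit Type s : index.

(** A solution of 2a + b + 2l = n has all three entries at most n, so a finite box contains them
    all. *)
Definition indices n : seq index :=
  undup [seq s <- [seq (p.1, p.2, l) | p <- [seq (a, b) | a <- iota 0 n.+1, b <- iota 0 n.+1],
                                       l <- iota 0 n.+1] | index_deg s == n].

Lemma mem_indices n s : (s \in indices n) = (index_deg s == n).
Proof.
rewrite mem_undup mem_filter; case: eqP => [deg_s|//]; rewrite andTb.
case: s deg_s => [[a b] l]; rewrite /index_deg [LHS]/= => deg_s.
apply/allpairsP; exists ((a, b), l); rewrite [_ \in iota _ _]mem_iota; split=> //; last by rewrite /=; lia.
by apply/allpairsP; exists (a, b); rewrite !mem_iota; split=> //=; lia.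
Qed.

Lemma singular_monogenic_sum n w : monogenic_of_degree n w ->
  singular (prod_pred (@gl_np F) (@sl_np F)) act w ->
  exists c : index -> F, w = \sum_(s <- indices n) c s *: hwv s.
Proof.
move=> Mw sw.
have sing : singular_spinor w by move=> x upA upZ; apply: sw.
apply: (singular_monogenic Mw sing (U := fun w => exists c : index -> F, w = \sum_(s <- indices n) c s *: hwv s)).
  split=> [|k _ _ [c ->] [c' ->]].
    by exists (fun=> 0); rewrite big1 // => s _; rewrite scale0r.
  exists (fun s => k * c s + c' s); rewrite scaler_sumr -big_split /=.
  by apply: eq_bigr => s _; rewrite scalerDl scalerA.
move=> a b l deg_s; exists (fun s => (s == (a, b, l))%:R).
rewrite (bigD1_seq (a, b, l)) ?undup_uniq ?mem_indices //=; last exact/eqP.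
rewrite eqxx scale1r big1 ?addr0 // => s /negPf->; by rewrite scale0r.
Qed.

Lemma monogenic_decomposition n w : monogenic_of_degree n w ->
  exists2 u : index -> spinor F, (forall s, cyclic act (hwv s) (u s)) &
    w = \sum_(s <- indices n) u s.
Proof.
have [d [b bM]] := monogenic_finite F n; have uniq_n : uniq (indices n) by apply: undup_uniq.
have Mhwv s : s \in indices n -> monogenic_of_degree n (hwv s).
  by rewrite mem_indices => /eqP <-; apply: hwv_monogenic.
exact: (cyclic_decomposition (spinor_unitary F) (@hwv_hw_vector F) (@hwv_orth F)
  (monogenic_of_degree_stable F n) bM (monogenic_nilpotent F n) uniq_n Mhwv
  (@singular_monogenic_sum n)).
Qed.

Lemma decomp_indexP k (s : decomp_index k) : index_deg (sval s) = k.
Proof. by case: s => s /= /eqP. Qed.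

Lemma monogenic_of_degree_sum k :
  iso_direct_sum act (@monogenic_of_degree F k)
    (fun s : decomp_index k => tensor_module (W_mod F (sval s)) (V_mod F (sval s))).
Proof.
pose T (s : decomp_index k) : lieModule (g0 F) :=
  tensor_module (W_mod F (sval s)) (V_mod F (sval s)).
pose Phi (s : decomp_index k) : {linear T s -> spinor F} := emb F (sval s).
have hv (s : decomp_index k) := hwv_hw_vector F (sval s).
have orth (s s' : decomp_index k) (ne : s != s') : fischer F (hwv (sval s)) (hwv (sval s')) = 0 :=
  hwv_orth F ne.
apply: (iso_direct_sum_cyclic (spinor_unitary F) hv orth (T := T) (Phi := Phi)).
- by move=> s; case: (embP F (sval s)).
- by move=> s; case: (embP F (sval s)) => _ _ _ _ [].
- by move=> s; case: (embP F (sval s)) => _ _ _ _ [].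
- exact: monogenic_of_degree_stable.
- by move=> s; rewrite -[X in monogenic_of_degree X](decomp_indexP s); apply: hwv_monogenic.
move=> w /monogenic_decomposition[u cu ->].
pose r : seq (decomp_index k) := pmap insub (indices k).
exists r, (fun s : decomp_index k => u (sval s)); split=> //.
  by apply: pmap_sub_uniq; apply: undup_uniq.
rewrite -(big_map val xpredT u) (pmap_filter (insubK _)); congr bigop; symmetry; apply/all_filterP/allP => s.
by rewrite mem_indices /= => deg_s; rewrite insubT.
Qed.

Lemma monogenic_stable : stable act (@monogenic F).
Proof. by split; [apply: monogenic_subspace | move=> x u; apply: monogenic_act]. Qed.

Lemma monogenic_sum_decomposition w : monogenic_sum w ->
  exists (s : seq index) (u : index -> spinor F),
    [/\ uniq s, forall i, cyclic act (hwv i) (u i) & w = \sum_(i <- s) u i].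
Proof.
case=> n [phi [Mphi ->]].
suff [s [u [us cu deg_s ->]]] : exists (s : seq index) (u : index -> spinor F),
    [/\ uniq s, forall i, cyclic act (hwv i) (u i), forall i, i \in s -> (index_deg i < n)%N
      & \sum_(k < n) phi k = \sum_(i <- s) u i] by exists s, u.
elim: n => [|n [s [u [us cu deg_s sum_u]]]].
  by exists [::], hwv; split=> //; [move=> i; apply: cyclic_refl | rewrite big_ord0 big_nil].
have [u' cu' Dphi] := monogenic_decomposition (Mphi n).
(* Indices of different degrees are distinct, so the degree of an index tells which family of
   components applies. *)
exists (s ++ indices n), (fun i => if index_deg i == n then u' i else u i); split.
- rewrite cat_uniq us undup_uniq andbT; apply/hasPn => i; rewrite mem_indices => /eqP di.
  by apply/negP=> /deg_s; rewrite di ltnn.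
- by move=> i; case: ifP.
- by move=> i; rewrite mem_cat mem_indices => /orP[/deg_s/ltnW|/eqP->].
rewrite big_ord_recr /= sum_u Dphi big_cat; congr (_ + _); apply: eq_big_seq => i.
  by move/deg_s => lt; rewrite ltn_eqF.
by rewrite mem_indices => ->.
Qed.

Lemma monogenic_multiplicity_free : multiplicity_free act (@monogenic_sum F).
Proof.
exists index, (fun s => tensor_module (W_mod F s) (V_mod F s)); split.
- by move=> s; case: (embP F s).
- exact: (@tensor_module_inj F).
apply: (iso_direct_sum_cyclic (spinor_unitary F) (@hwv_hw_vector F) (@hwv_orth F) (Phi := @emb F)).
- by move=> s; case: (embP F s).
- by move=> s; case: (embP F s) => _ _ _ _ [].
- by move=> s; case: (embP F s) => _ _ _ _ [].
- have [[m0 mlin] mact] := monogenic_stable.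
  split=> [|x u /monogenic_sumE mu]; last by apply/monogenic_sumE/mact.
  split=> [|a u w /monogenic_sumE mu /monogenic_sumE mw]; apply/monogenic_sumE => //.
  exact: mlin.
- by move=> s; rewrite monogenic_sumE; case: (hwv_monogenic F s).
- exact: monogenic_sum_decomposition.
Qed.

End Decomposition.


Theorem theorem6p1 (R : realType) :
  (forall k : nat,
     exists (W : decomp_index k -> mxLieRep (gl R[i] 2))
            (V : decomp_index k -> mxLieRep (sl R[i] 4)),
       [/\ forall t, is_irrep_gl (W t) (W_weight R[i] (sval t)),
           forall t, is_irrep_sl (V t) (V_weight R[i] (sval t)),
           forall t, irreducible_module (tensor_module (W t) (V t))
         & iso_direct_sum (@spinor_act R[i]) (@monogenic_of_degree R[i] k)
             (fun t => tensor_module (W t) (V t))]) /\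
  (forall psi : spinor R[i], monogenic_sum psi <-> monogenic psi) /\
  multiplicity_free (@spinor_act R[i]) (@monogenic_sum R[i]).
Proof.
split=> [k|]; last by split; [apply: monogenic_sumE | apply: monogenic_multiplicity_free].
exists (fun t => W_mod R[i] (sval t)), (fun t => V_mod R[i] (sval t)); split.
- by move=> s; case: (embP R[i] (sval s)).
- by move=> s; case: (embP R[i] (sval s)).
- by move=> s; case: (embP R[i] (sval s)).
- exact: monogenic_of_degree_sum.
Qed.
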